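(* Let $\mathcal H$ be a real separable Hilbert space and $\{X_k\}_{k\in\mathbb Z}$ a zero-mean, stationary Gaussian process with values in $\mathcal H$ and nondegenerate covariance operator $Q$ with orthonormal eigenvectors $\{v_j\}_{j\in\mathbb N}$ (forming a basis of $\mathcal H$) and corresponding positive eigenvalues $\{\lambda_j\}_{j\in\mathbb N}$. Let $\hat\lambda_{jn}=\frac1n\sum_{k=1}^n\langle X_k,v_j\rangle_{\mathcal H}^2$ and $G_j[x]=\langle x,v_j\rangle_{\mathcal H}^2-\lambda_j$. Suppose that $$\sum_{v\in\mathbb Z}\|\Gamma(v)\|_{\mathcal S_1(\mathcal H)}^2<\infty .$$ Then: (a) For every $j\in\mathbb N$, as $n\to\infty$, $\sqrt n(\hat\lambda_{jn}-\lambda_j)\xrightarrow{d}\mathcal N(0,\sigma_j^2)$, where $\sigma_j^2=\mathrm E\,G_j^2[X_1]+2\sum_{k=1}^\infty\mathrm E\,G_j[X_1]G_j[X_{k+1}]$. (b) With $\lambda=(\lambda_1,\lambda_2,\dots)$ and $\hat\lambda_n=(\hat\lambda_{1n},\hat\lambda_{2n},\dots)$, as $n\to\infty$, $$\sqrt n(\hat\lambda_n-\lambda)\xrightarrow{d}S\quad\text{in }\ell^2(\mathbb N),$$ where $S$ is a centered Gaussian element of $\ell^2(\mathbb N)$ whose covariance operator $\mathcal T_S$ satisfies, for the canonical basis $\{\psi_j\}$ of $\ell^2(\mathbb N)$, $$\langle\mathcal T_S(\psi_i),\psi_j\rangle_{\ell^2(\mathbb N)}=\sum_{v\in\mathbb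 Z}\mathrm E\big(G_i[X_0]\,G_j[X_v]\big).$$
   Context: $Q=\mathrm E(X_1\otimes X_1)$ and $\Gamma(v)=\mathrm E(X_{1+v}\otimes X_1)$, $v\in\mathbb Z$, with the convention $(x\otimes y)h=\langle h,y\rangle x$. Nondegenerate means $\ker Q=\{0\}$. $\mathcal S_1(\mathcal H)$ is the trace class with norm $\operatorname{Tr}|T|$. *)

(* Defs.v *)
From HB Require Import structures.
From mathcomp Require Import all_boot all_order all_algebra.
From mathcomp Require Import all_classical all_reals all_analysis.
From mathcomp Require Import ring lra.

Set Implicit Arguments.
Unset Strict Implicit.
Unset Printing Implicit Defensive.

Import Order.TTheory GRing.Theory Num.Theory.
Import numFieldNormedType.Exports.

Local Open Scope classical_set_scope.
Local Open Scope ring_scope.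

HB.mixin Record NormedModule_isHilbert (R : realType) H
    & NormedModule R H := {
  inner : {dot H for (@idfun R)} ;
  inner_normE : forall x : H, inner x x = `|x| ^+ 2
}.

#[short(type="hilbertType")]
HB.structure Definition Hilbert (R : realType) :=
  {H of CompleteNormedModule R H & NormedModule_isHilbert R H}.

Definition separable (T : topologicalType) : Prop :=
  exists2 D : set T, countable D & dense D.

Section l2_def.
Variable R : realType.

Definition square_summable : {pred R^nat} :=
  mem [set x : R^nat | cvgn (series (fun k => x k ^+ 2))].

Lemma square_summableP (x : R^nat) :
  reflect (cvgn (series (fun k => x k ^+ 2))) (x \in square_summable).
Proof. by apply: (iffP idP) => [/set_mem|?]; last exact/mem_set. Qed.

Lemma square_summable_mul (x y : R^nat) : x \in square_summable ->
  y \in square_summable -> cvgn (series (fun k => x k * y k)).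
Proof.
move=> /square_summableP cx /square_summableP cy.
apply: normed_cvg.
apply: (@series_le_cvg _ _ (fun k => x k ^+ 2 + y k ^+ 2)) => //= [n|n|].
- by rewrite addr_ge0 ?sqr_ge0.
- rewrite normrM -(real_normK (num_real (x n))) -(real_normK (num_real (y n))).
  have := sqr_ge0 (`|x n| - `|y n|).
  have := normr_ge0 (x n); have := normr_ge0 (y n); nra.
- exact: is_cvg_seriesD.
Qed.

Lemma square_summable_submod : submod_closed square_summable.
Proof.
split=> [|a x y sx sy]; apply/square_summableP.
  rewrite (_ : series _ = cst 0); first exact: is_cvg_cst.
  by apply/funext => n; rewrite /series/= big1// => i _; rewrite expr0n.
rewrite (_ : (fun k => _) = a ^+ 2 *: (fun k => x k ^+ 2) +
    (a *+ 2 *: (fun k => x k * y k) + (fun k => y k ^+ 2))).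
  apply: is_cvg_seriesD; first exact/is_cvg_seriesZ/square_summableP.
  apply: is_cvg_seriesD; last exact/square_summableP.
  exact/is_cvg_seriesZ/square_summable_mul.
apply/funext => k; rewrite !fctE /=.
by rewrite /GRing.scale/=; ring.
Qed.

HB.instance Definition _ :=
  GRing.isSubmodClosed.Build R R^nat square_summable square_summable_submod.

Record l2 := L2 { l2_fun :> nat -> R ; _ : l2_fun \in square_summable }.

HB.instance Definition _ := [isSub for l2_fun].
HB.instance Definition _ := [Choice of l2 by <:].
HB.instance Definition _ := [SubChoice_isSubLmodule of l2 by <:].

Definition l2_inner (x y : l2) : R := limn (series (fun k => x k * y k)).

Lemma l2P (x : l2) : (x : nat -> R) \in square_summable.
Proof. exact: valP. Qed.

Lemma l2_cvg (x y : l2) : cvgn (series (fun k => x k * y k)).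
Proof. by apply: square_summable_mul; exact: l2P. Qed.

Lemma l2_innerC x y : l2_inner x y = l2_inner y x.
Proof. by congr (limn (series _)); apply/funext => k; rewrite mulrC. Qed.

Lemma l2_innerP a x y z :
  l2_inner (a *: x + y) z = a * l2_inner x z + l2_inner y z.
Proof.
rewrite /l2_inner -[a * _]/(a *: _) -lim_seriesZ; last exact: l2_cvg.
rewrite -lim_seriesD; [|exact/is_cvg_seriesZ/l2_cvg|exact: l2_cvg].
congr (limn (series _)); apply/funext => k.
by rewrite !fctE /GRing.scale/= mulrDl mulrA.
Qed.

Lemma l2_bilinear : bilinear_for *%R (idfun \; *%R) l2_inner.
Proof.
split=> [z a x y|z a x y]; first exact: l2_innerP.
by rewrite l2_innerC l2_innerP !(l2_innerC z).
Qed.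

HB.instance Definition _ :=
  bilinear_isBilinear.Build R l2 l2 R *%R (idfun \; *%R) l2_inner l2_bilinear.

Lemma l2_hermitian x y : l2_inner x y = (-1) ^+ false * idfun (l2_inner y x).
Proof. by rewrite expr0 mul1r l2_innerC. Qed.

HB.instance Definition _ :=
  isHermitianSesquilinear.Build R l2 false idfun l2_inner l2_hermitian.

Lemma l2_psum_le (x : l2) n : \sum_(k < n) x k ^+ 2 <= l2_inner x x.
Proof.
have -> : \sum_(k < n) x k ^+ 2 = series (fun k => x k * x k) n.
  by rewrite /series/= big_mkord.
apply: nondecreasing_cvgn_le; last exact: l2_cvg.
by apply: nondecreasing_series => k _ _; rewrite -expr2 sqr_ge0.
Qed.

Lemma l2_coord_le (x : l2) k : x k ^+ 2 <= l2_inner x x.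
Proof.
apply: le_trans (l2_psum_le x k.+1); rewrite big_ord_recr/= lerDr.
by apply: sumr_ge0 => i _; rewrite sqr_ge0.
Qed.

Lemma l2_inner_ge0 x : 0 <= l2_inner x x.
Proof. exact: le_trans (sqr_ge0 _) (l2_coord_le x 0). Qed.

Lemma l2_inner_eq0 x : l2_inner x x = 0 -> x = 0.
Proof.
move=> x0; apply/val_inj/funext => k /=.
by apply/eqP; rewrite -sqrf_eq0 eq_le sqr_ge0 andbT -x0 l2_coord_le.
Qed.

Lemma l2_inner_gt0 x : x != 0 -> 0 < l2_inner x x.
Proof.
move=> x0; rewrite lt_neqAle l2_inner_ge0 andbT eq_sym.
by apply: contra x0 => /eqP/l2_inner_eq0/eqP.
Qed.

HB.instance Definition _ := isDotProduct.Build R l2 l2_inner l2_inner_gt0.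

Lemma l2_CauchySchwarz x y : l2_inner x y ^+ 2 <= l2_inner x x * l2_inner y y.
Proof.
have [->|/l2_inner_gt0 y0] := eqVneq y 0.
  by rewrite linear0r expr0n mulr_ge0 ?l2_inner_ge0.
set t := l2_inner x y / l2_inner y y.
have := l2_inner_ge0 (- t *: y + x).
rewrite l2_innerP (l2_innerC y) (l2_innerC x) !l2_innerP (l2_innerC y x).
have tE : t * l2_inner y y = l2_inner x y by rewrite divfK// gt_eqF.
have := tE; have := y0; move: (l2_inner x x) (l2_inner y y) (l2_inner x y) => a b c.
by move=> b0 <-; nra.
Qed.

Definition l2_norm (x : l2) : R := Num.sqrt (l2_inner x x).

Lemma l2_norm_ge0 x : 0 <= l2_norm x. Proof. exact: sqrtr_ge0. Qed.

Lemma l2_normE x : l2_norm x ^+ 2 = l2_inner x x.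
Proof. by rewrite sqr_sqrtr// l2_inner_ge0. Qed.

Lemma l2_ler_normD x y : l2_norm (x + y) <= l2_norm x + l2_norm y.
Proof.
rewrite -(@ler_pXn2r _ 2)// ?nnegrE ?addr_ge0 ?l2_norm_ge0//.
rewrite sqrrD !l2_normE linearDl !linearDr/= (l2_innerC y x).
have : l2_inner x y <= l2_norm x * l2_norm y.
  rewrite (le_trans (ler_norm _))// -(@ler_pXn2r _ 2)// ?nnegrE ?mulr_ge0 ?l2_norm_ge0//.
  by rewrite real_normK ?num_real// exprMn !l2_normE l2_CauchySchwarz.
by lra.
Qed.

Lemma l2_normrZ a x : l2_norm (a *: x) = `|a| * l2_norm x.
Proof.
rewrite /l2_norm -sqrtr_sqr -sqrtrM ?sqr_ge0//; congr Num.sqrt.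
by rewrite linearZl_LR linearZr_LR/= mulrA expr2.
Qed.

Lemma l2_normr0_eq0 x : l2_norm x = 0 -> x = 0.
Proof. by move=> x0; apply: l2_inner_eq0; rewrite -l2_normE x0 expr0n. Qed.

HB.instance Definition _ :=
  Lmodule_isNormed.Build R l2 l2_ler_normD l2_normrZ l2_normr0_eq0.

Lemma l2_normrE (x : l2) : `|x| = l2_norm x. Proof. by []. Qed.

Lemma l2_coord_norm (x : l2) k : `|x k| <= `|x|.
Proof.
rewrite l2_normrE -(@ler_pXn2r _ 2)// ?nnegrE ?l2_norm_ge0//.
by rewrite real_normK ?num_real// l2_normE l2_coord_le.
Qed.

Lemma l2_psum_norm (x : l2) n : \sum_(k < n) x k ^+ 2 <= `|x| ^+ 2.
Proof. by rewrite l2_normrE l2_normE l2_psum_le. Qed.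

Lemma l2_complete (F : set_system l2) : ProperFilter F -> cauchy F -> cvg F.
Proof.
move=> FF /cauchy_ballP Fc.
have Fsmall e : 0 < e ->
    exists2 A, F A & forall x y, A x -> A y -> `|x - y| <= e.
  move=> e0; have [[A B] /= [FA FB] ABe] := Fc _ e0.
  exists (A `&` B); first exact: filterI.
  move=> x y [Ax _] [_ By]; have := ABe (x, y) (conj Ax By).
  by rewrite /= -ball_normE/= => /ltW.
pose a k := lim ((fun x : l2 => x k) @ F).
have ca k : (fun x : l2 => x k) @ F --> a k.
  apply: R_complete; apply/cauchy_ballP => e e0.
  have [A FA Ae] := Fsmall (e / 2) (divr_gt0 e0 (ltr0n _ 2)).
  pose B := (fun x : l2 => x k) @` A.
  have FB : F [set x : l2 | B (x k)] by apply: (filterS _ FA) => x Ax; exists x.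
  exists (B, B) => // -[_ _] /= [[x Ax <-] [y Ay <-]].
  rewrite -ball_normE/=; apply: (le_lt_trans (l2_coord_norm (x - y) k)).
  by apply: le_lt_trans (Ae _ _ Ax Ay) _; lra.
have psum e A : (forall x y, A x -> A y -> `|x - y| <= e) -> F A ->
    forall x n, A x -> \sum_(k < n) (x k - a k) ^+ 2 <= e ^+ 2.
  move=> Ae FA x n Ax.
  have c : (fun y : l2 => \sum_(k < n) (x k - y k) ^+ 2) @ F -->
      \sum_(k < n) (x k - a k) ^+ 2.
    elim: n => [|n IHn].
      by under eq_fun do rewrite big_ord0; rewrite big_ord0; exact: cvg_cst.
    under eq_fun do rewrite big_ord_recr/=; rewrite big_ord_recr/=.
    apply: cvgD => //; rewrite expr2; under eq_fun do rewrite expr2.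
    by apply: cvgM; apply: cvgB => //; exact: cvg_cst.
  apply: (@closed_cvg _ _ F FF _ [set z | z <= e ^+ 2] _ _ _ c).
    exact: closed_le.
  apply: (filterS _ FA) => y Ay /=; apply: (le_trans (l2_psum_norm (x - y) n)).
  by rewrite ler_pXn2r ?nnegrE// ?Ae// (le_trans _ (Ae _ _ Ax Ay)).
have sqcvg (u : R^nat) M : (forall n, \sum_(k < n) u k ^+ 2 <= M) ->
    u \in square_summable.
  move=> uM; apply/square_summableP; apply: nondecreasing_is_cvgn.
    by apply: nondecreasing_series => k _ _; exact: sqr_ge0.
  by exists M => _ [n _ <-]; rewrite /series/= big_mkord.
have sq e A : (forall x y, A x -> A y -> `|x - y| <= e) -> F A ->
    forall x, A x -> (x : nat -> R) - a \in square_summable.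
  move=> Ae FA x Ax; apply: (sqcvg _ (e ^+ 2)) => n.
  exact: (psum _ _ Ae FA _ _ Ax).
have sa : a \in square_summable.
  have [A FA Ae] := Fsmall 1 ltr01.
  have [x Ax] := filter_ex FA.
  rewrite (_ : a = (x : nat -> R) - ((x : nat -> R) - a)); last by rewrite subKr.
  by apply: rpredB; [exact: l2P|exact: (sq _ _ Ae FA _ Ax)].
apply/cvg_ex; exists (L2 sa); apply/cvgrPdist_le => e e0.
have [A FA Ae] := Fsmall e e0.
apply: (filterS _ FA) => x Ax /=; rewrite distrC l2_normrE.
rewrite -(@ler_pXn2r _ 2)// ?nnegrE ?l2_norm_ge0 ?(ltW e0)// l2_normE.
apply: limr_le; first exact: l2_cvg.
apply: nearW => n /=; rewrite /series/= big_mkord.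
have := psum _ _ Ae FA x n Ax.
by under eq_bigr do rewrite expr2; exact.
Qed.

HB.instance Definition _ := Uniform_isComplete.Build l2 l2_complete.

Lemma l2_inner_normE (x : l2) : l2_inner x x = `|x| ^+ 2.
Proof. by rewrite l2_normrE l2_normE. Qed.

HB.instance Definition _ :=
  NormedModule_isHilbert.Build R l2 l2_inner_normE.

Lemma l2_basis_subproof (j : nat) :
  (fun k => (k == j)%:R : R) \in square_summable.
Proof.
apply/square_summableP; apply: (cvgP (1 : R)); apply/cvgrPdist_le => e e0.
exists j.+1 => // n /= jn; rewrite /series/= big_mkord (bigD1 (Ordinal jn))//=.
rewrite eqxx expr1n big1 ?addr0 ?subrr ?normr0 ?(ltW e0)// => i.
by rewrite -val_eqE/= => /negbTE ->; rewrite expr0n.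
Qed.

Definition l2_basis (j : nat) : l2 := L2 (l2_basis_subproof j).

End l2_def.

Notation borel T := (g_sigma_algebraType (@open T)).

(* [normal_prob m s] takes the standard deviation and is not the point mass at
   [m] when [s = 0]. *)
Definition gaussian_law (R : realType) (m s2 : R) :
    probability (measurableTypeR R) R :=
  if s2 == 0 then \d_(m : measurableTypeR R) : probability _ _
  else normal_prob m (Num.sqrt s2) : probability _ _.

Section random_elements.
Context {d : measure_display} {Omega : measurableType d} {R : realType}.
Variable P : probability Omega R.

Definition gaussian_rv (Y : Omega -> R) : Prop :=
  measurable_fun setT Y /\
  exists m s2 : R, 0 <= s2 /\
    forall A : set R, measurable A -> P (Y @^-1` A) = gaussian_law m s2 A.

Definition cvg_in_distribution (T : topologicalType) (Z : nat -> Omega -> T)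
    {d' : measure_display} {Omega' : measurableType d'}
    (P' : probability Omega' R) (S : Omega' -> T) : Prop :=
  forall f : T -> R, continuous f -> bounded_fun f ->
    ('E_P[f \o Z n])%E @[n --> \oo] --> ('E_P'[f \o S])%E.

Variable H : hilbertType R.

Definition gaussian_element (Y : Omega -> H) : Prop :=
  forall h : H, gaussian_rv (fun w => inner (Y w) h).

(* The Bochner expectation: an integrable random element of a separable space
   has exactly one mean, determined by its inner products. *)
Definition is_expectation (Y : Omega -> H) (m : H) : Prop :=
  P.-integrable setT (fun w => `|Y w|%:E) /\
  forall h : H, ('E_P[fun w => inner (Y w) h] = (inner m h)%:E)%E.

(* 0 when the expectation does not exist. *)
Definition hexpectation (Y : Omega -> H) : H :=
  xget 0 [set m | is_expectation Y m].

Definition tensor (x y h : H) : H := inner h y *: x.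

(* The operator E(tensor X Y), evaluated at [h]. *)
Definition cross_cov (X Y : Omega -> H) (h : H) : H :=
  hexpectation (fun w => tensor (X w) (Y w) h).

Definition cov_op (Y : Omega -> H) : H -> H := cross_cov Y Y.

Definition gaussian_process (X : int -> Omega -> H) : Prop :=
  forall (n : nat) (t : 'I_n -> int) (h : 'I_n -> H),
    gaussian_rv (fun w => \sum_(i < n) inner (X (t i) w) (h i)).

Definition stationary (X : int -> Omega -> borel H) : Prop :=
  forall (n : nat) (t : 'I_n -> int) (s : int) (B : set (n.-tuple (borel H))),
    measurable B ->
    P [set w | B [tuple X (t i + s) w | i < n]] =
    P [set w | B [tuple X (t i) w | i < n]].

End random_elements.

Section trace_norm.
Context {R : realType} {H : hilbertType R}.

Definition orthonormal_basis (e : nat -> H) : Prop :=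
  (forall i j, inner (e i) (e j) = (i == j)%:R) /\
  (forall x : H, series (fun i => inner x (e i) *: e i) @ \oo --> x).

(* A = |T|, the nonnegative self-adjoint square root of T^* T. *)
Definition is_modulus (T : H -> H) (A : {linear H -> H}) : Prop :=
  [/\ continuous A,
      forall x y, inner (A x) y = inner x (A y),
      forall x, 0 <= inner (A x) x &
      forall x y, inner (A (A x)) y = inner (T x) (T y)].

(* The trace of a nonnegative operator, which does not depend on the
   orthonormal basis [e]. *)
Definition trace (e : nat -> H) (A : H -> H) : \bar R :=
  (\sum_(0 <= j <oo) (inner (A (e j)) (e j))%:E)%E.

(* Tr |T|: a bounded operator has exactly one modulus, so that the infimum is
   over a singleton; it is +oo for a [T] that has no modulus. *)
Definition trace_norm (e : nat -> H) (T : H -> H) : \bar R :=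
  ereal_inf [set trace e A | A in [set A : {linear H -> H} | is_modulus T A]].

End trace_norm.

(* By absolute summability the order of summation is irrelevant, so that
   symmetric partial sums suffice. *)
Definition has_sumZ (R : realType) (a : int -> R) (s : R) : Prop :=
  summable [set: int] (EFin \o a) /\
  \sum_(0 <= k < n.*2.+1) a (k%:Z - n%:Z) @[n --> \oo] --> s.

Section process.
Context {d : measure_display} {Omega : measurableType d} {R : realType}.
Variables (P : probability Omega R) (H : hilbertType R).
Variables (X : int -> Omega -> H) (v : nat -> H) (lambda : nat -> R).

Definition autocov (k : int) : H -> H := cross_cov P (X (1 + k)) (X 1).

(* The eigenvalues are indexed from 0, time from 1. *)
Definition eigval_hat (n j : nat) (w : Omega) : R :=
  n%:R^-1 * \sum_(1 <= k < n.+1) inner (X k%:Z w) (v j) ^+ 2.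

Definition G (j : nat) (x : H) : R := inner x (v j) ^+ 2 - lambda j.

(* E (G_i[X_k] G_j[X_l]) *)
Definition G_cov (i j : nat) (k l : int) : R :=
  fine ('E_P[fun w => (G i (X k w) * G j (X l w))%R])%E.

Definition sigma2 (j : nat) : R :=
  G_cov j j 1 1 +
  2 * limn (fun n => \sum_(1 <= k < n) G_cov j j 1 (k.+1)%:Z).

End process.

(* Main.v *)
(* With xi_(k,j) = <X_k, v_j>, the errors Z_nj = sqrt n (hat lambda_jn - lambda_j)
   are normalized sums of centered squares of a stationary Gaussian family, and
   Isserlis' formula gives E G_i[X_0] G_j[X_k] = 2 <Gamma(k) v_i, v_j>^2.  The
   Hilbert-Schmidt norm is below the trace norm, so these covariances are
   summable over k and over i = j: E Z_ni Z_nj converges to a covariance C_ij,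
   and E Z_nj^2 <= C_jj with \sum_j C_jj finite.

   A finite linear combination of the Z_nj is a centered quadratic form Q in
   Gaussian variables.  Rotating them against an independent copy gives Stein's
   identity E Q sin(Q + b) = 2 E V cos(Q + b), with V the carre du champ; hence
   E cos(Q + b) differs from the Gaussian value by at most 2 E |V - E V|.  The
   variance of V is a sum over four-cycles of correlations rho, bounded by
   (\sum_(m < n) rho_m)^2 / n, which tends to 0 because \sum_m rho_m^2 is finite.

   In l2, a bounded continuous f is approximated from both sides by minima of
   quadratic bumps c + K |x - z|^2.  The uniform bound on E Z_nj^2 reduces these
   to functions of finitely many coordinates, which trigonometric polynomials
   approximate; so convergence of the characteristic functions of the
   coordinates is enough.  The limit S is a Cholesky factor of C applied to the
   variables <X_1, v_i> / sqrt lambda_i. *)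

From mathcomp Require Import all_boot all_order all_algebra.
From mathcomp Require Import all_classical all_reals all_analysis.
From mathcomp Require Import measurable_realfun ring lra.
Require Import Defs.

Set Implicit Arguments.
Unset Strict Implicit.
Unset Printing Implicit Defensive.

Import Order.TTheory GRing.Theory Num.Theory.
Import numFieldNormedType.Exports.

Local Open Scope classical_set_scope.
Local Open Scope ring_scope.

(** * Expectations of real random variables *)

(** The hypothesis makes the squares of the correlations summable but not the correlations
    themselves, so a moment method would have to control cumulants of every order of strongly
    dependent sums. Stein's identity confines the argument to fourth moments: the only quantity that
    has to become small is the variance of V, a fourfold Isserlis sum. Rotating against an
    independent copy gives the identity for covariances of any rank, because a rotation acts on
    characteristic functions only through their quadratic exponents; no density in several variables
    occurs.

    At lag 0 the trace norm has a second task. It makes the eigenvalues summable, which gives X_1 a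
    second moment in norm, lets the operators Gamma(k) exist as Bochner expectations, and places
    every error vector in l2 at every sample point.

    The convergence criterion in l2 is also applied to constant sequences. There it says that
    characteristic functions determine laws, which yields both the rotation invariance and the
    Gaussian law of each <S, h>. Statement (a) is the image of (b) under a coordinate map. *)

Section mean.
Context {d : measure_display} {T : measurableType d} {R : realType}.
Variable P : probability T R.
Implicit Types Y Z : T -> R.

Definition L1 Y := P.-integrable setT (EFin \o Y).

Definition mean Y : R := Rintegral P setT Y.

Lemma L1_meas Y : L1 Y -> measurable_fun setT Y.
Proof. by move=> /integrableP[/measurable_EFinP]. Qed.

Lemma eq_mean Y Z : Y =1 Z -> mean Y = mean Z.
Proof. by move=> /funext ->. Qed.

Lemma eq_L1 Y Z : Y =1 Z -> L1 Y -> L1 Z.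
Proof. by move=> /funext ->. Qed.

Lemma expectationE Y : L1 Y -> ('E_P[Y] = (mean Y)%:E)%E.
Proof.
by move=> iY; rewrite unlock /mean /Rintegral fineK//; exact: integrable_fin_num.
Qed.

Lemma fine_expectation Y : fine 'E_P[Y]%E = mean Y.
Proof. by rewrite unlock. Qed.

Lemma L1_le Y Z : measurable_fun setT Y -> L1 Z -> (forall w, `|Y w| <= Z w) ->
  L1 Y.
Proof.
move=> mY iZ YZ; apply: le_integrable iZ => //; first exact/measurable_EFinP.
by move=> w _ /=; rewrite lee_fin (le_trans (YZ w))// ler_norm.
Qed.

Lemma L1_cst (c : R) : L1 (fun=> c).
Proof. by apply: finite_measure_integrable_cst. Qed.

Lemma L1_bounded Y M : measurable_fun setT Y -> (forall w, `|Y w| <= M) -> L1 Y.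
Proof. by move=> mY YM; exact: (L1_le mY (L1_cst M)). Qed.

Lemma L1D Y Z : L1 Y -> L1 Z -> L1 (fun w => Y w + Z w).
Proof. by move=> iY iZ; exact: (integrableD _ iY iZ). Qed.

Lemma L1Z c Y : L1 Y -> L1 (fun w => c * Y w).
Proof. by move=> iY; exact: (integrableZl _ c iY). Qed.

Lemma L1Zr c Y : L1 Y -> L1 (fun w => Y w * c).
Proof. by move=> iY; apply: (eq_L1 _ (L1Z c iY)) => w; rewrite mulrC. Qed.

Lemma L1N Y : L1 Y -> L1 (fun w => - Y w).
Proof. by move=> /(L1Z (-1)); apply: eq_L1 => w; rewrite mulN1r. Qed.

Lemma L1B Y Z : L1 Y -> L1 Z -> L1 (fun w => Y w - Z w).
Proof. by move=> iY iZ; apply: L1D => //; exact: L1N. Qed.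

Lemma L1_sum I (s : seq I) (p : pred I) (F : I -> T -> R) :
  (forall i, p i -> L1 (F i)) -> L1 (fun w => \sum_(i <- s | p i) F i w).
Proof.
move=> iF; rewrite /L1 (_ : _ \o _ = fun w => (\sum_(i <- s | p i) (F i w)%:E)%E).
  by apply: (integrable_sum measurableT _ (h := fun i w => (F i w)%:E)).
by apply/funext => w /=; rewrite sumEFin.
Qed.

Lemma L1_norm Y : L1 Y -> L1 (fun w => `|Y w|).
Proof. by move=> iY; exact: integrable_norm. Qed.

Lemma L1_mulB Y Z M : L1 Y -> measurable_fun setT Z -> (forall w, `|Z w| <= M) ->
  L1 (fun w => Y w * Z w).
Proof.
move=> iY mZ ZM; apply: (L1_le _ (L1Z M (L1_norm iY))).
  by apply: measurable_funM => //; exact: L1_meas.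
by move=> w; rewrite normrM mulrC ler_wpM2r.
Qed.

Lemma L1_mul Y Z : measurable_fun setT Y -> measurable_fun setT Z ->
  L1 (fun w => Y w ^+ 2) -> L1 (fun w => Z w ^+ 2) -> L1 (fun w => Y w * Z w).
Proof.
move=> mY mZ iY iZ; apply: (L1_le _ (L1D iY iZ)); first exact: measurable_funM.
move=> w; rewrite normrM -(real_normK (num_real (Y w))).
rewrite -(real_normK (num_real (Z w))).
by have := sqr_ge0 (`|Y w| - `|Z w|); have := normr_ge0 (Y w);
  have := normr_ge0 (Z w); nra.
Qed.

Lemma L1_sqr Y : measurable_fun setT Y -> L1 (fun w => Y w ^+ 2) -> L1 Y.
Proof.
move=> mY iY; apply: (L1_le mY (L1D iY (L1_cst 1))) => w.
by rewrite -(real_normK (num_real (Y w))); have := sqr_ge0 (`|Y w| - 1); nra.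
Qed.

Lemma L1_quartic Y : measurable_fun setT Y -> L1 (fun w => Y w ^+ 4) ->
  L1 (fun w => Y w ^+ 2).
Proof.
move=> mY iY; apply: L1_sqr; first exact: measurable_funX.
by apply: (eq_L1 _ iY) => w; rewrite -exprM.
Qed.

Lemma meanD Y Z : L1 Y -> L1 Z -> mean (fun w => Y w + Z w) = mean Y + mean Z.
Proof. by move=> iY iZ; exact: RintegralD. Qed.

Lemma meanZ c Y : L1 Y -> mean (fun w => c * Y w) = c * mean Y.
Proof. by move=> iY; exact: RintegralZl. Qed.

Lemma meanZr c Y : L1 Y -> mean (fun w => Y w * c) = mean Y * c.
Proof. by move=> iY; exact: RintegralZr. Qed.

Lemma meanN Y : L1 Y -> mean (fun w => - Y w) = - mean Y.
Proof. by move=> iY; rewrite -mulN1r -meanZ//; apply: eq_mean => w; rewrite mulN1r. Qed.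

Lemma meanB Y Z : L1 Y -> L1 Z -> mean (fun w => Y w - Z w) = mean Y - mean Z.
Proof. by move=> iY iZ; exact: RintegralB. Qed.

Lemma mean_cst (c : R) : mean (fun=> c) = c.
Proof. by rewrite /mean Rintegral_cst//= probability_setT mulr1. Qed.

Lemma mean_sum I (s : seq I) (p : pred I) (F : I -> T -> R) :
  (forall i, p i -> L1 (F i)) ->
  mean (fun w => \sum_(i <- s | p i) F i w) = \sum_(i <- s | p i) mean (F i).
Proof.
move=> iF; elim: s => [|i s IHs].
  by rewrite big_nil -[RHS](mean_cst 0); apply: eq_mean => w; rewrite big_nil.
rewrite big_cons; have [pi|pi] := boolP (p i); last first.
  by rewrite -IHs; apply: eq_mean => w; rewrite big_cons (negbTE pi).
rewrite -IHs -meanD//; [|exact: iF|exact: L1_sum].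
by apply: eq_mean => w; rewrite big_cons pi.
Qed.

Lemma mean_le Y Z : L1 Y -> L1 Z -> (forall w, Y w <= Z w) -> mean Y <= mean Z.
Proof. by move=> iY iZ YZ; exact: le_Rintegral. Qed.

Lemma mean_ge0 Y : (forall w, 0 <= Y w) -> 0 <= mean Y.
Proof. by move=> Y0; exact: Rintegral_ge0. Qed.

Lemma mean_norm Y : L1 Y -> `|mean Y| <= mean (fun w => `|Y w|).
Proof. by move=> iY; exact: le_normr_Rintegral. Qed.

Lemma mean_bounded Y M : measurable_fun setT Y -> (forall w, `|Y w| <= M) ->
  `|mean Y| <= M.
Proof.
move=> mY YM; have iY := L1_bounded mY YM.
by rewrite (le_trans (mean_norm iY))// -[leRHS]mean_cst mean_le//;
  [exact: L1_norm|exact: L1_cst].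
Qed.

Lemma mean_norm_le Y Z : L1 Y -> L1 Z -> (forall w, `|Y w| <= Z w) ->
  `|mean Y| <= mean Z.
Proof.
by move=> iY iZ YZ; rewrite (le_trans (mean_norm iY))// mean_le//; exact: L1_norm.
Qed.

Lemma mean_dct (F : nat -> T -> R) Y Z : (forall n, measurable_fun setT (F n)) ->
  (forall w, F ^~ w @ \oo --> Y w) -> L1 Z -> (forall n w, `|F n w| <= Z w) ->
  L1 Y /\ (mean \o F) @ \oo --> mean Y.
Proof.
move=> mF FY iZ FZ.
have mY : measurable_fun setT Y by apply: (measurable_fun_cvg (h := F)) => // w _; exact: FY.
have FYE w : (fun n => (F n w)%:E) @ \oo --> (Y w)%:E.
  by apply: cvg_EFin; [exact: nearW|exact: FY].
have [||||iY _ c] := @dominated_convergence _ _ _ P setT measurableT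
  (fun n w => (F n w)%:E) (EFin \o Y) (EFin \o Z) _ _ _ iZ.
- by move=> n; exact/measurable_EFinP.
- exact/measurable_EFinP.
- by apply: aeW => w _; exact: FYE.
- by apply: aeW => w n _ /=; rewrite lee_fin.
split=> //; apply: fine_cvg.
by rewrite /mean /Rintegral fineK//; exact: integrable_fin_num.
Qed.

End mean.
Arguments mean {d T R} P Y.
Arguments L1 {d T R} P Y.

(** Integrability of the limit belongs to the conclusion and comes from the bound on the means.
    Norms and tails, which are limits of sums over coordinates, get their moments in this way. *)
Lemma mean_monotone {d} {T : measurableType d} {R : realType}
    (P : probability T R) (F : nat -> T -> R) (Y : T -> R) (M : R) :
  (forall n, L1 P (F n)) -> (forall n w, 0 <= F n w) ->
  (forall n w, F n w <= F n.+1 w) -> (forall w, F ^~ w @ \oo --> Y w) ->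
  (forall n, mean P (F n) <= M) -> L1 P Y /\ mean P Y <= M.
Proof.
move=> iF F0 Fnd FY FM.
have mY : measurable_fun setT Y.
  by apply: (measurable_fun_cvg (h := F)) => // n; exact: L1_meas.
have Y0 w : 0 <= Y w.
  rewrite -(cvg_lim _ (FY w))//; apply: limr_ge; first exact: cvgP (FY w).
  exact: nearW.
have le : (\int[P]_w (Y w)%:E <= M%:E)%E.
  rewrite (eq_integral (fun w => limn (fun n => (F n w)%:E))) => [|w _]; last first.
    by apply/esym/cvg_lim => //; apply: cvg_EFin; [exact: nearW|exact: FY].
  rewrite monotone_convergence//.
  - apply: lime_le; last first.
      apply: nearW => n; apply: (@le_trans _ _ (mean P (F n))%:E); last by rewrite lee_fin.
      by rewrite -expectationE// unlock.
    apply: ereal_nondecreasing_is_cvgn => n m nm; apply: ge0_le_integral => //.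
    + by move=> w _; rewrite lee_fin.
    + by apply/measurable_EFinP; exact: L1_meas.
    + by apply/measurable_EFinP; exact: L1_meas.
    + move=> w _; rewrite lee_fin; elim: m nm => [|m IH]; first by rewrite leqn0 => /eqP ->.
      by rewrite leq_eqVlt => /predU1P[->//|/IH/le_trans]; apply.
  - by move=> n; apply/measurable_EFinP; exact: L1_meas.
  - by move=> n w _; rewrite lee_fin.
  - move=> w _ n m nm; rewrite lee_fin; elim: m nm => [|m IH]; first by rewrite leqn0 => /eqP ->.
    by rewrite leq_eqVlt => /predU1P[->//|/IH/le_trans]; apply.
have iY : L1 P Y.
  apply/integrableP; split; first exact/measurable_EFinP.
  rewrite (eq_integral (EFin \o Y)) => [|w _]; last by rewrite /= ger0_norm.
  exact: le_lt_trans le (ltry _).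
by split=> //; rewrite -lee_fin -expectationE// unlock.
Qed.

Section mean_law.
Context {d d' : measure_display} {T : measurableType d} {T' : measurableType d'}.
Context {R : realType}.
Variables (P : probability T R) (P' : probability T' R).
Variables (Y : T -> R) (Z : T' -> R).
Hypotheses (mY : measurable_fun setT Y) (mZ : measurable_fun setT Z).
Hypothesis YZ : forall A : set R, measurable A -> P (Y @^-1` A) = P' (Z @^-1` A).
Variable g : R -> R.
Hypothesis mg : measurable_fun setT g.

Let law_eq_integral (h : R -> \bar R) : measurable_fun setT h ->
  (forall y, 0 <= h y)%E -> (\int[P]_w h (Y w) = \int[P']_w h (Z w))%E.
Proof.
move=> mh h0.
rewrite -[LHS](@ge0_integral_pushforward _ _ _ _ _ _ mY P setT h)//.
rewrite -[RHS](@ge0_integral_pushforward _ _ _ _ _ _ mZ P' setT h)//.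
by apply: eq_measure_integral => // A mA _; exact: YZ.
Qed.

Lemma law_L1 : L1 P (g \o Y) -> L1 P' (g \o Z).
Proof.
move=> /integrableP[_ iY]; apply/integrableP; split.
  by apply/measurable_EFinP; exact: measurableT_comp.
apply: le_lt_trans iY.
rewrite -(law_eq_integral (h := fun y => (`|(g y)%:E|)%E))//.
by apply: measurableT_comp => //; exact/measurable_EFinP.
Qed.

Lemma law_mean : L1 P (g \o Y) -> mean P (g \o Y) = mean P' (g \o Z).
Proof.
move=> iY; have iZ := law_L1 iY.
have mgE : measurable_fun setT (EFin \o g) by exact/measurable_EFinP.
rewrite /mean /Rintegral; congr fine.
rewrite -[LHS](@integral_pushforward _ _ _ _ _ _ mY P setT (EFin \o g))//.
rewrite -[RHS](@integral_pushforward _ _ _ _ _ _ mZ P' setT (EFin \o g))//.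
by apply: eq_measure_integral => // A mA _; exact: YZ.
Qed.

End mean_law.

Section mean_prod.
Context {d d' : measure_display} {T : measurableType d} {T' : measurableType d'}.
Context {R : realType}.
Variables (P : probability T R) (P' : probability T' R).

Definition prodP : probability (T * T')%type R := (P \x P')%E.

Lemma measurable_prodM (F : T -> R) (G : T' -> R) : measurable_fun setT F ->
  measurable_fun setT G -> measurable_fun setT (fun z : T * T' => F z.1 * G z.2).
Proof.
by move=> mF mG; apply: measurable_funM;
  [exact: (measurableT_comp mF measurable_fst)|
   exact: (measurableT_comp mG measurable_snd)].
Qed.

Lemma L1_prod (F : T -> R) (G : T' -> R) : L1 P F -> L1 P' G ->
  L1 prodP (fun z => F z.1 * G z.2).
Proof.
move=> iF iG; have mF := L1_meas iF; have mG := L1_meas iG.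
apply/(@integrable12ltyP _ _ _ _ _ P P').
  by apply/measurable_EFinP; exact: measurable_prodM.
rewrite (_ : (fun _ => _) = fun x => ((mean P' (fun y => `|G y|)) * `|F x|)%:E).
  have /integrableP[_] := L1Z (mean P' (fun y => `|G y|)) (L1_norm iF).
  congr (_ < _)%E; apply: eq_integral => x _ /=.
  by rewrite ger0_norm// mulr_ge0// mean_ge0.
apply/funext => x /=; rewrite mulrC -meanZ ?L1_norm// -expectationE; last first.
  exact/L1Z/L1_norm.
by rewrite unlock; apply: eq_integral => y _; rewrite -normrM.
Qed.

Lemma mean_prod (F : T -> R) (G : T' -> R) : L1 P F -> L1 P' G ->
  mean prodP (fun z => F z.1 * G z.2) = mean P F * mean P' G.
Proof.
move=> iF iG; rewrite /mean /Rintegral.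
rewrite -[X in fine X](@integral12_prod_meas1 _ _ _ _ _ P P'); last exact: L1_prod.
rewrite -/(mean P' G) mulrC -[RHS]meanZ//; congr fine.
apply: eq_integral => x _.
by rewrite mulrC -meanZ// -expectationE ?unlock//; exact: L1Z.
Qed.

(** Fubini with the inner mean in the closed form [G]: the second factor is integrated first, the
    first one being fixed. *)
Lemma mean_prod1 (F : T * T' -> R) (G : T -> R) : L1 prodP F ->
  (forall x, L1 P' (fun y => F (x, y))) ->
  (forall x, mean P' (fun y => F (x, y)) = G x) -> mean prodP F = mean P G.
Proof.
move=> iF iFx FG; rewrite /mean /Rintegral.
rewrite -[X in fine X](@integral12_prod_meas1 _ _ _ _ _ P P')//; congr fine.
by apply: eq_integral => x _; rewrite -FG -expectationE ?unlock//; exact: iFx.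
Qed.

End mean_prod.

(** * Trigonometric bounds and characteristic functions *)

Section trig_bounds.
Variable R : realType.
Implicit Types x y u : R.

Lemma sinB_ler x : `|sin x| <= `|x|.
Proof.
wlog x0 : x / 0 <= x => [H|].
  have [/H//|/ltW x0] := leP 0 x.
  by rewrite -normrN -sinN -[leRHS]normrN H// oppr_ge0.
have [|c _] := @MVT_segment R sin cos 0 x x0 (fun y _ => is_derive_sin y).
  by apply: continuous_subspaceT => y; exact: continuous_sin.
rewrite sin0 !subr0 => ->; rewrite normrM ler_piMl//; exact: cos_max.
Qed.

Lemma onem_cosE x : 1 - cos x = 2 * sin (x / 2) ^+ 2.
Proof.
have := cos_mulr2n (x / 2); rewrite (_ : (x / 2) *+ 2 = x); last first.
  by rewrite -mulr_natr divfK.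
by have := cos2Dsin2 (x / 2); lra.
Qed.

Lemma onem_cos_ge0 x : 0 <= 1 - cos x.
Proof. by rewrite subr_ge0 cos_le1. Qed.

Lemma onem_cos_le x : 1 - cos x <= x ^+ 2 / 2.
Proof.
rewrite onem_cosE -(real_normK (num_real (sin _))).
have := sinB_ler (x / 2); rewrite (normrM x) normfV (@ger0_norm _ 2)//.
rewrite -(real_normK (num_real x)); move: `|sin _| (normr_ge0 (sin (x / 2))).
by move=> s s0; have := normr_ge0 x; nra.
Qed.

Lemma onem_cos_le_norm x : 1 - cos x <= `|x|.
Proof.
have := onem_cos_le x; have := cos_geN1 x.
rewrite -(real_normK (num_real x)); have := normr_ge0 x; move: `|x| (cos x).
by move=> t c; have [] := leP t 2; nra.
Qed.

(** The intermediate point is kept because the two bounds on [1 - cos c], quadratic and linear, then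
    give the cubic and the quadratic estimate of [sin x - x]. *)
Lemma sinB_MVT x : exists2 c, `|c| <= `|x| & `|sin x - x| = `|x| * (1 - cos c).
Proof.
wlog x0 : x / 0 <= x => [H|].
  have [/H//|/ltW x0] := leP 0 x.
  have [|c cx E] := H (- x); first by rewrite oppr_ge0.
  by exists c; rewrite ?normrN in cx E *; rewrite // -E sinN -opprB normrN opprK addrC.
have dS y : is_derive y 1 (fun y => sin y - y) (cos y - 1) by exact: is_deriveB.
have [|c] := MVT_segment x0 (fun y _ => dS y).
  by apply: continuous_subspaceT => y; apply: cvgB; [exact: continuous_sin|exact: cvg_id].
rewrite in_itv/= => /andP[c0 cx]; rewrite sin0 !subr0 => ->.
exists c; first by rewrite !ger0_norm.
by rewrite normrM mulrC -(opprB 1) normrN (ger0_norm (onem_cos_ge0 _)).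
Qed.

Lemma sinB_le_cube x : `|sin x - x| <= `|x| ^+ 3 / 2.
Proof.
have [c cx ->] := sinB_MVT x; have := onem_cos_le c.
rewrite -(real_normK (num_real c)) => h.
rewrite exprS -mulrA ler_wpM2l// (le_trans h)// ler_wpM2r// ?invr_ge0//.
by rewrite ler_pXn2r ?nnegrE.
Qed.

Lemma sinB_le_sqr x : `|sin x - x| <= x ^+ 2.
Proof.
have [c cx ->] := sinB_MVT x; have := onem_cos_le_norm c.
rewrite -(real_normK (num_real x)) expr2 => h.
by rewrite ler_wpM2l// (le_trans h).
Qed.

(** The price of replacing a square by a bounded function. The difference factors into
    [|u| - |sin u|], at most [|u| ^+ 3 / 2], and [|u| + |sin u|], at most [2 * |u|]. *)
Lemma sqrB_sin_le u : u ^+ 2 - sin u ^+ 2 <= u ^+ 4.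
Proof.
have := sinB_le_cube u; have := sinB_ler u.
have -> : u ^+ 4 = (u ^+ 2) ^+ 2 by rewrite -exprM.
rewrite -(real_normK (num_real u)) -(real_normK (num_real (sin u))).
have := lerB_dist u (sin u); rewrite distrC.
have := normr_ge0 (sin u); have := normr_ge0 u; move: `|u| `|sin u| `|sin u - u|.
by move=> a b c; nra.
Qed.

Lemma sin_max x : `|sin x| <= 1.
Proof. by rewrite ler_norml sin_geN1 sin_le1. Qed.

(** The remainder is uniform in [x], so that a second moment of the increment controls its mean. It
    serves to differentiate characteristic functions and to dominate the difference quotients in
    [quad_stein]. *)
Lemma cosD_taylor1 x u : `|cos (x + u) - cos x + u * sin x| <= 2 * u ^+ 2.
Proof.
rewrite cosD (_ : _ - cos x + _ = - (cos x * (1 - cos u)) - sin x * (sin u - u)); last by ring.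
rewrite (le_trans (ler_normB _ _))// normrN !normrM.
have h1 : `|cos x| * `|1 - cos u| <= 1 * (u ^+ 2 / 2).
  rewrite ler_pM// ?cos_max//.
  by rewrite (ger0_norm (onem_cos_ge0 _)) onem_cos_le.
have h2 : `|sin x| * `|sin u - u| <= 1 * u ^+ 2.
  by rewrite ler_pM// ?sin_max// sinB_le_sqr.
by have := sqr_ge0 u; lra.
Qed.

Lemma cosD_taylor2 x u :
  `|cos (x + u) - cos x + u * sin x + u ^+ 2 / 2 * cos x| <= `|u| ^+ 3.
Proof.
rewrite cosD (_ : _ - cos x + _ + _ = cos x * (u ^+ 2 / 2 - (1 - cos u)) - sin x * (sin u - u));
  last by ring.
rewrite (le_trans (ler_normB _ _))// !normrM.
have h1 : `|cos x| * `|u ^+ 2 / 2 - (1 - cos u)| <= 1 * (`|u| ^+ 3 / 2).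
  rewrite ler_pM// ?cos_max// ger0_norm ?subr_ge0 ?onem_cos_le//.
  rewrite onem_cosE; have := sinB_le_sqr (u / 2); have := sinB_ler (u / 2).
  have := lerB_dist (u / 2) (sin (u / 2)); rewrite distrC.
  rewrite [(u / 2) ^+ 2]exprMn !normrM normfV (@ger0_norm _ 2)//.
  rewrite -(real_normK (num_real (sin _))) -(real_normK (num_real u)).
  have := normr_ge0 (sin (u / 2)); have := normr_ge0 u.
  by move: `|u| `|sin (u / 2)| `|sin (u / 2) - u / 2| => a b c; nra.
have h2 : `|sin x| * `|sin u - u| <= 1 * (`|u| ^+ 3 / 2).
  by rewrite ler_pM// ?sin_max// sinB_le_cube.
by lra.
Qed.

End trig_bounds.

Lemma measurable_cos_comp {d} {T : measurableType d} {R : realType} (F : T -> R) :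
  measurable_fun setT F -> measurable_fun setT (fun w => cos (F w)).
Proof.
apply: (measurableT_comp (f := @cos R)).
by apply: continuous_measurable_fun; exact: continuous_cos.
Qed.

Lemma measurable_sin_comp {d} {T : measurableType d} {R : realType} (F : T -> R) :
  measurable_fun setT F -> measurable_fun setT (fun w => sin (F w)).
Proof.
apply: (measurableT_comp (f := @sin R)).
by apply: continuous_measurable_fun; exact: continuous_sin.
Qed.

Section characteristic_function.
Context {d : measure_display} {T : measurableType d} {R : realType}.
Variable P : probability T R.
Variables (Y : T -> R) (b : R).
Hypotheses (mY : measurable_fun setT Y) (Y2 : L1 P (fun w => Y w ^+ 2)).

Let iY : L1 P Y. Proof. exact: L1_sqr. Qed.

Lemma measurable_cos_affine (t : R) : measurable_fun setT (fun w => cos (t * Y w + b)).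
Proof.
by apply: measurable_cos_comp; apply: measurable_funD => //; exact: measurable_funM.
Qed.

Lemma measurable_sin_affine (t : R) : measurable_fun setT (fun w => sin (t * Y w + b)).
Proof.
by apply: measurable_sin_comp; apply: measurable_funD => //; exact: measurable_funM.
Qed.

Lemma L1_cos_affine (t : R) : L1 P (fun w => cos (t * Y w + b)).
Proof.
by apply: (L1_bounded P (M := 1)) => [|w]; [exact: measurable_cos_affine|exact: cos_max].
Qed.

(** The Taylor remainder [2 * h ^+ 2 * Y w ^+ 2] is integrated directly: the difference quotient
    misses its limit by at most [2 * |h| * M], with [M] the second moment. *)
Lemma is_derive_charfun (t : R) :
  is_derive t 1 (fun t => mean P (fun w => cos (t * Y w + b)))
    (- mean P (fun w => Y w * sin (t * Y w + b))).
Proof.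
have iS : L1 P (fun w => Y w * sin (t * Y w + b)).
  by apply: (L1_mulB (M := 1) iY) => [|w]; [exact: measurable_sin_affine|exact: sin_max].
set M := mean P (fun w => Y w ^+ 2).
have M0 : 0 <= M by apply: mean_ge0 => w; exact: sqr_ge0.
have key h : `|mean P (fun w => cos ((t + h) * Y w + b)) -
    mean P (fun w => cos (t * Y w + b)) +
    h * mean P (fun w => Y w * sin (t * Y w + b))| <= 2 * h ^+ 2 * M.
  rewrite -meanB ?L1_cos_affine// -meanZ// -meanD; last 2 first.
  - by apply: L1B; exact: L1_cos_affine.
  - exact: L1Z.
  rewrite -meanZ//; apply: mean_norm_le.
  - by apply: L1D; [apply: L1B; exact: L1_cos_affine|exact: L1Z].
  - exact: L1Z.
  - move=> w; have := cosD_taylor1 (t * Y w + b) (h * Y w).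
    rewrite exprMn !mulrA; congr (_ <= _); congr `|cos _ - _ + _|.
    by rewrite mulrDl addrAC.
apply: DeriveDef; last first.
  rewrite /derive; apply: cvg_lim => //.
  apply/cvgrPdist_le => e e0.
  have d0 : 0 < e / (2 * M + 1) by rewrite divr_gt0// ltr_wpDl// mulr_ge0.
  near=> h; have h0 : h != 0 by near: h; exact: nbhs_dnbhs_neq.
  have hd : `|h| <= e / (2 * M + 1) by near: h; exact: dnbhs0_le.
  rewrite -(ler_pM2l (x := `|h|)) ?normr_gt0// -normrM.
  rewrite /= -[_ *: (_ - _)]/(h^-1 * (_ - _)) -[h *: 1]/(h * 1) mulr1.
  rewrite mulrBr mulrA mulfV// mul1r mulrN -normrN opprB opprK (addrC h).
  rewrite (le_trans (key h))// -(real_normK (num_real h)).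
  rewrite (_ : 2 * _ * M = `|h| * (`|h| * (2 * M))); last by ring.
  rewrite ler_wpM2l//; move: hd; rewrite ler_pdivlMr ?ltr_wpDl ?mulr_ge0// => hd.
  by rewrite (le_trans _ hd)// ler_wpM2l// lerDl.
(* The same estimate, now read as the existence of the derivative. *)
apply/cvg_ex; exists (- mean P (fun w => Y w * sin (t * Y w + b))) => /=.
apply/cvgrPdist_le => e e0.
have d0 : 0 < e / (2 * M + 1) by rewrite divr_gt0// ltr_wpDl// mulr_ge0.
near=> h; have h0 : h != 0 by near: h; exact: nbhs_dnbhs_neq.
have hd : `|h| <= e / (2 * M + 1) by near: h; exact: dnbhs0_le.
rewrite -(ler_pM2l (x := `|h|)) ?normr_gt0// -normrM.
rewrite /= -[_ *: (_ - _)]/(h^-1 * (_ - _)) -[h *: 1]/(h * 1) mulr1.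
rewrite mulrBr mulrA mulfV// mul1r mulrN -normrN opprB opprK (addrC h).
rewrite (le_trans (key h))// -(real_normK (num_real h)).
rewrite (_ : 2 * _ * M = `|h| * (`|h| * (2 * M))); last by ring.
rewrite ler_wpM2l//; move: hd; rewrite ler_pdivlMr ?ltr_wpDl ?mulr_ge0// => hd.
by rewrite (le_trans _ hd)// ler_wpM2l// lerDl.
Unshelve. all: by end_near. Qed.

End characteristic_function.

(* Gronwall: the derivative of [expR (q * t ^+ 2 / 2) * phi t] is
   [expR (q * t ^+ 2 / 2) * eps t]. *)
Lemma gaussian_ode (R : realType) (phi eps : R -> R) (q eta : R) :
  0 <= q -> 0 <= eta ->
  (forall t : R, is_derive t 1 phi (- (t * q * phi t) + eps t)) ->
  (forall t : R, 0 <= t <= 1 -> `|eps t| <= eta) ->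
  `|phi 1 - phi 0 * expR (- (q / 2))| <= eta.
Proof.
move=> q0 eta0 dphi epsle.
pose u (t : R) := expR (q / 2 * t ^+ 2) * phi t.
have du (t : R) : is_derive t 1 u (expR (q / 2 * t ^+ 2) * eps t).
  have dq : is_derive t 1 (fun t : R => q / 2 * t ^+ 2) (q * t).
    apply: is_derive_eq; rewrite /GRing.scale/=. by field.
  have de := @is_derive1_comp R expR (fun t => q / 2 * t ^+ 2) t _ _ (is_derive_expR _) dq.
  have := is_deriveM de (dphi t) => H.
  apply: (is_derive_eq H); rewrite /GRing.scale/=.
  by ring.
have [c] := MVT_segment (@ler01 R) (fun x _ => du x)
  (derivable_within_continuous (fun x _ => @ex_derive _ _ _ _ _ _ _ (du x))).
rewrite in_itv/= => /andP[c0 c1]; rewrite /u expr1n mulr1 expr0n/= mulr0 expR0 mul1r.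
rewrite subr0 mulr1 => E.
(* After multiplication by [expR (q / 2)] the left side is [|u 1 - u 0|], and the exponential at the
   intermediate point [c] is at most the one at 1. *)
rewrite -(ler_pM2l (expR_gt0 (q / 2))) -{1}(ger0_norm (expR_ge0 (q / 2))) -normrM.
rewrite mulrBr mulrCA -expRD subrr expR0 mulr1 E normrM ger0_norm ?expR_ge0//.
rewrite ler_pM// ?expR_ge0// ?epsle ?c0// ler_expR.
by rewrite ler_piMr ?divr_ge0// expr_le1.
Qed.

(** * Moments of the normal law *)

Section normal_mean.
Context {R : realType}.
Variables m s : R.
Hypothesis s0 : s != 0.
Local Notation mu := (@lebesgue_measure R).
Local Notation pdf := (normal_pdf m s).
Local Notation N := (normal_prob m s : probability (measurableTypeR R) R).

Let rn_ae : ae_eq mu setT (Radon_Nikodym_SigmaFinite.f N mu) (EFin \o pdf).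
Proof.
have dom := @normal_prob_dominates R m s.
apply: integral_ae_eq => //.
- exact: Radon_Nikodym_SigmaFinite.f_integrable.
- by apply/measurable_EFinP; exact: measurable_normal_pdf.
- by move=> A _ mA; rewrite -Radon_Nikodym_SigmaFinite.f_integral.
Qed.

(** The Radon-Nikodym derivative of the normal law has the same integral as [normal_pdf] over every
    measurable set, hence equals it almost everywhere; the change of variables is known for the
    derivative. *)
Lemma ge0_integral_normal (h : R -> \bar R) : measurable_fun setT h ->
  (forall x, 0 <= h x)%E ->
  (\int[N]_x h x = \int[mu]_x (h x * (pdf x)%:E))%E.
Proof.
move=> mh h0; have dom := @normal_prob_dominates R m s.
rewrite -(Radon_Nikodym_SigmaFinite.change_of_variables dom)//.
apply: ae_eq_integral => //.
- apply: emeasurable_funM => //.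
  exact: measurable_int (Radon_Nikodym_SigmaFinite.f_integrable dom).
- apply: emeasurable_funM => //; apply/measurable_EFinP.
  exact: measurable_normal_pdf.
- exact: ae_eqe_mul2l.
Qed.

Lemma normal_L1 (h : R -> R) : measurable_fun setT h ->
  mu.-integrable setT (fun x => (h x * pdf x)%:E) -> L1 N h.
Proof.
move=> mh /integrableP[_ ih]; apply/integrableP; split.
  exact/measurable_EFinP.
rewrite (ge0_integral_normal (h := fun x => (`|(h x)%:E|)%E))//; last first.
  by apply: measurableT_comp => //; exact/measurable_EFinP.
apply: le_lt_trans ih; rewrite le_eqVlt; apply/orP; left; apply/eqP.
apply: eq_integral => x _ /=.
by rewrite normrM (ger0_norm (normal_pdf_ge0 m s x)).
Qed.

Lemma normal_mean (h : R -> R) : measurable_fun setT h ->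
  mu.-integrable setT (fun x => (h x * pdf x)%:E) ->
  mean N h = Rintegral mu setT (fun x => h x * pdf x).
Proof.
move=> mh ih; have dom := @normal_prob_dominates R m s.
rewrite /mean /Rintegral; congr fine.
have mEh : measurable_fun setT (EFin \o h) by exact/measurable_EFinP.
rewrite [LHS]integralE [RHS]integralE.
rewrite !ge0_integral_normal//; last 2 first.
- exact: measurable_funeneg.
- exact: measurable_funepos.
congr (_ - _)%E; apply: eq_integral => x _.
  rewrite !funeposE /= -!EFin_max -EFinM maxr_pMl ?normal_pdf_ge0//.
  by rewrite mul0r.
rewrite !funenegE /= -!EFin_max -EFinM maxr_pMl ?normal_pdf_ge0//.
by rewrite mul0r mulNr.
Qed.


Local Notation y x := (x - m).

(** A quartic factor is absorbed by doubling the standard deviation. With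
    [z = y ^+ 2 / (2 * s ^+ 2)], the fourth power is [4 * s ^+ 4 * z ^+ 2], and
    [z ^+ 2 <= 15 / 4 * expR (3 / 4 * z)] from the quadratic term of the exponential. Doubling [s]
    turns [expR (- z)] into [expR (- z / 4)] and halves the peak, whence [30 = 4 * (15 / 4) * 2]. *)
Lemma quartic_pdf_le x : y x ^+ 4 * pdf x <= 30 * s ^+ 4 * normal_pdf m (2 * s) x.
Proof.
have s20 : 2 * s != 0 by rewrite mulf_neq0.
rewrite !normal_pdfE// /normal_peak /normal_fun.
have s2 : 0 < s ^+ 2 by rewrite exprn_even_gt0.
set z := y x ^+ 2 / (s ^+ 2 *+ 2).
have z0 : 0 <= z by rewrite divr_ge0 ?sqr_ge0// mulrn_wge0// ltW.
rewrite (_ : - y x ^+ 2 / ((2 * s) ^+ 2 *+ 2) = 3 / 4 * z + - z); last first.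
  by rewrite /z; field.
rewrite (_ : - y x ^+ 2 / _ = - z) ?mulNr// expRD.
rewrite (_ : Num.sqrt ((2 * s) ^+ 2 * pi *+ 2) = 2 * Num.sqrt (s ^+ 2 * pi *+ 2)); last first.
  rewrite (_ : (2 * s) ^+ 2 * pi *+ 2 = 2 ^+ 2 * (s ^+ 2 * pi *+ 2)); last by ring.
  by rewrite sqrtrM ?sqr_ge0// sqrtr_sqr ger0_norm.
rewrite invfM; set c := (Num.sqrt _)^-1.
have c0 : 0 <= c by rewrite invr_ge0.
have -> : y x ^+ 4 = 4 * s ^+ 4 * z ^+ 2 by rewrite /z; field.
have h := @expR_ge1Dxn R (3 / 4 * z) 1 (mulr_ge0 _ z0).
have {h} h : z ^+ 2 <= 15 / 4 * expR (3 / 4 * z).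
  have := h; rewrite (_ : 2`!%:R = 2)// => /(_ _)/=.
  have z2 := sqr_ge0 z; rewrite exprMn.
  by have -> : 0 <= 3 / 4 :> R by []; move=> /(_ isT); lra.
have ez := expR_ge0 (- z).
rewrite (_ : 4 * _ * _ * _ = (4 * s ^+ 4 * c * expR (- z)) * z ^+ 2); last by ring.
rewrite (_ : 30 * _ * _ = (4 * s ^+ 4 * c * expR (- z)) * (15 / 4 * expR (3 / 4 * z))); last by field.
have s4 : 0 <= s ^+ 4 by rewrite exprn_even_ge0.
by rewrite ler_wpM2l// (mulr_ge0 (mulr_ge0 (mulr_ge0 _ s4) c0) ez).
Qed.

Lemma quartic_integrable (h : R -> R) C : measurable_fun setT h ->
  (forall x, `|h x| <= C * (1 + y x ^+ 4)) ->
  mu.-integrable setT (fun x => (h x * pdf x)%:E).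
Proof.
move=> mh hC.
pose g x := C * pdf x + C * 30 * s ^+ 4 * normal_pdf m (2 * s) x.
have ig : mu.-integrable setT (EFin \o g).
  rewrite (_ : _ \o _ = (fun x => C%:E * (pdf x)%:E) \+
      (fun x => (C * 30 * s ^+ 4)%:E * (normal_pdf m (2 * s) x)%:E))%E//.
  by apply: integrableD => //; apply: integrableZl => //; exact: integrable_normal_pdf.
have C0 : 0 <= C.
  rewrite -(pmulr_lge0 (x := 1 + y 0 ^+ 4)) ?(le_trans (normr_ge0 _) (hC 0))//.
  by rewrite ltr_pwDl// exprn_even_ge0.
apply: le_integrable ig => //.
  apply/measurable_EFinP; apply: measurable_funM => //.
  exact: measurable_normal_pdf.
move=> x _ /=; rewrite lee_fin normrM (ger0_norm (normal_pdf_ge0 m s x)).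
rewrite (le_trans _ (ler_norm _))// /g.
rewrite (le_trans (ler_wpM2r (normal_pdf_ge0 m s x) (hC x)))//.
by rewrite mulrDr mulr1 mulrDl lerD2l; have := ler_wpM2l C0 (quartic_pdf_le x); lra.
Qed.

Lemma normal_quartic_L1 (h : R -> R) C : measurable_fun setT h ->
  (forall x, `|h x| <= C * (1 + (x - m) ^+ 4)) -> L1 N h.
Proof. by move=> mh hC; apply: normal_L1 => //; exact: quartic_integrable hC. Qed.

End normal_mean.

Section normal_stein.
Context {R : realType}.
Variables m s : R.
Hypothesis s0 : s != 0.
Local Notation mu := (@lebesgue_measure R).
Local Notation pdf := (normal_pdf m s).
Local Notation N := (normal_prob m s : probability (measurableTypeR R) R).

Let pdf_decay (t : R) (x : R) : t != 0 -> x != m ->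
  normal_pdf m t x <= normal_peak t * (2 * t ^+ 2) / (x - m) ^+ 2.
Proof.
move=> t0 xm; rewrite normal_pdfE// -mulrA ler_wpM2l ?normal_peak_ge0//.
have t2 : 0 < t ^+ 2 by rewrite exprn_even_gt0.
have y2 : 0 < (x - m) ^+ 2 by rewrite exprn_even_gt0//= subr_eq0.
rewrite /normal_fun mulNr expRN -[leRHS]invrK lef_pV2 ?posrE ?expR_gt0//; last first.
  by rewrite invr_gt0 divr_gt0// mulr_gt0.
rewrite (le_trans _ (expR_ge1Dx _))// invf_div (mulr_natl (t ^+ 2)).
by rewrite lerDr.
Qed.

Lemma is_derive_normal_pdf (x : R) :
  is_derive x 1 pdf (- ((x - m) / s ^+ 2) * pdf x).
Proof.
have s2 : s ^+ 2 != 0 by rewrite expf_neq0.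
have dq : is_derive x 1 (fun x : R => - (x - m) ^+ 2 / (s ^+ 2 *+ 2))
    (- ((x - m) / s ^+ 2)).
  rewrite [X in is_derive _ _ X](_ : _ = (fun x : R => (- (s ^+ 2 *+ 2)^-1) *: ((x - m) * (x - m)))).
    apply: is_derive_eq; rewrite /GRing.scale/= subr0.
    by field.
  by apply/funext => z; rewrite /GRing.scale/= expr2 mulNr mulrC mulNr.
have de := @is_derive1_comp R expR _ x _ _ (is_derive_expR _) dq.
have H := is_deriveZ (normal_peak s) de.
rewrite !(normal_pdfE m s0); apply: (is_derive_eq H).
rewrite /normal_fun /GRing.scale/=.
by ring.
Qed.

Variables (g g' : R -> R) (C : R).
Hypotheses (dg : forall x : R, is_derive x 1 g (g' x)) (cg' : continuous g').
Hypotheses (gC : forall x, `|g x| <= C * (1 + (x - m) ^+ 4))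
  (g'C : forall x, `|g' x| <= C * (1 + (x - m) ^+ 4))
  (ygC : forall x, `|(x - m) * g x| <= C * (1 + (x - m) ^+ 4)).

Let cg : continuous g.
Proof.
by move=> x; apply: differentiable_continuous; apply/derivable1_diffP.
Qed.

Let mg : measurable_fun setT g.
Proof. exact: continuous_measurable_fun. Qed.

Let mg' : measurable_fun setT g'.
Proof. exact: continuous_measurable_fun. Qed.

Let myg : measurable_fun setT (fun x : R => (x - m) * g x).
Proof. by apply: measurable_funM => //; exact: measurable_funB. Qed.

Lemma normal_stein_L1 : L1 N g'.
Proof. exact: (normal_quartic_L1 s0 mg' g'C). Qed.

Lemma normal_stein_mul_L1 : L1 N (fun x : R => (x - m) * g x).
Proof. exact: (normal_quartic_L1 s0 myg ygC). Qed.

Let h (x : R) := (x - m) * g x - s ^+ 2 * g' x.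

(** An antiderivative of [h x * pdf x], because the logarithmic derivative of [pdf] is
    [- (x - m) / s ^+ 2]. Stein's identity says that [F] vanishes at both ends. *)
Let F (x : R) := - s ^+ 2 * g x * pdf x.

Let dF (x : R) : is_derive x 1 F (h x * pdf x).
Proof.
have d1 := is_deriveM (is_deriveZ (- s ^+ 2) (dg x)) (is_derive_normal_pdf x).
apply: (is_derive_eq d1); rewrite /h /= /GRing.scale/=.
by field.
Qed.

Let cpdf : continuous pdf.
Proof. exact: continuous_normal_pdf. Qed.

Let ch : continuous (fun x => h x * pdf x).
Proof.
move=> x; apply: cvgM; last exact: cpdf.
apply: cvgB; apply: cvgM; [|exact: cg|exact: cvg_cst|exact: cg'].
by apply: cvgB; [exact: cvg_id|exact: cvg_cst].
Qed.

(** The sign [e] selects the end of the line. By [quartic_pdf_le] the growth of [g] is absorbed into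
    two normal densities, and each of them decays at least like the inverse square of the distance
    to [m]. *)
Let F_cvg0 (e : R) : e = 1 \/ e = -1 -> F (m + e * n.+1%:R) @[n --> \oo] --> (0 : R).
Proof.
move=> e1; have s20 : 2 * s != 0 by rewrite mulf_neq0.
have [c c0 cP] : exists2 c, 0 <= c & forall k : R, 0 < k ->
    `|F (m + e * k)| <= c / k ^+ 2.
  pose K := `|s ^+ 2| * C * (normal_peak s * (2 * s ^+ 2) +
    30 * s ^+ 4 * (normal_peak (2 * s) * (2 * (2 * s) ^+ 2))).
  exists `|K| => // k k0.
  have kE : (m + e * k - m) ^+ 2 = k ^+ 2.
    by rewrite addrAC subrr add0r; case: e1 => ->; rewrite ?mul1r ?mulN1r ?sqrrN.
  have km : m + e * k != m.
    by rewrite -subr_eq0 -sqrf_eq0 kE expf_eq0/= gt_eqF.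
  rewrite /F -mulrA normrM normrN (normrM (g _)) (ger0_norm (normal_pdf_ge0 m s _)).
  have C0 : 0 <= C.
    rewrite -(pmulr_lge0 (x := 1 + (0 - m) ^+ 4)) ?(le_trans (normr_ge0 _) (gC 0))//.
    by rewrite ltr_pwDl// exprn_even_ge0.
  have p0 := normal_pdf_ge0 m s (m + e * k).
  have h1 := ler_wpM2r p0 (gC (m + e * k)).
  have h2 := quartic_pdf_le m s0 (m + e * k).
  have := pdf_decay s0 km; have := pdf_decay s20 km; rewrite kE => h3 h4.
  have s4 : 0 <= s ^+ 4 by rewrite exprn_even_ge0.
  have h5 := ler_wpM2l (mulr_ge0 (ler0n R 30) s4) h3.
  have h6 : `|g (m + e * k)| * pdf (m + e * k) <= C * (normal_peak s * (2 * s ^+ 2) / k ^+ 2 +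
     30 * s ^+ 4 * (normal_peak (2 * s) * (2 * (2 * s) ^+ 2) / k ^+ 2)).
    apply: (le_trans h1); rewrite -(mulrA C) ler_wpM2l// mulrDl mul1r lerD//.
    exact: le_trans h5.
  rewrite (le_trans (ler_wpM2l _ h6))// (le_trans _ (ler_wpM2r _ (ler_norm K)))//; last first.
    by rewrite invr_ge0 sqr_ge0.
  by rewrite [leLHS](_ : _ = K / k ^+ 2)// /K; ring.
apply/norm_cvg0P; apply: (@squeeze_cvgr _ _ _ _ (fun=> 0) (fun n => c * harmonic n)).
- apply: nearW => n; rewrite normr_ge0/= (le_trans (cP _ _))// ler_wpM2l//.
  by rewrite lef_pV2 ?posrE ?exprn_gt0// expr2 ler_peMr// ler1n.
- exact: cvg_cst.
- by rewrite -[X in _ --> X](mulr0 c); apply: cvgM; [exact: cvg_cst|exact: cvg_harmonic].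
Qed.


(** Integration by parts: on the interval of radius [n.+1] around [m] the mean of [h] is an
    increment of [F], which tends to 0, while the truncations of [h] are dominated by [|h|]. *)
Lemma normal_stein : mean N (fun x : R => (x - m) * g x) = s ^+ 2 * mean N g'.
Proof.
apply/eqP; rewrite -subr_eq0 -meanZ; last exact: normal_stein_L1.
rewrite -meanB; [|exact: normal_stein_mul_L1|exact/L1Z/normal_stein_L1].
rewrite -/h; apply/eqP.
have mh : measurable_fun setT h.
  by apply: measurable_funB => //; exact: measurable_funM.
have ih : L1 N h by apply: L1B; [exact: normal_stein_mul_L1|exact/L1Z/normal_stein_L1].
pose I (n : nat) := `[m - n.+1%:R, m + n.+1%:R]%classic.
have mI n : measurable (I n) by exact: measurable_itv.
pose hn n := h \_ (I n).
have mhn n : measurable_fun setT (hn n).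
  by apply/measurable_restrict => //; exact: measurable_funTS.
have hnle n x : `|hn n x| <= `|h x|.
  by rewrite /hn patchE; case: ifPn => // _; rewrite normr0.
have hnh x : hn ^~ x @ \oo --> h x.
  apply: cvg_near_cst; near=> n; rewrite /hn patchE ifT// inE /I/= in_itv/=.
  have : `|x - m| <= n.+1%:R.
    near: n; apply: filterS (nbhs_infty_ger `|x - m|) => n /le_trans; apply.
    by rewrite ler_nat.
  by rewrite ler_norml => /andP[h1 h2]; apply/andP; split; lra.
have [_ cN] := @mean_dct _ (measurableTypeR R) R N hn h (fun x => `|h x|) mhn hnh (L1_norm ih) hnle.
have hnE n : mean N (hn n) = F (m + 1 * n.+1%:R) - F (m + -1 * n.+1%:R).
  rewrite mul1r mulN1r.
  have n0 : m - n.+1%:R < m + n.+1%:R by rewrite ltrD2l gtrN.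
  have ihn : mu.-integrable setT (fun x => (hn n x * pdf x)%:E).
    pose C' := C + s ^+ 2 * C.
    apply: (@quartic_integrable _ m s s0 (hn n) C') => // x.
    rewrite (le_trans (hnle n x))// /h (le_trans (ler_normB _ _))// (normrM (s ^+ 2)).
    by rewrite (ger0_norm (sqr_ge0 s)) /C' [leRHS]mulrDl lerD// -(mulrA (s ^+ 2)) ler_wpM2l// sqr_ge0.
  rewrite normal_mean// (_ : (fun x => _) = (fun x => h x * pdf x) \_ (I n)); last first.
    by apply/funext => x; rewrite /hn !patchE; case: ifP; rewrite // mul0r.
  rewrite -Rintegral_mkcond /Rintegral (continuous_FTC2 (F := F))//.
  - exact: continuous_subspaceT.
  - split=> [x _| |]; first exact: ex_derive.
    + apply: cvg_at_right_filter; apply: differentiable_continuous.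
      by apply/derivable1_diffP; exact: ex_derive.
    + apply: cvg_at_left_filter; apply: differentiable_continuous.
      by apply/derivable1_diffP; exact: ex_derive.
  - by move=> x _; rewrite derive1E; have [_ ->] := dF x.
rewrite -(cvg_lim _ cN)//; apply/cvg_lim => //.
rewrite (_ : _ \o _ = fun n => F (m + 1 * n.+1%:R) - F (m + -1 * n.+1%:R)); last first.
  by apply/funext => n; rewrite /= hnE.
rewrite -[X in _ --> X](subr0 0); apply: cvgB; apply: F_cvg0; by [left|right].
Unshelve. all: by end_near. Qed.

End normal_stein.

Section normal_moments.
Context {R : realType}.
Variable s : R.
Hypothesis s0 : s != 0.

Let le_quartic (k : nat) (y : R) : (k <= 4)%N -> `|y| ^+ k <= 1 + y ^+ 4.
Proof.
move=> k4; rewrite -[y ^+ 4](@ger0_norm _ (y ^+ 4)) ?exprn_even_ge0// normrX.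
have [y1|/ltW y1] := leP `|y| 1; first by rewrite ler_wpDr ?exprn_ile1// exprn_ge0.
by rewrite ler_wpDl// ler_weXn2l.
Qed.

(** Stein's identity for the constant function 1 says that [x - m] has mean 0. *)
Lemma normal_prob_mean (m : R) :
  let N : probability (measurableTypeR R) R := normal_prob m s in
  L1 N (@idfun R) /\ mean N idfun = m.
Proof.
move=> N.
have g1 (x : R) : `|1 : R| <= 1 * (1 + (x - m) ^+ 4) :> R.
  by rewrite normr1 mul1r lerDl exprn_even_ge0.
have g0 (x : R) : `|0 : R| <= 1 * (1 + (x - m) ^+ 4) :> R.
  by rewrite normr0 (le_trans _ (g1 x)).
have gy x : `|(x - m) * 1| <= 1 * (1 + (x - m) ^+ 4).
  by rewrite mulr1 mul1r -[leLHS]expr1 le_quartic.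
have d1 (x : R) : is_derive x 1 (fun=> 1 : R) 0 by exact: is_derive_cst.
have c0 : continuous (fun _ : R => 0 : R) by move=> x; exact: cvg_cst.
have := normal_stein_mul_L1 s0 d1 gy.
have := normal_stein s0 d1 c0 g1 g0 gy.
rewrite mean_cst mulr0.
set f := (fun x : R => _) => Ef if_.
have iD : L1 N idfun by apply: (eq_L1 _ (L1D if_ (L1_cst N m))) => x; rewrite /f mulr1 subrK.
split=> //; rewrite (@eq_mean _ _ _ N idfun (fun x => f x + m)).
  by rewrite meanD ?mean_cst ?Ef ?add0r//; exact: L1_cst.
by move=> x; rewrite /f mulr1 subrK.
Qed.

Let N : probability (measurableTypeR R) R := normal_prob 0 s.

Let normal0_L1 k : (k <= 4)%N -> L1 N (fun x : R => x ^+ k).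
Proof.
move=> k4; apply: (@normal_quartic_L1 _ 0 s s0 _ 1) => [|x].
  exact: measurable_funX.
by rewrite subr0 mul1r normrX le_quartic.
Qed.

Lemma normal0_quartic_L1 : L1 N (fun x : R => x ^+ 4).
Proof. exact: normal0_L1. Qed.

Let dX (k : nat) (x : R) : is_derive x 1 (fun x : R => x ^+ k.+1) (k.+1%:R * x ^+ k).
Proof.
rewrite (_ : (fun x : R => x ^+ k.+1) = (@idfun R) ^+ k.+1); last first.
  by apply/funext => z; rewrite exprfctE.
apply: (is_derive_eq (is_deriveX k.+1 (is_derive_id x 1))).
by rewrite /GRing.scale/= mulr1 mulr_natl.
Qed.

Let cX (k : nat) : continuous (fun x : R => k.+1%:R * x ^+ k).
Proof. by move=> x; apply: cvgM; [exact: cvg_cst|exact: exprn_continuous]. Qed.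

(** Stein's identity for [x ^+ k.+1]. The restriction to degree 4 is the range of the quartic
    domination. *)
Let normal0_step (k : nat) : (k.+2 <= 4)%N ->
  mean N (fun x : R => x ^+ k.+2) = s ^+ 2 * (k.+1%:R * mean N (fun x : R => x ^+ k)).
Proof.
move=> k4.
have e1 (x : R) : 0 <= 1 + (x - 0) ^+ 4 by rewrite addr_ge0// exprn_even_ge0.
have kR : 1 <= k.+1%:R :> R by rewrite ler1n.
have g1 x : `|x ^+ k.+1| <= k.+1%:R * (1 + (x - 0) ^+ 4) :> R.
  by rewrite (le_trans _ (ler_peMl (e1 x) kR))// subr0 normrX le_quartic// ltnW.
have g2 x : `|k.+1%:R * x ^+ k| <= k.+1%:R * (1 + (x - 0) ^+ 4) :> R.
  by rewrite normrM ger0_norm// ler_wpM2l// subr0 normrX le_quartic// ltnW// ltnW.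
have g3 x : `|(x - 0) * x ^+ k.+1| <= k.+1%:R * (1 + (x - 0) ^+ 4) :> R.
  by rewrite (le_trans _ (ler_peMl (e1 x) kR))// subr0 -exprS normrX le_quartic.
have := normal_stein s0 (dX k) (@cX k) g1 g2 g3; rewrite meanZ; last first.
  by apply: normal0_L1; rewrite ltnW// ltnW.
by move=> <-; apply: eq_mean => x; rewrite subr0 -exprS.
Qed.

Lemma normal0_sqr : mean N (fun x : R => x ^+ 2) = s ^+ 2.
Proof.
by rewrite normal0_step// (@eq_mean _ _ _ N _ (fun=> 1)) ?mean_cst ?mulr1.
Qed.

Lemma normal0_quartic : mean N (fun x : R => x ^+ 4) = 3 * s ^+ 2 ^+ 2.
Proof. by rewrite normal0_step// normal0_sqr; ring. Qed.

(** In the scale [u], Stein's identity for [sin (u * t * x + b)] gives the equation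
    [phi' = - u * t ^+ 2 * s ^+ 2 * phi]; [gaussian_ode] without perturbation evaluates it at
    [u = 1]. The free phase [b] covers real and imaginary parts together. *)
Lemma normal0_charfun (t b : R) :
  mean N (fun x : R => cos (t * x + b)) = cos b * expR (- (t ^+ 2 * s ^+ 2 / 2)).
Proof.
pose Y (x : measurableTypeR R) : R := t * x.
have mY : measurable_fun setT Y by exact: measurable_funM.
have Y2 : L1 N (fun w => Y w ^+ 2).
  apply: (eq_L1 _ (L1Z (t ^+ 2) (normal0_L1 (k := 2) isT))) => x.
  by rewrite /Y exprMn.
pose phi (u : R) : R := mean N (fun w => cos (u * Y w + b)).
have dphi (u : R) : is_derive u 1 phi (- (u * (t ^+ 2 * s ^+ 2) * phi u) + 0).
  apply: (is_derive_eq (is_derive_charfun b mY Y2 u)); rewrite addr0; congr (- _).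
  have e1 (x : R) : 1 <= 1 + (x - 0) ^+ 4 by rewrite lerDl exprn_even_ge0.
  pose C := `|u * t| + 1.
  have C1 : 1 <= C by rewrite lerDr.
  have dg (x : R) : is_derive x 1 (fun x : R => sin (u * t * x + b)) (u * t * cos (u * t * x + b)).
    have dl : is_derive x 1 (fun x : R => u * t * x + b) (u * t).
      by apply: is_derive_eq; rewrite /GRing.scale/= mulr1 addr0.
    apply: (is_derive_eq (@is_derive1_comp R sin _ x _ _ (is_derive_sin _) dl)).
    by rewrite mulrC.
  have cg : continuous (fun x : R => u * t * cos (u * t * x + b)).
    move=> x; apply: cvgM; first exact: cvg_cst.
    apply: (cvg_comp (fun x : R => u * t * x + b) cos); last exact: continuous_cos.
    by apply: cvgD; [apply: cvgM; [exact: cvg_cst|exact: cvg_id]|exact: cvg_cst].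
  have g1 (x : R) : `|sin (u * t * x + b)| <= C * (1 + (x - 0) ^+ 4).
    by rewrite (le_trans (sin_max _))// (le_trans C1)// ler_peMr// (le_trans _ C1).
  have g2 (x : R) : `|u * t * cos (u * t * x + b)| <= C * (1 + (x - 0) ^+ 4).
    rewrite normrM (le_trans (ler_wpM2l _ (cos_max _)))// mulr1.
    by rewrite (le_trans _ (ler_peMr _ (e1 x)))// ?lerDl// (le_trans _ C1).
  have g3 (x : R) : `|(x - 0) * sin (u * t * x + b)| <= C * (1 + (x - 0) ^+ 4).
    rewrite normrM (le_trans (ler_wpM2l _ (sin_max _)))// mulr1.
    rewrite (le_trans _ (ler_peMl _ C1))//; last by rewrite (le_trans _ (e1 x)).
    by rewrite -[leLHS]expr1 le_quartic.
  have iX := normal_stein_mul_L1 s0 dg g3.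
  have iC : L1 N (fun x : R => cos (u * Y x + b)) by exact: L1_cos_affine.
  have := normal_stein s0 dg cg g1 g2 g3.
  rewrite (@eq_mean _ _ _ N (fun x : R => u * t * cos (u * t * x + b))
    (fun x : R => u * t * cos (u * Y x + b))); last by move=> x; rewrite /Y mulrA.
  rewrite meanZ// -/(phi u) => E.
  rewrite (@eq_mean _ _ _ N _ (fun x : R => t * ((x - 0) * sin (u * t * x + b)))).
    by rewrite meanZ// E; ring.
  by move=> x; rewrite /Y subr0 !mulrA.
have q0 : 0 <= t ^+ 2 * s ^+ 2 by rewrite mulr_ge0// sqr_ge0.
have : `|phi 1 - phi 0 * expR (- (t ^+ 2 * s ^+ 2 / 2))| <= 0.
  by apply: (gaussian_ode q0 (lexx 0) dphi) => u _; rewrite normr0.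
rewrite normr_le0 subr_eq0 => /eqP; rewrite /phi.
rewrite (@eq_mean _ _ _ N _ (fun x : R => cos (t * x + b))); last first.
  by move=> x; rewrite /Y mul1r.
move=> ->; congr (_ * _); rewrite -[RHS](mean_cst N); apply: eq_mean => x.
by rewrite mul0r add0r.
Qed.

End normal_moments.

Section gaussian_law.
Context {R : realType}.

Lemma dirac_L1 (a : R) (h : R -> R) : measurable_fun setT h ->
  L1 (\d_(a : measurableTypeR R) : probability _ R) h.
Proof.
move=> mh; apply/integrableP; split; first exact/measurable_EFinP.
rewrite integral_dirac//; first by rewrite diracT mul1e ltry.
by apply: measurableT_comp => //; exact/measurable_EFinP.
Qed.

Lemma dirac_mean (a : R) (h : R -> R) : measurable_fun setT h ->
  mean (\d_(a : measurableTypeR R) : probability _ R) h = h a.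
Proof.
move=> mh; rewrite /mean /Rintegral integral_dirac//; first by rewrite diracT mul1e.
exact/measurable_EFinP.
Qed.

Lemma gaussian_law_mean (m q : R) : 0 <= q ->
  L1 (gaussian_law m q) (@idfun R) /\ mean (gaussian_law m q) idfun = m.
Proof.
move=> q0; rewrite /gaussian_law; case: eqVneq => [_|qn0].
  split; first by apply: dirac_L1; exact: measurable_id.
  by apply: (etrans (@dirac_mean m (@idfun R) _)) => //; exact: measurable_id.

by apply: normal_prob_mean; rewrite gt_eqF// sqrtr_gt0 lt_def qn0.
Qed.

Lemma gaussian_law0 (q : R) : 0 <= q ->
  [/\ L1 (gaussian_law 0 q) (fun x : R => x ^+ 4),
      mean (gaussian_law 0 q) (fun x : R => x ^+ 2) = q,
      mean (gaussian_law 0 q) (fun x : R => x ^+ 4) = 3 * q ^+ 2 &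
      forall t b, mean (gaussian_law 0 q) (fun x : R => cos (t * x + b)) =
        cos b * expR (- (t ^+ 2 * q / 2))].
Proof.
have mX k : measurable_fun setT (fun x : R => x ^+ k) by exact: measurable_funX.
move=> q0; rewrite /gaussian_law; case: eqVneq => [->|qn0].
  split; first by apply: dirac_L1; exact: mX.
  - by apply: (etrans (dirac_mean 0 (mX 2))); rewrite expr0n.
  - by apply: (etrans (dirac_mean 0 (mX 4))); rewrite !expr0n/= mulr0.
  move=> t b; apply: (etrans (dirac_mean 0 _)).
    by apply: measurable_cos_comp; apply: measurable_funD => //; exact: measurable_funM.
  by rewrite !mulr0 mul0r add0r oppr0 expR0 mulr1.
have s0 : Num.sqrt q != 0 by rewrite gt_eqF// sqrtr_gt0 lt_def qn0.
have sE := sqr_sqrtr q0.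
split; first exact: normal0_quartic_L1.
- by rewrite normal0_sqr.
- by rewrite normal0_quartic// sE.
- by move=> t b; rewrite normal0_charfun// sE.
Qed.

Context {d : measure_display} {T : measurableType d} (P : probability T R).

(** [gaussian_rv] only asserts that some parameters exist. They are recovered by transporting the
    first two moments, so that afterwards everything is expressed through the second moment of
    [Y]. *)
Lemma gaussian_rv0 (Y : T -> R) : gaussian_rv P Y -> mean P Y = 0 ->
  [/\ L1 P (fun w => Y w ^+ 4),
      mean P (fun w => Y w ^+ 4) = 3 * mean P (fun w => Y w ^+ 2) ^+ 2,
      (forall t b, mean P (fun w => cos (t * Y w + b)) =
        cos b * expR (- (t ^+ 2 * mean P (fun w => Y w ^+ 2) / 2))) &
      forall A, measurable A ->
        P (Y @^-1` A) = gaussian_law 0 (mean P (fun w => Y w ^+ 2)) A].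
Proof.
have mX k : measurable_fun setT (fun x : R => x ^+ k) by exact: measurable_funX.
move=> [mY [m [q [q0 YE]]]] Y0.
have mid : measurable_fun setT (@idfun (measurableTypeR R)) by exact: measurable_id.
have tr (g : R -> R) : measurable_fun setT g -> L1 (gaussian_law m q) g ->
    L1 P (g \o Y) /\ mean P (g \o Y) = mean (gaussian_law m q) g.
  move=> mg ig.
  have YE' (A : set R) : measurable A -> gaussian_law m q (idfun @^-1` A) = P (Y @^-1` A).
    by move=> mA; rewrite YE.
  split; first exact: (law_L1 mid mY YE' mg ig).
  by apply/esym; exact: (law_mean mid mY YE' mg ig).
have m0 : m = 0.
  have [i1 E1] := gaussian_law_mean m q0.
  by have [_] := tr _ mid i1; rewrite E1 => <-.
rewrite {m}m0 in tr YE.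
have [i4 E2 E4 Ec] := gaussian_law0 q0.
have i2 := L1_quartic mid i4.
have -> : mean P (fun w => Y w ^+ 2) = q by have [_ ->] := tr _ (mX 2) i2.
split=> //.
- by have [] := tr _ (mX 4) i4.
- by have [_ ->] := tr _ (mX 4) i4.
- move=> t b.
  have mc : measurable_fun setT (fun x : R => cos (t * x + b)).
    by apply: measurable_cos_comp; apply: measurable_funD => //; exact: measurable_funM.
  have [|_ ->] := tr _ mc; last exact: Ec.
  by apply: (L1_bounded _ (M := 1)) => // x; exact: cos_max.
Qed.

End gaussian_law.

(** * Gaussian families *)

Section gaussian_family.
Context {d : measure_display} {T : measurableType d} {R : realType}.
Variable P : probability T R.

(** The index type is arbitrary because the same notion is used for pairs of a time and a direction,
    for flattened blocks and for the coordinates of the limit. Degenerate combinations are allowed: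
    [gaussian_law] includes point masses. *)
Definition gaussian_family (I : Type) (xi : I -> T -> R) : Prop :=
  (forall a, mean P (xi a) = 0) /\
  forall (n : nat) (t : 'I_n -> I) (u : 'I_n -> R),
    gaussian_rv P (fun w => \sum_(i < n) u i * xi (t i) w).

Lemma gaussian_family_comp (I J : Type) (f : J -> I) (xi : I -> T -> R) :
  gaussian_family xi -> gaussian_family (xi \o f).
Proof.
by move=> [xi0 xiG]; split=> [a|n t u]; [exact: xi0|exact: (xiG n (f \o t) u)].
Qed.

Context {I : Type} {xi : I -> T -> R}.
Hypothesis xiG : gaussian_family xi.

Definition gcov (a b : I) : R := mean P (fun w => xi a w * xi b w).

Lemma gcovC a b : gcov a b = gcov b a.
Proof. by apply: eq_mean => w; rewrite mulrC. Qed.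

Lemma gaussian_family_rv a : gaussian_rv P (xi a).
Proof.
have [_ /(_ 1%N (fun=> a) (fun=> 1))] := xiG.
congr (gaussian_rv P _); apply/funext => w.
by rewrite big_ord_recl big_ord0 addr0 mul1r.
Qed.

Lemma gaussian_family_meas a : measurable_fun setT (xi a).
Proof. by have [] := gaussian_family_rv a. Qed.
Local Hint Resolve gaussian_family_meas : core.

Lemma gaussian_family_L4 a : L1 P (fun w => xi a w ^+ 4).
Proof. by have [] := gaussian_rv0 (gaussian_family_rv a) (xiG.1 a). Qed.

Lemma gaussian_family_L2 a : L1 P (fun w => xi a w ^+ 2).
Proof. by apply: L1_quartic => //; exact: gaussian_family_L4. Qed.

Lemma gaussian_family_L1 a : L1 P (xi a).
Proof. by apply: L1_sqr => //; exact: gaussian_family_L2. Qed.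

Lemma gaussian_family_L1M a b : L1 P (fun w => xi a w * xi b w).
Proof. by apply: L1_mul => //; exact: gaussian_family_L2. Qed.

Lemma gaussian_family_L2M a b : L1 P (fun w => (xi a w * xi b w) ^+ 2).
Proof.
apply: (eq_L1 (Y := fun w => xi a w ^+ 2 * xi b w ^+ 2)) => [w|].
  by rewrite exprMn.
by apply: L1_mul; [exact: measurable_funX|exact: measurable_funX|..];
  apply: eq_L1 (gaussian_family_L4 _) => w; rewrite -exprM.
Qed.

Lemma gaussian_family_L4M a b c e :
  L1 P (fun w => (xi a w * xi b w) * (xi c w * xi e w)).
Proof.
by apply: L1_mul; [exact: measurable_funM|exact: measurable_funM|
  exact: gaussian_family_L2M|exact: gaussian_family_L2M].
Qed.

Section linear.
Variables (J : finType) (f : J -> I) (u : J -> R).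

Let Y w := \sum_a u a * xi (f a) w.

Lemma gaussian_family_linear : gaussian_rv P Y.
Proof.
have [_ /(_ #|J| (f \o enum_val) (u \o enum_val))] := xiG.
congr (gaussian_rv P _); apply/funext => w; rewrite /Y.
by rewrite (reindex (@enum_val J J))//; apply: onW_bij; exact: enum_val_bij.
Qed.

Lemma mean_linear : mean P Y = 0.
Proof.
rewrite /Y mean_sum => [|a _]; last exact/L1Z/gaussian_family_L1.
by rewrite big1// => a _; rewrite meanZ ?(xiG.1 (f a)) ?mulr0//; exact: gaussian_family_L1.
Qed.

Lemma mean_linear_sqr :
  mean P (fun w => Y w ^+ 2) = \sum_a \sum_b u a * u b * gcov (f a) (f b).
Proof.
rewrite (@eq_mean _ _ _ P _ (fun w => \sum_a \sum_b u a * u b * (xi (f a) w * xi (f b) w))).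
  rewrite mean_sum => [|a _]; last first.
    by apply: L1_sum => b _; exact/L1Z/gaussian_family_L1M.
  apply: eq_bigr => a _; rewrite mean_sum => [|b _].
    by apply: eq_bigr => b _; rewrite meanZ//; exact: gaussian_family_L1M.
  exact/L1Z/gaussian_family_L1M.
move=> w; rewrite /Y expr2 big_distrl/=; apply: eq_bigr => a _.
by rewrite big_distrr/=; apply: eq_bigr => b _; rewrite mulrACA.
Qed.

Lemma gaussian_linear_charfun (t b : R) :
  mean P (fun w => cos (t * Y w + b)) =
  cos b * expR (- (t ^+ 2 * (\sum_a \sum_b u a * u b * gcov (f a) (f b)) / 2)).
Proof.
rewrite -mean_linear_sqr.
by have [_ _ -> _] := gaussian_rv0 gaussian_family_linear mean_linear.
Qed.

End linear.

Let lin4 (a b c e : I) (p q s : R) :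
  L1 P (fun w => (xi a w + p * xi b w + q * xi c w + s * xi e w) ^+ 4) /\
  mean P (fun w => (xi a w + p * xi b w + q * xi c w + s * xi e w) ^+ 4) =
  3 * (gcov a a + p ^+ 2 * gcov b b + q ^+ 2 * gcov c c + s ^+ 2 * gcov e e +
    2 * (p * gcov a b + q * gcov a c + s * gcov a e +
      p * q * gcov b c + p * s * gcov b e + q * s * gcov c e)) ^+ 2.
Proof.
pose f := tnth [tuple a; b; c; e]; pose u := tnth [tuple 1; p; q; s].
have [] := gaussian_rv0 (gaussian_family_linear f u) (mean_linear f u).
rewrite mean_linear_sqr (_ : (fun w => (\sum_a0 _) ^+ 4) =
    (fun w => (xi a w + p * xi b w + q * xi c w + s * xi e w) ^+ 4)).
  move=> i4 -> _ _; split=> //; congr (3 * _ ^+ 2).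
  rewrite !big_ord_recl !big_ord0 /f /u !(tnth_nth a) !(tnth_nth 0)/=.
  rewrite (gcovC b a) (gcovC c a) (gcovC e a) (gcovC c b) (gcovC e b) (gcovC e c).
  by ring.
apply/funext => w; congr (_ ^+ 4).
rewrite !big_ord_recl !big_ord0 /f /u !(tnth_nth a) !(tnth_nth 0)/=.
by rewrite mul1r addr0 !addrA.
Qed.

(* The polarization identity
   [192 x y z t = \sum_(p, q, s = +-1) p q s (x + p y + q z + s t) ^ 4]
   reduces the formula to the fourth moment of a normal variable. *)
Lemma isserlis a b c e :
  mean P (fun w => (xi a w * xi b w) * (xi c w * xi e w)) =
  gcov a b * gcov c e + gcov a c * gcov b e + gcov a e * gcov b c.
Proof.
pose F (p q s : R) w := (xi a w + p * xi b w + q * xi c w + s * xi e w) ^+ 4.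
have iF p q s : L1 P (F p q s) by have [] := lin4 a b c e p q s.
have iZ p q s k : L1 P (fun w => k * F p q s w) by exact: L1Z.
rewrite (@eq_mean _ _ _ P _ (fun w => 192^-1 * (F 1 1 1 w - F (-1) 1 1 w - F 1 (-1) 1 w
  - F 1 1 (-1) w + F 1 (-1) (-1) w + F (-1) 1 (-1) w + F (-1) (-1) 1 w
  - F (-1) (-1) (-1) w))); last by move=> w; rewrite /F; field.
rewrite meanZ; last by do !(exact: iF || apply: L1B || apply: L1D).
do ![rewrite meanB; [|by do !(exact: iF || apply: L1B || apply: L1D)|exact: iF]
   |rewrite meanD; [|by do !(exact: iF || apply: L1B || apply: L1D)|exact: iF]].
rewrite !(lin4 a b c e _ _ _).2.
by field.
Qed.

End gaussian_family.
Arguments gcov {d T R} P {I} xi a b.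

Lemma nonexpansive_continuous (R : realType) (V : normedModType R) (f : V -> R) :
  (forall x y, `|f x - f y| <= `|x - y|) -> continuous f.
Proof.
move=> fle x; apply/cvgrPdist_le => e e0; near=> y; apply: le_trans (fle _ _) _.
by near: y; apply: cvgr_dist_le => //; exact: cvg_id.
Unshelve. all: by end_near. Qed.

(** * Convergence in distribution in l2 *)

Section l2_topology.
Context {R : realType}.
Local Notation l2 := (l2 R).
Implicit Types x y z : l2.

Lemma l2D x y k : (x + y) k = x k + y k. Proof. by []. Qed.
Lemma l2B x y k : (x - y) k = x k - y k. Proof. by []. Qed.

Lemma l2_sum (I : Type) (r : seq I) (F : I -> l2) k :
  (\sum_(i <- r) F i) k = \sum_(i <- r) F i k.
Proof.
by elim: r => [|i r IHr]; rewrite ?big_nil ?big_cons// l2D IHr.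
Qed.

Lemma l2_coord_continuous k : continuous (fun x : l2 => x k).
Proof.
apply: nonexpansive_continuous => x y; exact: (l2_coord_norm (x - y) k).
Qed.

Lemma l2_sqr_norm_cvg x : (fun n => \sum_(k < n) x k ^+ 2) @ \oo --> `|x| ^+ 2.
Proof.
rewrite -l2_inner_normE (_ : (fun n => _) = series (fun k => x k * x k)).
  exact: l2_cvg.
by apply/funext => n; rewrite /series/= big_mkord; apply: eq_bigr => k _; rewrite expr2.
Qed.

Lemma l2_tail_cvg x N :
  (fun n => \sum_(k < n) x (N + k)%N ^+ 2) @ \oo -->
  `|x| ^+ 2 - \sum_(k < N) x k ^+ 2.
Proof.
rewrite (_ : (fun n => _) = fun n =>
    \sum_(k < n + N) x k ^+ 2 - \sum_(k < N) x k ^+ 2); last first.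
  by apply/funext => n; rewrite addnC big_split_ord/= addrAC subrr add0r.
apply: cvgB; last exact: cvg_cst.
by rewrite (cvg_shiftn N (fun n => \sum_(k < n) x k ^+ 2)); exact: l2_sqr_norm_cvg.
Qed.

Lemma l2_tail_ge0 x N : 0 <= `|x| ^+ 2 - \sum_(k < N) x k ^+ 2.
Proof. by rewrite subr_ge0 l2_psum_norm. Qed.

Definition l2_fin (N : nat) (u : nat -> R) : l2 := \sum_(j < N) u j *: l2_basis R j.

Lemma l2_finE N u k : l2_fin N u k = if (k < N)%N then u k else 0.
Proof.
rewrite /l2_fin l2_sum (eq_bigr (fun j : 'I_N => u j * (k == j)%:R))//.
case: ltnP => [kN|Nk].
  rewrite (bigD1 (Ordinal kN))//= eqxx mulr1 big1 ?addr0// => j.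
  by rewrite -val_eqE/= eq_sym => /negbTE ->; rewrite mulr0.
by rewrite big1// => j _; rewrite gtn_eqF ?mulr0// (leq_trans (ltn_ord j)).
Qed.

Lemma l2_fin_sqr_norm N u : `|l2_fin N u| ^+ 2 = \sum_(k < N) u k ^+ 2.
Proof.
rewrite -(cvg_lim _ (@l2_sqr_norm_cvg (l2_fin N u)))//; apply/cvg_lim => //.
apply: (cvg_near_cst); near=> n.
have Nn : (N <= n)%N by near: n; exact: nbhs_infty_ge.
rewrite (eq_bigr (fun k : 'I_n => if (k < N)%N then u k ^+ 2 else 0)); last first.
  by move=> k _; rewrite l2_finE; case: ifP; rewrite // expr0n.
by rewrite -big_mkcond/= -(big_ord_widen n (fun k => u k ^+ 2) Nn).
Unshelve. all: by end_near. Qed.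

Definition l2_rat (q : seq rat) : l2 := l2_fin (size q) (fun k => ratr (nth 0 q k)).

Lemma l2_rat_dense x e : 0 < e -> exists q, `|x - l2_rat q| < e.
Proof.
move=> e0; have e2 : 0 < e ^+ 2 / 4 by rewrite divr_gt0// exprn_gt0.
have [N _ /(_ N (leqnn N))/= xN] : \forall n \near \oo,
    `|x| ^+ 2 - \sum_(k < n) x k ^+ 2 < e ^+ 2 / 4.
  have /cvgrPdist_lt/(_ _ e2) := @l2_sqr_norm_cvg x.
  by apply: filterS => n; apply: le_lt_trans; rewrite ler_norm.
(* Each of the [N] coordinates may contribute [eta] to a total of [e ^+ 2 / 4]. Since [del] is at
   most 1, the square of an error below [del] is at most [del], hence at most [eta]. *)
pose eta := e ^+ 2 / 4 / N.+1%:R.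
have eta0 : 0 < eta by rewrite divr_gt0.
pose del := Num.min 1 eta.
have d0 : 0 < del by rewrite lt_min ltr01.
have qP k : exists q : rat, `|x k - ratr q| < del.
  have /rat_in_itvoo[q] : x k - del < x k + del by rewrite ltrD2l gtrN.
  rewrite in_itv/= => /andP[h1 h2]; exists q.
  by rewrite ltr_norml; apply/andP; split; lra.
pose qk k := projT1 (cid (qP k)).
have qkP k : `|x k - ratr (qk k)| < del by rewrite /qk; case: cid.
exists (mkseq qk N).
have E : l2_rat (mkseq qk N) = l2_fin N (fun k => ratr (qk k)).
  apply/val_inj/funext => k; rewrite /l2_rat size_mkseq [LHS]l2_finE [RHS]l2_finE.
  by case: ltnP => // kN; rewrite nth_mkseq.
rewrite -(ltr_pXn2r (n := 2)) ?nnegrE ?normr_ge0 ?(ltW e0)// E; set z := l2_fin _ _.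
rewrite -(cvg_lim _ (@l2_sqr_norm_cvg (x - z)))//.
apply: (@le_lt_trans _ _ (e ^+ 2 / 2)); last first.
  by rewrite ltr_pdivrMr// ltr_pMr ?exprn_gt0// ltr1n.
apply: limr_le; first by apply: cvgP; exact: l2_sqr_norm_cvg.
near=> n; have Nn : (N <= n)%N by near: n; exact: nbhs_infty_ge.
rewrite -(big_mkord xpredT (fun k => (x - z) k ^+ 2)) (big_cat_nat (n := N))//=.
rewrite [e ^+ 2 / 2](_ : _ = e ^+ 2 / 4 + e ^+ 2 / 4); last by lra.
apply: lerD.
  apply: (@le_trans _ _ (\sum_(0 <= k < N) eta)).
    apply: ler_sum_nat => k /= kN.
    rewrite [leLHS](_ : _ = (x k - ratr (qk k)) ^+ 2); last first.
      by congr (_ ^+ 2); rewrite [LHS](l2B x z k) l2_finE kN.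
    rewrite -(real_normK (num_real _)) expr2.
    have h := ltW (qkP k); rewrite (le_trans (ler_pM _ _ h h))//.
    have d1 : del <= 1 by rewrite /del ge_min lexx.
    have deta : del <= eta by rewrite /del ge_min lexx orbT.
    by apply: le_trans deta; rewrite ler_piMr// ltW.
  rewrite sumr_const_nat subn0 /eta -[leLHS]mulr_natr mulrAC.
  by rewrite ler_pdivrMr// ler_wpM2l ?ler_nat// ltW.
apply: le_trans (ltW xN).
rewrite lerBrDl -(big_mkord xpredT (fun k => x k ^+ 2)).
apply: le_trans (l2_psum_norm x n).
have -> : \sum_(k < n) x k ^+ 2 =
    \sum_(0 <= k < N) x k ^+ 2 + \sum_(N <= k < n) x k ^+ 2.
  by rewrite -(big_cat_nat (n := N))// big_mkord.
rewrite lerD2l.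
apply: ler_sum_nat => k /andP[Nk _].
rewrite [leLHS](_ : _ = x k ^+ 2)//.
have Ek : (x - z) k = x k by rewrite [LHS](l2B x z k) l2_finE ltnNge Nk subr0.
exact: (congr1 (fun t => t ^+ 2) Ek).
Unshelve. all: by end_near. Qed.

Lemma measurable_l2_sqr_dist {d} {T : measurableType d} (W : T -> l2) z :
  (forall j, measurable_fun setT (fun w => W w j)) ->
  measurable_fun setT (fun w => `|W w - z| ^+ 2).
Proof.
move=> mW; apply: (measurable_fun_cvg
  (h := fun n w => \sum_(k < n) (W w - z) k ^+ 2)) => [n|w _].
  apply: measurable_sum => k; apply: measurable_funX.
  by apply: measurable_funB => //; exact: mW.
exact: l2_sqr_norm_cvg.
Qed.

(** Separability: an open set is a countable union of balls with rational finitely supported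
    centres, and a ball is a sublevel set of a squared distance, which is a limit of functions of
    the coordinates. *)
Lemma measurable_l2_open {d} {T : measurableType d} (W : T -> l2) (U : set l2) :
  (forall j, measurable_fun setT (fun w => W w j)) -> open U ->
  measurable (W @^-1` U).
Proof.
move=> mW oU.
pose B (qk : seq rat * nat) := ball (l2_rat qk.1) (qk.2.+1%:R^-1 : R).
(* The pairs of a centre and a radius are enumerated by [unpickle]; codes of no pair, and balls not
   contained in [U], contribute the empty set. *)
pose F i := if unpickle i is Some qk then
  if `[< B qk `<=` U >] then W @^-1` B qk else set0 else set0.
have -> : W @^-1` U = \bigcup_i F i.
  apply/seteqP; split=> [w /= Uw|w [i _]]; last first.
    rewrite /F; case: unpickle => // qk; case: asboolP => // BU.
    exact: BU.
  have /nbhs_ballP[e /= e0 eU] : nbhs (W w) U by exact: open_nbhs_nbhs.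
  have [k _ /(_ k (leqnn k))/= ke] : \forall k \near \oo, k.+1%:R^-1 < e / 2 :> R.
    have e20 : 0 < e / 2 by rewrite divr_gt0.
    have /cvgrPdist_lt/(_ _ e20) := @cvg_harmonic R; apply: filterS => k.
    by rewrite sub0r normrN ger0_norm// harmonic_ge0.
  have [|q qw] := @l2_rat_dense (W w) k.+1%:R^-1; first by rewrite invr_gt0.
  exists (pickle (q, k)) => //; rewrite /F pickleK asboolT.
    by rewrite /B/= -ball_normE/= distrC.
  move=> y; rewrite /B -ball_normE/= => qy; apply: eU; rewrite -ball_normE/=.
  rewrite (_ : W w - y = (W w - l2_rat q) + (l2_rat q - y)); last by rewrite subrKA.
  rewrite (le_lt_trans (ler_normD _ _))// (splitr e).
  by apply: ltrD; [exact: lt_trans qw ke|exact: lt_trans qy ke].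
apply: bigcupT_measurable => i; rewrite /F; case: unpickle => // qk.
case: ifPn => // _.
have r0 : 0 < qk.2.+1%:R^-1 :> R by rewrite invr_gt0.
rewrite (_ : _ @^-1` _ = (fun w => `|W w - l2_rat qk.1| ^+ 2) @^-1` `]-oo, (qk.2.+1%:R^-1) ^+ 2[).
  by rewrite -[X in measurable X]setTI; apply: measurable_l2_sqr_dist.
apply/seteqP; split=> w /=; rewrite /B -ball_normE/= distrC in_itv/=.
  by move=> h; rewrite ltr_pXn2r ?nnegrE// ltW.
by rewrite ltr_pXn2r ?nnegrE// ltW.
Qed.

Lemma measurable_l2 {d} {T : measurableType d} (W : T -> borel l2) :
  (forall j, measurable_fun setT (fun w => (W w : l2) j)) ->
  measurable_fun setT W.
Proof.
move=> mW; apply: (@measurability _ _ T (borel l2) setT W (@open l2) erefl) => _ [U oU <-].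
by rewrite setTI; exact: measurable_l2_open.
Qed.

Lemma measurable_l2_continuous {d} {T : measurableType d} (W : T -> l2)
    (f : l2 -> R) : (forall j, measurable_fun setT (fun w => W w j)) ->
  continuous f -> measurable_fun setT (f \o W).
Proof.
move=> mW cf; apply: (measurability _ (RGenOpens.measurableE R)) => // _ [_ [a [b ->]] <-].
rewrite setTI comp_preimage; apply: measurable_l2_open => //.
move/continuousP: cf; apply; exact: interval_open.
Qed.

End l2_topology.

(** * Uniform approximation by trigonometric polynomials in finitely many coordinates *)

Section trig_class.
Context {R : realType}.
Variable J : nat.
Local Notation l2 := (l2 R).
Implicit Types g h p q : l2 -> R.

(** With a free phase, cosines alone include the sines and the constants, and the product-to-sum
    formula keeps products inside the class. *)
Inductive trig_poly : (l2 -> R) -> Prop :=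
| trig_cos (a : nat -> R) (b c : R) :
    trig_poly (fun x => c * cos (\sum_(j < J) a j * x j + b))
| trig_add p q : trig_poly p -> trig_poly q -> trig_poly (fun x => p x + q x).

Lemma trig_poly_ext p q : p =1 q -> trig_poly p -> trig_poly q.
Proof. by move=> /funext ->. Qed.

Lemma trig_poly_cst c : trig_poly (fun=> c).
Proof.
apply: (trig_poly_ext _ (trig_cos (fun=> 0) 0 c)) => x.
by rewrite big1 ?addr0 ?cos0 ?mulr1// => j _; rewrite mul0r.
Qed.

Lemma trig_poly_mul p q : trig_poly p -> trig_poly q ->
  trig_poly (fun x => p x * q x).
Proof.
move=> tp; elim=> [a b c|{}q r _ IHq _ IHr]; last first.
  by apply: (trig_poly_ext _ (trig_add IHq IHr)) => x; rewrite mulrDr.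
elim: tp => [a' b' c'|{}p r _ IHp _ IHr]; last first.
  by apply: (trig_poly_ext _ (trig_add IHp IHr)) => x; rewrite mulrDl.
apply: (trig_poly_ext _ (trig_add (trig_cos (fun j => a' j + a j) (b' + b) (c' * c / 2))
  (trig_cos (fun j => a' j - a j) (b' - b) (c' * c / 2)))) => x.
have -> : \sum_(j < J) (a' j + a j) * x j + (b' + b) =
  (\sum_(j < J) a' j * x j + b') + (\sum_(j < J) a j * x j + b).
  by under eq_bigr do rewrite mulrDl; rewrite big_split/= addrACA.
have -> : \sum_(j < J) (a' j - a j) * x j + (b' - b) =
  (\sum_(j < J) a' j * x j + b') - (\sum_(j < J) a j * x j + b).
  by under eq_bigr do rewrite mulrBl; rewrite sumrB opprD addrACA.
by rewrite cosD cosB; field.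
Qed.

Lemma trig_poly_bounded p : trig_poly p -> exists2 M, 0 <= M & forall x, `|p x| <= M.
Proof.
elim=> [a b c|{}p q _ [M M0 pM] _ [M' M'0 qM]].
  by exists `|c| => // x; rewrite normrM ler_piMr// cos_max.
exists (M + M'); first exact: addr_ge0.
by move=> x; rewrite (le_trans (ler_normD _ _))// lerD.
Qed.

(** Approximation is uniform on the whole of [l2], so that means of [g] and of its approximant are
    close under every law at once. The class is closed under finite minima, which is what the bumps
    require. *)
Definition trig_approx g : Prop :=
  forall e : R, 0 < e -> exists2 p, trig_poly p & forall x, `|g x - p x| <= e.

Lemma trig_approx_poly p : trig_poly p -> trig_approx p.
Proof. by move=> tp e e0; exists p => // x; rewrite subrr normr0 ltW. Qed.

Lemma trig_approx_ext g h : g =1 h -> trig_approx g -> trig_approx h.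
Proof. by move=> /funext ->. Qed.

Lemma trig_approx_cst c : trig_approx (fun=> c).
Proof. exact/trig_approx_poly/trig_poly_cst. Qed.

Lemma trig_approx_bounded g : trig_approx g ->
  exists2 M, 0 <= M & forall x, `|g x| <= M.
Proof.
move=> /(_ 1 ltr01)[p /trig_poly_bounded[M M0 pM] gp].
exists (M + 1); first exact: addr_ge0.
move=> x; rewrite -(subrK (p x) (g x)) (le_trans (ler_normD _ _))// addrC.
by rewrite lerD.
Qed.

Lemma trig_approxD g h : trig_approx g -> trig_approx h ->
  trig_approx (fun x => g x + h x).
Proof.
move=> tg th e e0; have e2 : 0 < e / 2 by rewrite divr_gt0.
have [p tp gp] := tg _ e2; have [q tq hq] := th _ e2.
exists (fun x => p x + q x); first exact: trig_add.
move=> x; rewrite opprD addrACA (le_trans (ler_normD _ _))// [leRHS]splitr.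
by rewrite lerD.
Qed.

Lemma trig_approxM g h : trig_approx g -> trig_approx h ->
  trig_approx (fun x => g x * h x).
Proof.
move=> tg th e e0.
have [M M0 gM] := trig_approx_bounded tg; have [M' M'0 hM] := trig_approx_bounded th.
pose D := M + M' + 1.
have D0 : 0 < D by rewrite ltr_wpDl// addr_ge0.
pose t := Num.min 1 (e / D).
have t0 : 0 < t by rewrite lt_min ltr01 divr_gt0.
have t1 : t <= 1 by rewrite ge_min lexx.
have te : t * D <= e by rewrite -ler_pdivlMr// ge_min lexx orbT.
have [p tp gp] := tg _ t0; have [q tq hq] := th _ t0.
exists (fun x => p x * q x); first exact: trig_poly_mul.
move=> x.
have -> : g x * h x - p x * q x =
  g x * (h x - q x) + (g x - p x) * h x - (g x - p x) * (h x - q x) by ring.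
rewrite (le_trans (ler_normB _ _))// (le_trans (lerD (ler_normD _ _) (lexx _)))//.
rewrite !normrM (le_trans _ te)//.
have := gp x; have := hq x; have := gM x; have := hM x.
have := normr_ge0 (g x); have := normr_ge0 (h x).
have := normr_ge0 (g x - p x); have := normr_ge0 (h x - q x).
rewrite /D; move: `|g x| `|h x| `|g x - p x| `|h x - q x| => a b c f.
move=> f0 c0 b0 a0 bM aM fe ce.
have h1 : a * f <= M * t by rewrite ler_pM.
have h2 : c * b <= t * M' by rewrite ler_pM.
have h3 : c * f <= t * 1 by rewrite ler_pM// (le_trans fe).
by lra.
Qed.

Lemma trig_approxZ k g : trig_approx g -> trig_approx (fun x => k * g x).
Proof. exact/trig_approxM/trig_approx_cst. Qed.

Lemma trig_approx_sum (I : Type) (r : seq I) (P : pred I) (g : I -> l2 -> R) :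
  (forall i, trig_approx (g i)) -> trig_approx (fun x => \sum_(i <- r | P i) g i x).
Proof.
move=> tg; elim: r => [|i r IHr].
  by apply: trig_approx_ext (trig_approx_cst 0) => x; rewrite big_nil.
have [Pi|Pi] := boolP (P i); last first.
  by apply: trig_approx_ext IHr => x; rewrite big_cons (negbTE Pi).
by apply: trig_approx_ext (trig_approxD (tg i) IHr) => x; rewrite big_cons Pi.
Qed.

Lemma trig_approx_lim g :
  (forall e : R, 0 < e -> exists2 h, trig_approx h & forall x, `|g x - h x| <= e) ->
  trig_approx g.
Proof.
move=> gh e e0; have e2 : 0 < e / 2 by rewrite divr_gt0.
have [h th gh2] := gh _ e2; have [p tp hp] := th _ e2; exists p => // x.
rewrite (_ : g x - p x = (g x - h x) + (h x - p x)); last by rewrite subrKA.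
by rewrite (le_trans (ler_normD _ _))// [leRHS]splitr lerD.
Qed.

(* The classical iteration [p := p + (t ^+ 2 - p ^+ 2) / 2] of the
   Stone-Weierstrass theorem, which increases to [`|t|] on [-1, 1]. *)
Fixpoint abs_iter (t : R) (k : nat) : R :=
  if k is k'.+1 then abs_iter t k' + (t ^+ 2 - abs_iter t k' ^+ 2) / 2 else 0.

(** The gap [z] between [|t|] and the iterate becomes at most [z * (1 - z / 2)]. This map increases
    on [0, 1], so the bound [2 / k.+2] can be inserted for [z], and its image is at most
    [2 / k.+3]. *)
Lemma abs_iterP (t : R) k : `|t| <= 1 ->
  0 <= abs_iter t k <= `|t| /\ `|t| - abs_iter t k <= 2 / k.+2%:R.
Proof.
move=> t1; have t0 := normr_ge0 t.
elim: k => [|k [/andP[IH0 IH1] IH2]] /=.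
  by rewrite lexx t0 subr0 divff.
rewrite -(real_normK (num_real t)); move: IH0 IH1 IH2.
set p := abs_iter t k; move: `|t| t0 t1 => s s0 s1 p0 ps IH2.
split; first by apply/andP; split; nra.
have k2 : 0 < k.+2%:R :> R by [].
have k3 : 0 < k.+3%:R :> R by [].
have h : s - (p + (s ^+ 2 - p ^+ 2) / 2) <= (s - p) * (1 - (s - p) / 2) by nra.
apply: (le_trans h).
set c := 2 / k.+2%:R in IH2 *.
have c1 : c <= 1 by rewrite ler_pdivrMr// mul1r ler_nat.
have c0 : 0 < c by rewrite divr_gt0.
have h2 : (s - p) * (1 - (s - p) / 2) <= c * (1 - c / 2).
  by move: (s - p) (subr_ge0 p s) ps IH2 => z <- z0 zc; nra.
apply: (le_trans h2); rewrite /c ler_pdivlMr//.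
rewrite [leLHS](_ : _ = 2 * (k.+1%:R * k.+3%:R) / (k.+2%:R ^+ 2)); last first.
  have -> : k.+3%:R = k.+1%:R + 2 :> R by rewrite -natrD addn2.
  have -> : k.+2%:R = k.+1%:R + 1 :> R by rewrite natr1.
  have : k.+1%:R + 1 != 0 :> R by rewrite natr1 pnatr_eq0.
  by move: (k.+1%:R : R) => a a1; field.
rewrite ler_pdivrMr ?exprn_gt0//.
have -> : k.+3%:R = k.+2%:R + 1 :> R by rewrite natr1.
have -> : k.+1%:R = k.+2%:R - 1 :> R by rewrite -[k.+2%:R]natr1 addrK.
by move: (k.+2%:R : R) => a; nra.
Qed.

(** Division by [D] brings [g] into [-1, 1], where [abs_iter] converges uniformly; each iterate is a
    polynomial in [g] and hence stays in the class. *)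
Lemma trig_approx_norm g : trig_approx g -> trig_approx (fun x => `|g x|).
Proof.
move=> tg; have [M M0 gM] := trig_approx_bounded tg.
pose D := M + 1; have D0 : 0 < D by rewrite ltr_wpDl.
pose h x := D^-1 * g x.
have th : trig_approx h by exact: trig_approxZ.
have h1 x : `|h x| <= 1.
  rewrite normrM normfV (gtr0_norm D0) mulrC ler_pdivrMr// mul1r.
  by rewrite (le_trans (gM x))// lerDl.
have tk k : trig_approx (fun x => abs_iter (h x) k).
  elim: k => [|k IH]; first exact: trig_approx_cst.
  apply: (@trig_approx_ext (fun x => abs_iter (h x) k + 2^-1 * (h x * h x +
      (-1) * (abs_iter (h x) k * abs_iter (h x) k)))).
    by move=> x; rewrite /= mulrC !expr2 mulN1r.
  apply: trig_approxD => //; apply/trig_approxZ/trig_approxD.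
    exact: trig_approxM.
  exact/trig_approxZ/trig_approxM.
apply: (@trig_approx_ext (fun x => D * `|h x|)).
  by move=> x; rewrite normrM normfV (gtr0_norm D0) mulrA mulfV ?mul1r// gt_eqF.
apply: trig_approxZ; apply: trig_approx_lim => e e0.
have [k _ /(_ k (leqnn k))/= ke] : \forall k \near \oo, k.+1%:R^-1 < e / 2 :> R.
  have e20 : 0 < e / 2 by rewrite divr_gt0.
  have /cvgrPdist_lt/(_ _ e20) := @cvg_harmonic R; apply: filterS => k.
  by rewrite sub0r normrN ger0_norm// harmonic_ge0.
exists (fun x => abs_iter (h x) k) => // x.
have [/andP[_ le1] le2] := abs_iterP k (h1 x).
rewrite ger0_norm ?subr_ge0// (le_trans le2)//.
rewrite mulrC -ler_pdivlMr// (le_trans _ (ltW ke))//.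
by rewrite lef_pV2 ?posrE// ler_nat.
Qed.

Lemma trig_approx_min g h : trig_approx g -> trig_approx h ->
  trig_approx (fun x => Num.min (g x) (h x)).
Proof.
move=> tg th.
apply: (@trig_approx_ext (fun x => 2^-1 * (g x + h x + (-1) * `|g x + (-1) * h x|))).
  move=> x; rewrite mulN1r; case: (leP (g x) (h x)) => gh.
    by rewrite ler0_norm ?mulN1r ?subr_le0//; field.
  by rewrite gtr0_norm ?mulN1r ?subr_gt0//; field.
apply/trig_approxZ/trig_approxD; first exact: trig_approxD.
by apply/trig_approxZ/trig_approx_norm/trig_approxD => //; exact: trig_approxZ.
Qed.

Lemma trig_approx_sin2 (j : nat) (M z : R) : (j < J)%N ->
  trig_approx (fun x => sin ((x j - z) / M) ^+ 2).
Proof.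
move=> jJ; pose a (k : nat) : R := if k == j then M^-1 else 0.
have E (x : l2) : \sum_(k < J) a k * x k = x j / M.
  rewrite (bigD1 (Ordinal jJ))//= /a eqxx big1 ?addr0 1?mulrC// => k.
  by rewrite -val_eqE/= => /negbTE ->; rewrite mul0r.
apply: trig_approx_poly.
have tc := trig_cos a (- z / M - pi / 2) 1.
apply: (trig_poly_ext _ (trig_poly_mul tc tc)) => x; rewrite E !mul1r -expr2.
by rewrite addrA -mulrDl cosB cos_pihalf sin_pihalf mulr0 add0r mulr1.
Qed.

End trig_class.

(** The bump of a ball is the supremum of [f] on it plus a parabola that reaches the oscillation
    [2 * B] at its boundary: it exceeds [f] inside by the supremum and outside by the parabola. A
    small ball whose centre is very close to [x] brings the bump down to [f x]. [N i] is the length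
    of the support of the centre. *)
Lemma usc_approximants (R : realType) (f : l2 R -> R) (B : R) :
  continuous f -> (forall x, `|f x| <= B) ->
  exists (s K : nat -> R) (z : nat -> l2 R) (N : nat -> nat),
  [/\ forall i, 0 <= K i, forall i, - B <= s i,
      forall x i, f x <= s i + K i * `|x - z i| ^+ 2,
      forall x e, 0 < e -> exists i, s i + K i * `|x - z i| ^+ 2 <= f x + e &
      forall i j, (N i <= j)%N -> z i j = 0].
Proof.
move=> cf fB; have B0 : 0 <= B by rewrite (le_trans _ (fB 0)).
have fle x : - B <= f x <= B by have := fB x; rewrite ler_norml.
pose I := (seq rat * nat)%type.
pose z (qk : I) : l2 R := l2_rat qk.1.
pose r (qk : I) : R := qk.2.+1%:R^-1.
have r0 qk : 0 < r qk by rewrite invr_gt0.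
pose A qk := [set f y | y in ball (z qk) (r qk)].
have Az qk : A qk (f (z qk)) by exists (z qk) => //; exact: ballxx.
have Aub qk : has_ubound (A qk).
  by exists B => _ [y _ <-]; have /andP[] := fle y.
have Asup qk : has_sup (A qk) by split; [exists (f (z qk))|].
pose s (qk : I) := sup (A qk); pose K (qk : I) : R := 2 * B * qk.2.+1%:R ^+ 2.
(* An index that codes no ball gets the constant bump [B], which satisfies all the bounds. *)
exists (fun i => if (unpickle i : option I) is Some qk then s qk else B).
exists (fun i => if (unpickle i : option I) is Some qk then K qk else 0).
exists (fun i => if (unpickle i : option I) is Some qk then z qk else 0).
exists (fun i => if (unpickle i : option I) is Some qk then size (qk : I).1 else 0%N).
have sB qk : - B <= s qk.
  have /andP[h _] := fle (z qk); apply: (le_trans h); apply: ub_le_sup => //.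
have K0 qk : 0 <= K qk by rewrite !mulr_ge0.
split=> [i|i|x i|x e e0|i j].
- by case: unpickle => // qk; exact: K0.
- by case: unpickle => [qk|]; [exact: sB|by rewrite (le_trans _ B0)// oppr_le0].
- case: unpickle => [qk|]; last by rewrite mul0r addr0; have /andP[] := fle x.
  have [xz|xz] := ltP `|x - z qk| (r qk).
    apply: (@le_trans _ _ (s qk)); last by rewrite lerDl mulr_ge0// sqr_ge0.
    apply: ub_le_sup => //; exists x => //.
    by rewrite -ball_normE/= distrC.
  have /andP[_ h] := fle x; apply: (le_trans h); have := sB qk.
  suff : 2 * B <= K qk * `|x - z qk| ^+ 2 by lra.
  rewrite /K -mulrA ler_peMr// ?mulr_ge0// -exprMn -[leLHS](expr1n _ 2).
  rewrite ler_pXn2r ?nnegrE ?mulr_ge0//.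
  by rewrite mulrC -ler_pdivrMr// div1r.
- have e2 : 0 < e / 2 by rewrite divr_gt0.
  have /nbhs_ballP[del /= d0 delP] : nbhs x [set y | `|f x - f y| < e / 2].
    by have /cvgrPdist_lt/(_ _ e2) := cf x.
  have [k _ /(_ k (leqnn k))/= kd] : \forall k \near \oo, k.+1%:R^-1 < del / 2 :> R.
    have d20 : 0 < del / 2 by rewrite divr_gt0.
    have /cvgrPdist_lt/(_ _ d20) := @cvg_harmonic R; apply: filterS => k.
    by rewrite sub0r normrN ger0_norm// harmonic_ge0.
  pose KK : R := 2 * B * k.+1%:R ^+ 2.
  have KK0 : 0 <= KK by rewrite !mulr_ge0.
  (* The distance from [x] to the centre must be below the radius, at most 1 so that its square is
     at most [t], and so small that the parabola adds at most [e / 2]. *)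
  pose t := Num.min (k.+1%:R^-1) (Num.min 1 (e / 2 / (KK + 1))).
  have t0 : 0 < t.
    by rewrite !lt_min ltr01 invr_gt0 ltr0n/= divr_gt0// ltr_wpDl.
  have [q xq] := l2_rat_dense x t0; exists (pickle (q, k)); rewrite pickleK.
  have t1 : t <= 1 by rewrite !ge_min lexx orbT.
  have tr : t <= k.+1%:R^-1 by rewrite !ge_min lexx.
  have tK : t * (KK + 1) <= e / 2.
    by rewrite -ler_pdivlMr ?ltr_wpDl// !ge_min lexx !orbT.
  rewrite [leRHS](_ : _ = (f x + e / 2) + e / 2); last by lra.
  apply: lerD.
    apply: ge_sup; first by exists (f (z (q, k))).
    move=> _ [y + <-]; rewrite -ball_normE/= => yz.
    have : `|f x - f y| < e / 2.
      apply: delP; rewrite -ball_normE/=.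
      rewrite (_ : x - y = (x - z (q, k)) + (z (q, k) - y)); last by rewrite subrKA.
      rewrite (le_lt_trans (ler_normD _ _))// (splitr del); apply: ltrD.
        exact: lt_trans (lt_le_trans xq tr) kd.
      exact: lt_trans yz kd.
    by rewrite ltr_norml => /andP[h1 h2]; lra.
  rewrite -/KK; have xq0 := normr_ge0 (x - l2_rat q).
  have h1 : `|x - l2_rat q| ^+ 2 <= t.
    by rewrite expr2 (le_trans (ler_pM xq0 xq0 (ltW xq) (ltW xq)))// ler_piMr// ltW.
  rewrite (le_trans (ler_wpM2l KK0 h1))// (le_trans _ tK)// mulrC ler_wpM2l ?(ltW t0)//.
  by rewrite lerDl.
- case: unpickle => // qk jq; rewrite /z /l2_rat [LHS]l2_finE ltnNge jq//.
Qed.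

Section capped_min.
Context {R : realType}.
Implicit Types (B : R) (u v : nat -> R).

(** The cap gives the empty minimum a value and bounds all finite minima of bumps by the bound of
    [f]. *)
Fixpoint cap_min B u (m : nat) : R :=
  if m is k.+1 then Num.min (cap_min B u k) (u k) else B.

Lemma cap_min_le B u m : cap_min B u m <= B.
Proof. by elim: m => //= m IH; rewrite ge_min IH. Qed.

Lemma cap_min_lei B u m i : (i < m)%N -> cap_min B u m <= u i.
Proof.
elim: m => //= m IH; rewrite ltnS leq_eqVlt => /predU1P[->|/IH h].
  by rewrite ge_min lexx orbT.
by rewrite ge_min h.
Qed.

Lemma le_cap_min B u m c : c <= B -> (forall i, c <= u i) -> c <= cap_min B u m.
Proof. by move=> cB cu; elim: m => //= m IH; rewrite le_min IH cu. Qed.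

Lemma cap_min_mono B u v m : (forall i, u i <= v i) -> cap_min B u m <= cap_min B v m.
Proof. by move=> uv; elim: m => //= m IH; rewrite le_min !ge_min IH uv orbT. Qed.

Lemma cap_min_err B u (e : nat -> R) m c : c <= B -> (forall i, 0 <= e i) ->
  (forall i, (i < m)%N -> c <= u i + e i) -> c <= cap_min B u m + \sum_(i < m) e i.
Proof.
move=> cB e0; elim: m => [_|m IH cu] /=; first by rewrite big_ord0 addr0.
rewrite big_ord_recr/=; have [h|h] := leP (cap_min B u m) (u m).
  by rewrite addrA (le_trans (IH _))// ?lerDl// => i im; apply: cu; exact: ltnW.
by rewrite (le_trans (cu m (ltnSn m)))// lerD2l lerDr sumr_ge0.
Qed.

End capped_min.

Lemma measurable_trig_poly (R : realType) {d} {T : measurableType d}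
    (Z : T -> l2 R) J p : (forall j, measurable_fun setT (fun w => Z w j)) ->
  trig_poly J p -> measurable_fun setT (p \o Z).
Proof.
move=> mZ; elim=> [a b c|{}p q _ IHp _ IHq]; last exact: measurable_funD.
apply: measurable_funM => //; apply: measurable_cos_comp.
apply: measurable_funD => //; apply: measurable_sum => j.
by apply: measurable_funM => //; exact: mZ.
Qed.

(** * From characteristic functions of coordinates to convergence in l2 *)

Section l2_convergence.
Context {R : realType} {d d' : measure_display}.
Context {T : measurableType d} {T' : measurableType d'}.
Variables (P : probability T R) (P' : probability T' R).
Variables (W : nat -> T -> l2 R) (S : T' -> l2 R) (m : nat -> R).
Hypothesis mW : forall n j, measurable_fun setT (fun w => W n w j).
Hypothesis mS : forall j, measurable_fun setT (fun w => S w j).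
Hypothesis cos_cvg : forall (J : nat) (a : nat -> R) (b : R),
  mean P (fun w => cos (\sum_(j < J) a j * W n w j + b)) @[n --> \oo] -->
  mean P' (fun w => cos (\sum_(j < J) a j * S w j + b)).
Hypothesis W2 : forall n j, L1 P (fun w => W n w j ^+ 2).
Hypothesis Wm : forall n j, mean P (fun w => W n w j ^+ 2) <= m j.
Hypothesis cm : cvgn (series m).

Let m0 j : 0 <= m j.
Proof. by apply: le_trans (Wm 0 j); apply: mean_ge0 => w; exact: sqr_ge0. Qed.

Let trig_mean_cvg J p : trig_poly J p ->
  mean P (p \o W n) @[n --> \oo] --> mean P' (p \o S).
Proof.
elim=> [a b c|{}p q tp IHp tq IHq].
  rewrite (_ : (fun n => _) = fun n =>
      c * mean P (fun w => cos (\sum_(j < J) a j * W n w j + b))); last first.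
    apply/funext => n; rewrite -meanZ//; apply: (L1_bounded _ (M := 1)) => [|w].
      apply: (eq_measurable_fun ((fun x : l2 R => 1 * cos (\sum_(j < J) a j * x j + b)) \o W n)).
        by move=> w _ /=; rewrite mul1r.
      by apply: measurable_trig_poly => //; exact: trig_cos.
    exact: cos_max.
  rewrite (_ : mean P' _ = c * mean P' (fun w => cos (\sum_(j < J) a j * S w j + b))).
    by apply: cvgM; [exact: cvg_cst|exact: cos_cvg].
  rewrite -meanZ//; apply: (L1_bounded _ (M := 1)) => [|w].
    apply: (eq_measurable_fun ((fun x : l2 R => 1 * cos (\sum_(j < J) a j * x j + b)) \o S)).
      by move=> w _ /=; rewrite mul1r.
    by apply: measurable_trig_poly => //; exact: trig_cos.
  exact: cos_max.
have L1p (e : measure_display) (E : measurableType e) (Q : probability E R)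
    (Z : E -> l2 R) r : (forall j, measurable_fun setT (fun w => Z w j)) ->
    trig_poly J r -> L1 Q (r \o Z).
  move=> mZ tr; have [M _ rM] := trig_poly_bounded tr.
  by apply: (L1_bounded _ (M := M)) => [|w]; [exact: measurable_trig_poly tr|exact: rM].
rewrite (_ : (fun n => _) = fun n => mean P (p \o W n) + mean P (q \o W n)).
  by rewrite (_ : mean P' _ = mean P' (p \o S) + mean P' (q \o S));
    [exact: cvgD|rewrite -meanD//; exact: L1p].
by apply/funext => n; rewrite -meanD//; exact: L1p.
Qed.

Let approx_mean_cvg J g : trig_approx J g ->
  (forall n, measurable_fun setT (g \o W n)) -> measurable_fun setT (g \o S) ->
  mean P (g \o W n) @[n --> \oo] --> mean P' (g \o S).
Proof.
move=> tg mgW mgS; have [M _ gM] := trig_approx_bounded tg.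
apply/cvgrPdist_le => e e0; have e3 : 0 < e / 3 by rewrite divr_gt0.
have [p tp gp] := tg _ e3; have [M' _ pM] := trig_poly_bounded tp.
have close (k : measure_display) (E : measurableType k) (Q : probability E R)
    (Z : E -> l2 R) : (forall j, measurable_fun setT (fun w => Z w j)) ->
    measurable_fun setT (g \o Z) ->
    `|mean Q (g \o Z) - mean Q (p \o Z)| <= e / 3.
  move=> mZ mgZ; rewrite -meanB.
  - apply: mean_bounded => [|w]; last exact: gp.
    by apply: measurable_funB => //; exact: measurable_trig_poly tp.
  - by apply: (L1_bounded _ (M := M)) => // w; exact: gM.
  - apply: (L1_bounded _ (M := M')) => [|w]; last exact: pM.
    exact: measurable_trig_poly tp.
have /cvgrPdist_le/(_ _ e3) := trig_mean_cvg tp; apply: filterS => n h.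
have h1 := close _ _ P' S mS mgS; have h2 := close _ _ P (W n) (mW n) (mgW n).
rewrite (_ : _ - _ = (mean P' (g \o S) - mean P' (p \o S)) +
  (mean P' (p \o S) - mean P (p \o W n)) + (mean P (p \o W n) - mean P (g \o W n))); last by ring.
rewrite (le_trans (ler_normD _ _))// (le_trans (lerD (ler_normD _ _) (lexx _)))//.
by rewrite [X in _ + X <= _]distrC; lra.
Qed.

(** The tail of the dominating series; it bounds the mean tail of [W n] beyond [J] uniformly in
    [n]. *)
Let tau J : R := limn (series m) - series m J.

Let tail J (x : l2 R) : R := `|x| ^+ 2 - \sum_(k < J) x k ^+ 2.

Let mean_tail n J : L1 P (tail J \o W n) /\ mean P (tail J \o W n) <= tau J.
Proof.
pose F k w := \sum_(i < k) W n w (J + i)%N ^+ 2.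
apply: (@mean_monotone _ _ _ P F) => [k|k w|k w|w|k].
- by apply: L1_sum => i _; exact: W2.
- by apply: sumr_ge0 => i _; exact: sqr_ge0.
- by rewrite /F big_ord_recr/= lerDl sqr_ge0.
- exact: l2_tail_cvg.
rewrite /F mean_sum => [|i _]; last exact: W2.
apply: (le_trans (ler_sum _ (fun (i : 'I_k) _ => Wm n (J + i)%N))).
rewrite /tau lerBrDl; have := nondecreasing_cvgn_le
  (nondecreasing_series (fun k _ _ => m0 k)) cm (J + k)%N.
by rewrite /series/= !big_mkord big_split_ord.
Qed.

Let tau_cvg0 : tau J @[J --> \oo] --> (0 : R).
Proof.
by rewrite -(subrr (limn (series m))); apply: cvgB => //; exact: cvg_cst.
Qed.

(** Two comparisons point in the required directions. Under the limit [S], the trigonometric minimum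
    [V] is at most [U k], whose mean is close to that of [f] by dominated convergence. Under [W n],
    [f] is at most [V] plus errors whose means are controlled by the uniform second moments. The
    means of [V] converge. *)
Lemma l2_cvg_limsup (f : l2 R -> R) (B : R) : continuous f ->
  (forall x, `|f x| <= B) -> forall e, 0 < e ->
  \forall n \near \oo, mean P (f \o W n) <= mean P' (f \o S) + e.
Proof.
move=> cf fB e e0; have B0 : 0 <= B by rewrite (le_trans _ (fB 0)).
have fle x : - B <= f x <= B by have := fB x; rewrite ler_norml.
have [s [K [z [N [K0 sB fu uf zN]]]]] := usc_approximants cf fB.
have e4 : 0 < e / 4 by rewrite divr_gt0.
pose u i (x : l2 R) := s i + K i * `|x - z i| ^+ 2.
pose U k (x : l2 R) := cap_min B (u ^~ x) k.
have mu (k : measure_display) (E : measurableType k) (Z : E -> l2 R) i :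
    (forall j, measurable_fun setT (fun w => Z w j)) ->
    measurable_fun setT (U i \o Z).
  move=> mZ; elim: i => [|i IH]; first exact: measurable_cst.
  apply: measurable_minr => //; apply: measurable_funD => //.
  by apply: measurable_funM => //; exact: measurable_l2_sqr_dist.
have fU k x : f x <= U k x.
  by apply: le_cap_min => [|i]; [have /andP[] := fle x|exact: fu].
have UB k x : `|U k x| <= B.
  rewrite ler_norml cap_min_le andbT (le_trans _ (fU k x))//.
  by have /andP[] := fle x.
have UfS w : U ^~ (S w) @ \oo --> f (S w).
  apply/cvgrPdist_le => t t0; have [i ui] := uf (S w) t t0; near=> k.
  have ik : (i < k)%N by near: k; exact: nbhs_infty_gt.
  rewrite distrC ger0_norm ?subr_ge0// lerBlDl (le_trans _ ui)//.
  exact: (@cap_min_lei _ B (u ^~ (S w)) k i ik).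
have [_ /cvgrPdist_le/(_ _ e4)[k _ /(_ k (leqnn k))/= k0]] :=
  @mean_dct _ _ _ P' (fun k => U k \o S) (f \o S) (fun=> B)
    (fun k => mu _ _ S k mS) UfS (L1_cst P' B) (fun k w => UB k (S w)).
have {}k0 : mean P' (U k \o S) <= mean P' (f \o S) + e / 4.
  by move: k0; rewrite distrC ler_norml => /andP[_]; rewrite lerBlDl.
pose SK := \sum_(i < k) K i.
have SK0 : 0 <= SK by apply: sumr_ge0.
(* Beyond [J] the first [k] centres vanish, so that the tail of [x - z i] is the tail of [x]; and
   the tails, weighted by all the [K i], cost at most [e / 4]. *)
have [J [JN Jtau]] : exists J, (forall i, (i < k)%N -> (N i <= J)%N) /\ SK * tau J <= e / 4.
  pose N' := (\max_(i < k) N i)%N.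
  have et : 0 < e / 4 / (SK + 1) by rewrite divr_gt0// ltr_wpDl.
  have /cvgrPdist_le/(_ _ et)[J0 _ J0P] := tau_cvg0.
  exists (maxn N' J0); split=> [i ik|].
    by rewrite leq_max (leq_bigmax_cond (Ordinal ik)).
  have := J0P (maxn N' J0) (leq_maxr _ _); rewrite /= sub0r normrN => h.
  have {h}h := le_trans (ler_norm _) h.
  have := ler_wpM2l SK0 h; move=> /le_trans; apply.
  by rewrite mulrCA ler_piMr ?(ltW e4)// ler_pdivrMr ?ltr_wpDl// mul1r lerDl.
pose C i := (2 * B + K i) * \sum_(j < J) (2 * m j + 2 * z i j ^+ 2).
have C0 i : 0 <= C i.
  rewrite mulr_ge0 ?addr_ge0 ?mulr_ge0// sumr_ge0// => j _.
  by rewrite addr_ge0// mulr_ge0// sqr_ge0.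
(* The scale of the sine. It is chosen after [J] and [k], so large that the errors of truncation,
   bounded by the sum of the [C i] over [M], stay below [e / 4]. *)
pose M := 4 * (\sum_(i < k) C i) / e + 1.
have M0 : 0 < M by rewrite ltr_wpDl// divr_ge0 ?mulr_ge0 ?sumr_ge0 ?ltW.
have MC : (\sum_(i < k) C i) / M <= e / 4.
  rewrite ler_pdivrMr// /M mulrDr mulr1.
  rewrite (_ : e / 4 * _ = \sum_(i < k) C i); last by field; rewrite gt_eqF.
  by rewrite lerDl ltW.
pose v i (x : l2 R) := s i + K i * \sum_(j < J) (M ^+ 2 * sin ((x j - z i j) / M) ^+ 2).
pose V (x : l2 R) := cap_min B (v ^~ x) k.
have sinle (y : R) : M ^+ 2 * sin (y / M) ^+ 2 <= y ^+ 2.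
  rewrite -{2}(divfK (lt0r_neq0 M0) y) [leRHS]exprMn mulrC ler_wpM2r ?sqr_ge0//.
  rewrite -(real_normK (num_real (sin _))) -[leRHS](real_normK (num_real _)).
  by rewrite ler_pXn2r ?nnegrE// sinB_ler.
have vu i x : v i x <= u i x.
  rewrite lerD2l ler_wpM2l// (le_trans _ (l2_psum_norm (x - z i) J))//.
  by apply: ler_sum => j _; exact: sinle.
have vB i x : - B <= v i x.
  rewrite (le_trans (sB i))// lerDl mulr_ge0// sumr_ge0// => j _.
  by rewrite mulr_ge0// sqr_ge0.
have tV : trig_approx J V.
  rewrite /V; elim: (k) => [|i IH]; first exact: trig_approx_cst.
  apply: trig_approx_min => //; apply: trig_approxD; first exact: trig_approx_cst.
  apply: trig_approxZ; apply: trig_approx_sum => j; apply: trig_approxZ.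
  exact: trig_approx_sin2.
have mV (l : measure_display) (E : measurableType l) (Z : E -> l2 R) :
    (forall j, measurable_fun setT (fun w => Z w j)) ->
    measurable_fun setT (V \o Z).
  move=> mZ; rewrite /V; elim: (k) => [|i IH]; first exact: measurable_cst.
  apply: measurable_minr => //; apply: measurable_funD => //.
  apply: measurable_funM => //; apply: measurable_sum => j.
  apply: measurable_funM => //; apply: measurable_funX.
  apply: measurable_sin_comp.
  by apply: measurable_funM => //; apply: measurable_funB => //; exact: mZ.
(* If some squared coordinate of [x - z i] exceeds [M], the first term is at least [2 * B], the
   oscillation of [f]. Otherwise the sine replaces [y ^+ 2] at a cost of at most
   [y ^+ 4 / M ^+ 2 <= y ^+ 2 / M]. The second term pays for the coordinates beyond [J]. *)
pose err i (x : l2 R) := (2 * B + K i) / M * \sum_(j < J) (x j - z i j) ^+ 2 + K i * tail J x.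
have err0 i x : 0 <= err i x.
  apply: addr_ge0; apply: mulr_ge0; [|by apply: sumr_ge0 => j _; exact: sqr_ge0|exact: K0|exact: l2_tail_ge0].
  apply: divr_ge0; last exact: ltW.
  by apply: addr_ge0; [exact: mulr_ge0|exact: K0].
have ferr i x : (i < k)%N -> f x <= v i x + err i x.
  move=> ik.
  have y0 j : 0 <= (x j - z i j) ^+ 2 by exact: sqr_ge0.
  have [[j jM]|] := pselect (exists j : 'I_J, M < (x j - z i j) ^+ 2).
    have /andP[_ h] := fle x; apply: (le_trans h).
    have h1 := vB i x.
    have h2 : 2 * B <= (2 * B + K i) / M * \sum_(j < J) (x j - z i j) ^+ 2.
      rewrite -mulrA; apply: (@le_trans _ _ ((2 * B + K i) * 1)).
        by rewrite mulr1 lerDl.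
      rewrite ler_wpM2l ?addr_ge0 ?mulr_ge0// mulrC ler_pdivlMr// mul1r.
      by rewrite (bigD1 j)//= (le_trans (ltW jM))// lerDl sumr_ge0.
    have h3 : 0 <= K i * tail J x by rewrite mulr_ge0 ?l2_tail_ge0.
    by rewrite /err; lra.
  move=> /forallNP yM; apply: (le_trans (fu x i)).
  rewrite /v /err -addrA lerD2l.
  have -> : `|x - z i| ^+ 2 = \sum_(j < J) (x j - z i j) ^+ 2 + tail J x.
    rewrite -[LHS](subrK (\sum_(j < J) (x - z i) j ^+ 2)) addrC; congr (_ + _).
    rewrite /tail -(cvg_lim _ (@l2_tail_cvg _ (x - z i) J))// -(cvg_lim _ (@l2_tail_cvg _ x J))//.
    congr (limn _); apply/funext => n; apply: eq_bigr => l _.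
    have -> // : (x - z i) (J + l)%N = x (J + l)%N.
    by rewrite [LHS](l2B x (z i)) zN ?subr0// (leq_trans (JN i ik))// leq_addr.
  rewrite mulrDr addrA lerD2r -lerBlDl -mulrBr -sumrB.
  apply: (@le_trans _ _ (K i * \sum_(j < J) (x j - z i j) ^+ 2 / M)); last first.
    rewrite -mulr_suml mulrA mulrAC ler_wpM2r ?sumr_ge0//.
    by rewrite ler_wpM2r ?invr_ge0 ?(ltW M0)// lerDr mulr_ge0.
  rewrite ler_wpM2l//; apply: ler_sum => j _.
  have := sqrB_sin_le ((x j - z i j) / M).
  have /negP := yM j; rewrite -leNgt; move: (x j - z i j) => y yM' h.
  have {}h := ler_wpM2l (sqr_ge0 M) h; move: h; rewrite mulrBr.
  rewrite (_ : M ^+ 2 * (y / M) ^+ 2 = y ^+ 2); last by field; rewrite gt_eqF.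
  move=> /le_trans; apply.
  rewrite (_ : M ^+ 2 * _ = (y ^+ 2 / M) * (y ^+ 2 / M)); last by field; rewrite gt_eqF.
  rewrite ler_piMr ?divr_ge0 ?sqr_ge0 ?(ltW M0)//.
  by rewrite ler_pdivrMr// mul1r.
have mf n : measurable_fun setT (f \o W n) by exact: measurable_l2_continuous.
have L1f n : L1 P (f \o W n) by apply: (L1_bounded _ (M := B)) => // w; exact: fB.
have L1dif n i j : L1 P (fun w => (W n w j - z i j) ^+ 2).
  apply: (@L1_le _ _ _ _ _ (fun w => 2 * W n w j ^+ 2 + 2 * z i j ^+ 2)).
  - by apply: measurable_funX; apply: measurable_funB => //; exact: mW.
  - by apply: L1D; [exact/L1Z/W2|exact: L1_cst].
  - move=> w; rewrite ger0_norm ?sqr_ge0//.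
    by have := sqr_ge0 (W n w j + z i j); nra.
have L1err n i : L1 P (err i \o W n).
  apply: L1D; apply: L1Z; last exact: (mean_tail n J).1.
  by apply: L1_sum => j _; exact: L1dif.
have merr n i : mean P (err i \o W n) <= C i / M + K i * tau J.
  rewrite (_ : _ \o _ = fun w => (2 * B + K i) / M * (\sum_(j < J) (W n w j - z i j) ^+ 2)
    + K i * (tail J \o W n) w)//.
  have L1s : L1 P (fun w => \sum_(j < J) (W n w j - z i j) ^+ 2).
    by apply: L1_sum => j _; exact: L1dif.
  have [tail1 tail2] := mean_tail n J.
  rewrite meanD; [|exact: L1Z|exact: L1Z]; rewrite !meanZ//.
  apply: lerD; last by rewrite ler_wpM2l.
  rewrite /C [leRHS]mulrAC; apply: ler_wpM2l.
    apply: divr_ge0; last exact: ltW.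
    by apply: addr_ge0; [exact: mulr_ge0|exact: K0].
  rewrite mean_sum => [|j _]; last exact: L1dif.
  apply: ler_sum => j _.
  apply: (@le_trans _ _ (mean P (fun w => 2 * W n w j ^+ 2 + 2 * z i j ^+ 2))).
    apply: mean_le => // [|w]; first by apply: L1D; [exact/L1Z/W2|exact: L1_cst].
    by have := sqr_ge0 (W n w j + z i j); nra.
  rewrite meanD; [|exact/L1Z/W2|exact: L1_cst].
  by rewrite meanZ ?mean_cst ?W2// lerD2r ler_wpM2l.
have VB x : `|V x| <= B.
  rewrite ler_norml cap_min_le andbT; apply: le_cap_min => [|i]; last exact: vB.
  by rewrite (le_trans _ B0)// oppr_le0.
have L1V n : L1 P (V \o W n).
  by apply: (L1_bounded _ (M := B)) => [|w]; [exact: mV|exact: VB].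
have key n : mean P (f \o W n) <= mean P (V \o W n) + e / 4 + e / 4.
  have L1s : L1 P (fun w => \sum_(i < k) (err i \o W n) w).
    by apply: L1_sum => i _; exact: L1err.
  apply: (@le_trans _ _ (mean P (fun w => (V \o W n) w + \sum_(i < k) (err i \o W n) w))).
    apply: mean_le => //; first exact: L1D.
    move=> w; apply: (@cap_min_err _ B (v ^~ (W n w)) (err ^~ (W n w)) k) => [|i|i ik]; [by have /andP[] := fle (W n w)|exact: err0|exact: ferr].
  rewrite meanD// -addrA lerD2l mean_sum => [|i _]; last exact: L1err.
  apply: (le_trans (ler_sum _ (fun (i : 'I_k) _ => merr n i))).
  by rewrite big_split/= -mulr_suml -mulr_suml lerD.
have VU : mean P' (V \o S) <= mean P' (U k \o S).
  apply: mean_le => [||w]; last exact: cap_min_mono.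
  - by apply: (L1_bounded _ (M := B)) => [|w]; [exact: mV|exact: VB].
  - by apply: (L1_bounded _ (M := B)) => [|w]; [exact: mu|exact: UB].
have /cvgrPdist_le/(_ _ e4) := approx_mean_cvg tV (fun n => mV _ _ _ (mW n)) (mV _ _ _ mS).
apply: filterS => n; rewrite distrC ler_norml => /andP[_ hn].
by have := key n; lra.
Unshelve. all: by end_near. Qed.

(** The upper bound of [l2_cvg_limsup] for [- f] is the lower bound for [f]. *)
Theorem l2_cvg_in_distribution (f : l2 R -> R) : continuous f -> bounded_fun f ->
  mean P (f \o W n) @[n --> \oo] --> mean P' (f \o S).
Proof.
move=> cf [B0 [_ /(_ (B0 + 1))]]; rewrite ltrDl ltr01 => /(_ isT) bf.
have fB x : `|f x| <= B0 + 1 by exact: bf.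
apply/cvgrPdist_le => e e0.
have up := l2_cvg_limsup cf fB e0.
have cfN : continuous (fun x => - f x) by move=> x; exact: (continuousN (cf x)).
have fBN x : `|- f x| <= B0 + 1 by rewrite normrN.
have dn := l2_cvg_limsup cfN fBN e0.
have L1f (k : measure_display) (E : measurableType k) (Q : probability E R)
    (Z : E -> l2 R) : (forall j, measurable_fun setT (fun w => Z w j)) -> L1 Q (f \o Z).
  move=> mZ; apply: (L1_bounded _ (M := B0 + 1)) => [|w]; last exact: fB.
  exact: measurable_l2_continuous.
near=> n.
have h1 : mean P (f \o W n) <= mean P' (f \o S) + e by near: n.
have : mean P ((fun x => - f x) \o W n) <= mean P' ((fun x => - f x) \o S) + e by near: n.
rewrite !(meanN (L1f _ _ _ _ _))//.
by rewrite ler_norml; lra.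
Unshelve. all: by end_near. Qed.

End l2_convergence.

Lemma L1_sqr_sum {d} {T : measurableType d} {R : realType} (P : probability T R)
    (I : Type) (r : seq I) (F : I -> T -> R) :
  (forall i, measurable_fun setT (F i)) -> (forall i, L1 P (fun w => F i w ^+ 2)) ->
  L1 P (fun w => (\sum_(i <- r) F i w) ^+ 2).
Proof.
move=> mF iF; elim: r => [|i r IHr].
  by apply: (eq_L1 _ (L1_cst P 0)) => w; rewrite big_nil expr0n.
apply: (@L1_le _ _ _ _ _ (fun w => 2 * F i w ^+ 2 + 2 * (\sum_(j <- r) F j w) ^+ 2)).
- by apply: measurable_funX; exact: measurable_sum.
- by apply: L1D; exact: L1Z.
- move=> w; rewrite ger0_norm ?sqr_ge0// big_cons.
  by have := sqr_ge0 (F i w - \sum_(j <- r) F j w); lra.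
Qed.

Lemma continuous_cos_quadratic (R : realType) (V : topologicalType) (n : nat)
    (g : nat -> V -> R) (c r : nat -> R) (b : R) : (forall a, continuous (g a)) ->
  continuous (fun x => cos (\sum_(a < n) c a * (g a x ^+ 2 - r a) + b)).
Proof.
move=> cg x; apply: (cvg_comp (fun x => \sum_(a < n) c a * (g a x ^+ 2 - r a) + b) cos);
  last exact: continuous_cos.
apply: cvgD; last exact: cvg_cst.
elim: n => [|n IHn].
  by rewrite (_ : (fun _ => _) = fun=> 0); [rewrite big_ord0; exact: cvg_cst|
    apply/funext => y; rewrite big_ord0].
rewrite (_ : (fun _ => _) = fun y => \sum_(a < n) c a * (g a y ^+ 2 - r a) +
  c n * (g n y ^+ 2 - r n)); last by apply/funext => y; rewrite big_ord_recr.
rewrite big_ord_recr; apply: cvgD => //; apply: cvgM; first exact: cvg_cst.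
by apply: cvgB; [apply: (cvg_comp (g n) (fun y => y ^+ 2) (cg n x)); exact: exprn_continuous|exact: cvg_cst].
Qed.

(** * Quadratic forms in Gaussian variables *)

Section gaussian_rotation.
Context {d : measure_display} {T : measurableType d} {R : realType}.
Variables (P : probability T R) (xi : nat -> T -> R).
Hypothesis xiG : gaussian_family P xi.
Local Notation PP := (prodP P P).
Local Notation r := (gcov P xi).

Let mxi a : measurable_fun setT (xi a). Proof. exact: gaussian_family_meas xiG a. Qed.

Let mxi1 a : measurable_fun setT (fun z : T * T => xi a z.1).
Proof. exact: (measurableT_comp (mxi a) measurable_fst). Qed.

Let mxi2 a : measurable_fun setT (fun z : T * T => xi a z.2).
Proof. exact: (measurableT_comp (mxi a) measurable_snd). Qed.

Lemma L1_fst (F : T -> R) : L1 P F -> L1 PP (fun z => F z.1).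
Proof.
by move=> iF; apply: (eq_L1 _ (L1_prod iF (L1_cst P 1))) => z; rewrite mulr1.
Qed.

Lemma L1_snd (F : T -> R) : L1 P F -> L1 PP (fun z => F z.2).
Proof.
by move=> iF; apply: (eq_L1 _ (L1_prod (L1_cst P 1) iF)) => z; rewrite mul1r.
Qed.

Lemma mean_fst (F : T -> R) : L1 P F -> mean PP (fun z => F z.1) = mean P F.
Proof.
move=> iF; rewrite -[RHS]mulr1 -(mean_cst P 1) -mean_prod//; last exact: L1_cst.
by apply: eq_mean => z; rewrite mulr1.
Qed.

(** For a linear combination with variance [q], integrating the second copy produces
    [expR (- (si ^+ 2 * q / 2))] and the first one supplies the same with [co]; the product depends
    on [co ^+ 2 + si ^+ 2] only. The vectors are put into [l2] so that the convergence criterion,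
    applied to a constant sequence, turns this into equality of means. *)
Lemma gaussian_rotation (N : nat) (f : l2 R -> R) (co si : R) :
  co ^+ 2 + si ^+ 2 = 1 -> continuous f -> bounded_fun f ->
  mean PP (fun z => f (l2_fin N (fun a => co * xi a z.1 + si * xi a z.2))) =
  mean P (fun w => f (l2_fin N (xi ^~ w))).
Proof.
move=> cs1 cf bf.
pose W (z : T * T) := l2_fin N (fun a => co * xi a z.1 + si * xi a z.2).
pose S w := l2_fin N (xi ^~ w).
have mW j : measurable_fun setT (fun z => W z j).
  rewrite (_ : (fun z => _) = if (j < N)%N then (fun z => co * xi j z.1 + si * xi j z.2) else fun=> 0).
    by case: ifP => // _; apply: measurable_funD; apply: measurable_funM.
  by apply/funext => z; rewrite /W l2_finE; case: ifP.
have mS j : measurable_fun setT (fun w => S w j).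
  rewrite (_ : (fun z => _) = if (j < N)%N then xi j else fun=> 0).
    by case: ifP.
  by apply/funext => z; rewrite /S l2_finE; case: ifP.
have W2 j : L1 PP (fun z => W z j ^+ 2).
  rewrite (_ : (fun z => _) = if (j < N)%N then (fun z => (co * xi j z.1 + si * xi j z.2) ^+ 2) else fun=> 0).
    case: ifP => // _; last exact: L1_cst.
    apply: (@L1_le _ _ _ _ _ (fun z => 2 * co ^+ 2 * xi j z.1 ^+ 2 + 2 * si ^+ 2 * xi j z.2 ^+ 2)).
    - by apply: measurable_funX; apply: measurable_funD; apply: measurable_funM.
    - apply: L1D; apply: L1Z.
        by apply: (L1_fst (F := fun w => xi j w ^+ 2)); exact: gaussian_family_L2.
      by apply: (L1_snd (F := fun w => xi j w ^+ 2)); exact: gaussian_family_L2.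
    - move=> z; rewrite ger0_norm ?sqr_ge0//.
      by have := sqr_ge0 (co * xi j z.1 - si * xi j z.2); lra.
  by apply/funext => z; rewrite /W l2_finE; case: ifP => // _; rewrite expr0n.
(* The dominating sequence is the second moments themselves; they vanish from index [N] on, which
   makes the series converge. *)
pose m j := mean PP (fun z => W z j ^+ 2).
have cm : cvgn (series m).
  apply: (cvgP (series m N)); apply: cvg_near_cst; near=> n.
  have Nn : (N <= n)%N by near: n; exact: nbhs_infty_ge.
  rewrite /series/= (big_cat_nat (n := N) (p := n))//= -[RHS]addr0; congr (_ + _).
  apply: big1_seq => j /andP[_]; rewrite mem_index_iota => /andP[Nj _].
  by rewrite /m (@eq_mean _ _ _ PP _ (fun=> 0)) ?mean_cst// => z; rewrite /W l2_finE ltnNge Nj expr0n.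
have key J (a : nat -> R) b : mean PP (fun z => cos (\sum_(j < J) a j * W z j + b)) =
    mean P (fun w => cos (\sum_(j < J) a j * S w j + b)).
  pose a' j := if (j < N)%N then a j else 0.
  pose L w := \sum_(j < J) a' j * xi j w.
  have mL : measurable_fun setT L by apply: measurable_sum => j; apply: measurable_funM.
  have SL w : \sum_(j < J) a j * S w j = L w.
    by apply: eq_bigr => j _; rewrite /S l2_finE /a'; case: ifP; rewrite // mulr0 mul0r.
  have WL z : \sum_(j < J) a j * W z j = co * L z.1 + si * L z.2.
    rewrite /L !mulr_sumr -big_split/=; apply: eq_bigr => j _; rewrite /W l2_finE /a'.
    by case: ifP; rewrite ?mul0r ?mulr0 ?addr0// => _; ring.
  have ch t b' := gaussian_linear_charfun xiG (@nat_of_ord J) (a' \o @nat_of_ord J) t b'.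
  move: ch; rewrite /= -/L; set q := (\sum_(i < J) _) => ch.
  have chL t b' : mean P (fun w => cos (t * L w + b')) = cos b' * expR (- (t ^+ 2 * q / 2)).
    exact: ch.
  have mcos (F : T -> R) : measurable_fun setT F -> measurable_fun setT (fun w => cos (F w)).
    exact: measurable_cos_comp.
  rewrite (@eq_mean _ _ _ P _ (fun w => cos (1 * L w + b))); last by move=> w; rewrite SL mul1r.
  rewrite (@eq_mean _ _ _ PP _ (fun z => cos (si * L z.2 + (co * L z.1 + b)))); last first.
    by move=> z; rewrite WL; congr cos; ring.
  have iF : L1 PP (fun z => cos (si * L z.2 + (co * L z.1 + b))).
    apply: (L1_bounded _ (M := 1)) => [|z]; last exact: cos_max.
    apply: measurable_cos_comp; apply: measurable_funD; first by apply: measurable_funM => //; exact: (measurableT_comp mL measurable_snd).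
    by apply: measurable_funD => //; apply: measurable_funM => //; exact: (measurableT_comp mL measurable_fst).
  rewrite (mean_prod1 (G := fun x => expR (- (si ^+ 2 * q / 2)) * cos (co * L x + b)) iF) => [|x|x].
  - rewrite meanZ; last first.
      apply: (L1_bounded _ (M := 1)) => [|z]; last exact: cos_max.
      by apply: mcos; apply: measurable_funD => //; exact: measurable_funM.
    rewrite !chL mulrCA -expRD; congr (_ * expR _).
    by rewrite expr1n -cs1; ring.
  - rewrite /=; apply: (L1_bounded _ (M := 1)) => [|z]; last exact: cos_max.
    by apply: mcos; apply: measurable_funD => //; exact: measurable_funM.
  - by rewrite /= chL mulrC.
have := @l2_cvg_in_distribution R _ _ _ _ PP P (fun _ => W) S m (fun=> mW) mS _ (fun=> W2)
  (fun _ j => lexx _) cm f cf bf.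
move=> H; have {}H : mean PP (f \o W) @[_ --> \oo] --> mean P (f \o S).
  by apply: H => J a b; rewrite key; exact: cvg_cst.
rewrite -[RHS](cvg_lim (@Rhausdorff R) H); apply/esym/cvg_lim; first exact: Rhausdorff.
exact: cvg_cst.
Unshelve. all: by end_near. Qed.

End gaussian_rotation.

(** * Stein's identity for a centred quadratic form *)

Section quadratic_stein.
Context {d : measure_display} {T : measurableType d} {R : realType}.
Variables (P : probability T R) (xi : nat -> T -> R).
Hypothesis xiG : gaussian_family P xi.
Local Notation PP := (prodP P P).
Local Notation r := (gcov P xi).
Variables (N : nat) (c : nat -> R).

Let mxi a : measurable_fun setT (xi a). Proof. exact: gaussian_family_meas xiG a. Qed.

Definition quad_form w := \sum_(a < N) c a * (xi a w ^+ 2 - r a a).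

(** A quarter of the squared gradient of the form in the metric of the covariance: the partial
    derivatives are [2 * c a * xi a]. Stein's identity halves the squared gradient on centred
    quadratic forms, which leaves the factor 2 in [quad_stein]. *)
Definition quad_carre w := \sum_(a < N) \sum_(b < N) c a * c b * r a b * (xi a w * xi b w).

Let Q := quad_form.
Let V := quad_carre.
(** The cross term produced by a rotation. Given the first copy, its mean square over the second is
    [V]. *)
Let B (z : T * T) := \sum_(a < N) c a * (xi a z.1 * xi a z.2).

Lemma measurable_quad_form : measurable_fun setT Q.
Proof.
apply: measurable_sum => a; apply: measurable_funM => //.
by apply: measurable_funB => //; exact: measurable_funX.
Qed.
Let mQ := measurable_quad_form.

Lemma quad_form_L2 : L1 P (fun w => Q w ^+ 2).
Proof.
apply: L1_sqr_sum => a.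
  by apply: measurable_funM => //; apply: measurable_funB => //; exact: measurable_funX.
apply: (eq_L1 (Y := fun w => c a ^+ 2 * (xi a w ^+ 4 - 2 * r a a * xi a w ^+ 2 + r a a ^+ 2))).
  by move=> w; ring.
apply: L1Z; apply: L1D; last exact: L1_cst.
by apply: L1B; [exact: gaussian_family_L4|apply: L1Z; exact: gaussian_family_L2].
Qed.

Let iQ : L1 P Q. Proof. by apply: L1_sqr mQ _; exact: quad_form_L2. Qed.

Lemma mean_quad_form : mean P Q = 0.
Proof.
rewrite mean_sum => [|a _]; last first.
  by apply: L1Z; apply: L1B; [exact: gaussian_family_L2|exact: L1_cst].
apply: big1 => a _; rewrite meanZ; last first.
  by apply: L1B; [exact: gaussian_family_L2|exact: L1_cst].
rewrite meanB; [|exact: gaussian_family_L2|exact: L1_cst].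
by rewrite mean_cst /gcov (@eq_mean _ _ _ P _ (fun w => xi a w * xi a w)) ?subrr ?mulr0.
Qed.

Lemma quad_carre_L1 : L1 P V.
Proof.
apply: L1_sum => a _; apply: L1_sum => b _; apply: L1Z.
exact: (gaussian_family_L1M xiG).
Qed.

Lemma mean_quad_carre :
  mean P V = \sum_(a < N) \sum_(b < N) c a * c b * r a b ^+ 2.
Proof.
rewrite mean_sum => [|a _]; last first.
  by apply: L1_sum => b _; apply: L1Z; exact: (gaussian_family_L1M xiG).
apply: eq_bigr => a _; rewrite mean_sum => [|b _]; last first.
  by apply: L1Z; exact: (gaussian_family_L1M xiG).
apply: eq_bigr => b _; rewrite meanZ; last exact: (gaussian_family_L1M xiG).
by rewrite -/(r a b) -mulrA -expr2.
Qed.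

Let mB : measurable_fun setT B.
Proof.
apply: measurable_sum => a; apply: measurable_funM => //.
exact: measurable_prodM.
Qed.

Let B2 : L1 PP (fun z => B z ^+ 2).
Proof.
apply: L1_sqr_sum => a.
  by apply: measurable_funM => //; exact: measurable_prodM.
apply: (eq_L1 (Y := fun z => c a ^+ 2 * (xi a z.1 ^+ 2 * xi a z.2 ^+ 2))).
  by move=> w; ring.
by apply: L1Z; apply: (L1_prod (F := fun w => xi a w ^+ 2) (G := fun w => xi a w ^+ 2));
  exact: gaussian_family_L2.
Qed.

Let rotated (co si : R) (z : T * T) : co ^+ 2 + si ^+ 2 = 1 ->
  \sum_(a < N) c a * ((co * xi a z.1 + si * xi a z.2) ^+ 2 - r a a) =
  co ^+ 2 * Q z.1 + si ^+ 2 * Q z.2 + 2 * (co * si) * B z.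
Proof.
move=> cs1; rewrite /Q /quad_form /B !mulr_sumr -!big_split/=.
apply: eq_bigr => a _.
have E : r a a = (co ^+ 2 + si ^+ 2) * r a a by rewrite cs1 mul1r.
by rewrite [in LHS]E; ring.
Qed.

(* Invariance of the law of [(xi, xi')] under a rotation by a small angle,
   expanded to second order in the angle. *)
Lemma quad_stein (b : R) :
  mean P (fun w => Q w * sin (Q w + b)) = 2 * mean P (fun w => V w * cos (Q w + b)).
Proof.
(* The angle is given by its sine [h n], and its cosine is [co n]. *)
pose h (n : nat) : R := n.+1%:R^-1.
pose co n := Num.sqrt (1 - h n ^+ 2).
have h0 n : 0 < h n by rewrite invr_gt0.
have h1 n : h n <= 1 by rewrite invf_le1// ler1n.
have hh n : h n ^+ 2 <= 1 by rewrite expr_le1// ltW.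
have cosqr n : co n ^+ 2 = 1 - h n ^+ 2 by rewrite sqr_sqrtr// subr_ge0.
have co0 n : 0 <= co n by exact: sqrtr_ge0.
have co1 n : co n <= 1.
  by rewrite -(@expr_le1 _ 2)// cosqr gerBl sqr_ge0.
have cs n : co n ^+ 2 + h n ^+ 2 = 1 by rewrite cosqr subrK.
(* The rotated form is [Q z.1 + h n * E n z], by [rotated] and [co n ^+ 2 = 1 - h n ^+ 2]. *)
pose E n (z : T * T) := h n * (Q z.2 - Q z.1) + 2 * co n * B z.
pose D n z := (cos (Q z.1 + b + h n * E n z) - cos (Q z.1 + b) +
  h n * E n z * sin (Q z.1 + b)) / h n ^+ 2.
(* Dominates [2 * E n z ^+ 2]: the square of a sum of three terms is at most three times the sum of
   their squares, and [h n] and [co n] are at most 1. *)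
pose Z z := 6 * (Q z.1 ^+ 2 + Q z.2 ^+ 2 + 4 * B z ^+ 2).
have mQ1 : measurable_fun setT (fun z : T * T => Q z.1).
  exact: (measurableT_comp mQ measurable_fst).
have mQ2 : measurable_fun setT (fun z : T * T => Q z.2).
  exact: (measurableT_comp mQ measurable_snd).
have mS : measurable_fun setT (fun z : T * T => sin (Q z.1 + b)).
  by apply: measurable_sin_comp; exact: measurable_funD.
have mC : measurable_fun setT (fun z : T * T => cos (Q z.1 + b)).
  by apply: measurable_cos_comp; exact: measurable_funD.
have mE n : measurable_fun setT (E n).
  apply: measurable_funD; apply: measurable_funM => //.
  exact: measurable_funB.
have mhE n : measurable_fun setT (fun z => h n * E n z) by exact: measurable_funM.
have mC' n : measurable_fun setT (fun z : T * T => cos (Q z.1 + b + h n * E n z)).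
  by apply: measurable_cos_comp; apply: measurable_funD => //; exact: measurable_funD.
have mD n : measurable_fun setT (D n).
  apply: measurable_funM => //; apply: measurable_funD; first exact: measurable_funB.
  exact: measurable_funM.
have iQ1 : L1 PP (fun z => Q z.1 ^+ 2).
  by apply: (L1_fst (F := fun w => Q w ^+ 2)); exact: quad_form_L2.
have iQ2 : L1 PP (fun z => Q z.2 ^+ 2).
  by apply: (L1_snd (F := fun w => Q w ^+ 2)); exact: quad_form_L2.
have iZ : L1 PP Z.
  by apply: L1Z; apply: L1D; [exact: L1D|exact: L1Z].
have ZD n z : `|D n z| <= Z z.
  rewrite /D normrM normfV (@ger0_norm _ (h n ^+ 2)) ?sqr_ge0// ler_pdivrMr ?exprn_gt0//.
  rewrite (le_trans (cosD_taylor1 _ _))// exprMn mulrCA mulrC ler_wpM2r ?sqr_ge0//.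
  rewrite /Z /E; have := hh n; have := h0 n.
  have cc : co n ^+ 2 <= 1 by rewrite cosqr gerBl sqr_ge0.
  move: (Q z.1) (Q z.2) (B z) (h n) (co n) cc => x y u s k kk s0 ss.
  have e1 := sqr_ge0 (s * y + s * x); have e2 := sqr_ge0 (s * y - 2 * k * u).
  have e3 := sqr_ge0 (s * x + 2 * k * u).
  have f1 : s ^+ 2 * x ^+ 2 <= x ^+ 2 by rewrite ler_piMl// sqr_ge0.
  have f2 : s ^+ 2 * y ^+ 2 <= y ^+ 2 by rewrite ler_piMl// sqr_ge0.
  have f3 : k ^+ 2 * u ^+ 2 <= u ^+ 2 by rewrite ler_piMl// sqr_ge0.
  by lra.
have hcvg : h @ \oo --> (0 : R) by exact: cvg_harmonic.
have cocvg : co @ \oo --> (1 : R).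
  apply/cvgrPdist_le => e e0; have /cvgrPdist_le/(_ _ e0) := hcvg; apply: filterS => n.
  rewrite sub0r normrN ger0_norm ?(ltW (h0 n))// => he.
  rewrite ger0_norm ?subr_ge0//; have := cs n; have := co0 n; have := co1 n.
  by move: (co n) (h n) (h0 n) (h1 n) he => k s s0 s1 se k1 k0 ks; nra.
(* [E n z] tends to [2 * B z], so the quadratic Taylor term tends to
   [- 2 * B z ^+ 2 * cos (Q z.1 + b)]; the remainder after division is at most
   [h n * |E n z| ^+ 3]. *)
have DL z : D ^~ z @ \oo --> - (2 * B z ^+ 2 * cos (Q z.1 + b)).
  have Ecvg : E ^~ z @ \oo --> 2 * B z.
    rewrite -[X in _ --> X]add0r -{1}(mul0r (Q z.2 - Q z.1)) -[2 in X in _ --> X]mulr1.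
    by apply: cvgD; apply: cvgM; [|exact: cvg_cst|apply: cvgM; [exact: cvg_cst|]|exact: cvg_cst].
  rewrite (_ : - _ = - ((2 * B z) * (2 * B z) / 2 * cos (Q z.1 + b)) + 0); last by rewrite addr0; field.
  rewrite (_ : D ^~ z = fun n => - (E n z * E n z / 2 * cos (Q z.1 + b)) +
    (D n z + E n z * E n z / 2 * cos (Q z.1 + b))); last first.
    by apply/funext => n; ring.
  apply: cvgD.
    by apply: cvgN; do 2 (apply: cvgM; last exact: cvg_cst); exact: cvgM.
  apply/norm_cvg0P.
  apply: (@squeeze_cvgr _ _ _ _ (fun=> 0) (fun n => h n * (`|E n z| * `|E n z| * `|E n z|))).
  - apply: nearW => n; rewrite normr_ge0/=.
    have hn := h0 n; have hn0 : h n != 0 by rewrite gt_eqF.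
    have := cosD_taylor2 (Q z.1 + b) (h n * E n z).
    rewrite (_ : _ + _ + _ = (D n z + E n z * E n z / 2 * cos (Q z.1 + b)) * h n ^+ 2); last first.
      by rewrite /D; field.
    rewrite normrM (@ger0_norm _ (h n ^+ 2)) ?sqr_ge0// normrM (gtr0_norm hn).
    rewrite -ler_pdivlMr ?exprn_gt0// => /le_trans; apply.
    by rewrite le_eqVlt; apply/orP; left; apply/eqP; field.
  - exact: cvg_cst.
  - rewrite -[X in _ --> X](mul0r (`|2 * B z| * `|2 * B z| * `|2 * B z|)).
    by apply: cvgM => //; apply: cvgM; [apply: cvgM|]; exact: cvg_norm.
have [_ DM] := mean_dct mD DL iZ ZD.
have iQS : L1 P (fun w => Q w * sin (Q w + b)).
  apply: (L1_mulB (M := 1) iQ) => [|w]; last exact: sin_max.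
  by apply: measurable_sin_comp; exact: measurable_funD.
have iS : L1 P (fun w => sin (Q w + b)).
  apply: (L1_bounded _ (M := 1)) => [|w]; last exact: sin_max.
  by apply: measurable_sin_comp; exact: measurable_funD.
have mXS a : measurable_fun setT (fun w => xi a w * sin (Q w + b)).
  by apply: measurable_funM => //; apply: measurable_sin_comp; exact: measurable_funD.
have iXS a : L1 P (fun w => xi a w * sin (Q w + b)).
  apply: (L1_mulB (M := 1)) => [||w]; [exact: gaussian_family_L1| |exact: sin_max].
  by apply: measurable_sin_comp; exact: measurable_funD.
have MB : L1 PP (fun z => B z * sin (Q z.1 + b)) /\ mean PP (fun z => B z * sin (Q z.1 + b)) = 0.
  have E2 : (fun z => B z * sin (Q z.1 + b)) =1
      (fun z => \sum_(a < N) c a * ((xi a z.1 * sin (Q z.1 + b)) * xi a z.2)).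
    by move=> z; rewrite /B mulr_suml; apply: eq_bigr => a _; ring.
  have iF a : L1 PP (fun z => (xi a z.1 * sin (Q z.1 + b)) * xi a z.2).
    by apply: (L1_prod (iXS a)); exact: gaussian_family_L1.
  split; first by apply: (eq_L1 (fun z => esym (E2 z))); apply: L1_sum => a _; exact: L1Z.
  rewrite (eq_mean _ E2) mean_sum => [|a _]; last exact: L1Z.
  apply: big1 => a _; rewrite meanZ// (mean_prod (iXS a)) ?(xiG.1 a) ?mulr0//.
  exact: gaussian_family_L1.
have M2 : L1 PP (fun z => sin (Q z.1 + b) * Q z.2) /\ mean PP (fun z => sin (Q z.1 + b) * Q z.2) = 0.
  split; first exact: (L1_prod iS iQ).
  by rewrite (mean_prod iS iQ) mean_quad_form mulr0.
have M1 : L1 PP (fun z => Q z.1 * sin (Q z.1 + b)) /\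
    mean PP (fun z => Q z.1 * sin (Q z.1 + b)) = mean P (fun w => Q w * sin (Q w + b)).
  by split; [exact: (L1_fst iQS)|exact: (mean_fst iQS)].
(* By invariance the two cosines have equal means, so only the linear term counts. In it [Q z.2] and
   [B z] average to 0 over the second copy; the part [- h n * Q z.1] of [E n z] is left, and the
   mean does not depend on [n]. *)
have DE n : mean PP (D n) = - mean P (fun w => Q w * sin (Q w + b)).
  have hn0 : h n != 0 by rewrite gt_eqF.
  have [MB1 MB2] := MB; have [M21 M22] := M2; have [M11 M12] := M1.
  have iC : L1 PP (fun z => cos (Q z.1 + b)).
    by apply: (L1_bounded _ (M := 1)) => // w; exact: cos_max.
  have iC' : L1 PP (fun z => cos (Q z.1 + b + h n * E n z)).
    by apply: (L1_bounded _ (M := 1)) => // w; exact: cos_max.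
  have inv : mean PP (fun z => cos (Q z.1 + b + h n * E n z)) = mean PP (fun z => cos (Q z.1 + b)).
    pose f (x : l2 R) := cos (\sum_(a < N) c a * (x a ^+ 2 - r a a) + b).
    have cf : continuous f.
      exact: (@continuous_cos_quadratic R _ N (fun a (x : l2 R) => x a) c (fun a => r a a) b
        (fun a => @l2_coord_continuous R a)).
    have bf : bounded_fun f.
      by exists 1; split => // M M1' x _; apply: (le_trans (cos_max _)); exact: ltW.
    have fE (u : nat -> R) : f (l2_fin N u) = cos (\sum_(a < N) c a * (u a ^+ 2 - r a a) + b).
      by congr (cos (_ + _)); apply: eq_bigr => a _; rewrite l2_finE ltn_ord.
    have := gaussian_rotation xiG N (cs n) cf bf.
    rewrite (@eq_mean _ _ _ PP _ (fun z => cos (Q z.1 + b + h n * E n z))); last first.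
      move=> z; rewrite fE rotated//; congr cos; rewrite /E.
      by rewrite cosqr; ring.
    move=> ->; rewrite (@eq_mean _ _ _ P _ (fun w => cos (Q w + b))); last by move=> w; rewrite fE.
    apply/esym/mean_fst; apply: (L1_bounded _ (M := 1)) => [|w]; last exact: cos_max.
    by apply: measurable_cos_comp; exact: measurable_funD.
  have DE2 : D n =1 (fun z => (h n ^+ 2)^-1 * (cos (Q z.1 + b + h n * E n z) - cos (Q z.1 + b)) +
     (sin (Q z.1 + b) * Q z.2 - Q z.1 * sin (Q z.1 + b) +
      2 * co n / h n * (B z * sin (Q z.1 + b)))).
    by move=> z; rewrite /D /E; field.
  rewrite (eq_mean _ DE2) meanD; [|by apply: L1Z; exact: L1B|by apply: L1D; [exact: L1B|exact: L1Z]].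
  rewrite meanZ; last exact: L1B.
  rewrite meanB// inv subrr mulr0 add0r meanD; [|exact: L1B|exact: L1Z].
  by rewrite meanB// meanZ// M22 M12 MB2 mulr0 addr0 sub0r.
have iXC a b' : L1 P (fun w => xi a w * xi b' w * cos (Q w + b)).
  apply: (L1_mulB (M := 1)) => [||w]; [exact: gaussian_family_L1M| |exact: cos_max].
  by apply: measurable_cos_comp; exact: measurable_funD.
have lim1 : - mean P (fun w => Q w * sin (Q w + b)) =
    mean PP (fun z => - (2 * B z ^+ 2 * cos (Q z.1 + b))).
  rewrite -[RHS](cvg_lim (@Rhausdorff R) DM); apply/esym/cvg_lim; first exact: Rhausdorff.
  rewrite (_ : _ \o D = fun=> - mean P (fun w => Q w * sin (Q w + b))); first exact: cvg_cst.
  by apply/funext => n; rewrite /= DE.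
(* Once [B] is squared, the mean over the second copy turns [xi a z.2 * xi a' z.2] into [r a a'],
   which is how [V] appears. *)
have BE : (fun z => - (2 * B z ^+ 2 * cos (Q z.1 + b))) =1 (fun z => - 2 *
    \sum_(a < N) \sum_(a' < N) c a * c a' *
      ((xi a z.1 * xi a' z.1 * cos (Q z.1 + b)) * (xi a z.2 * xi a' z.2))).
  move=> z; rewrite mulNr -(mulrA 2); congr (- (_ * _)).
  rewrite expr2 {1}/B !mulr_suml; apply: eq_bigr => a _.
  by rewrite /B mulrA mulr_sumr mulr_suml; apply: eq_bigr => a' _; ring.
have iXX a a' : L1 PP (fun z => (xi a z.1 * xi a' z.1 * cos (Q z.1 + b)) * (xi a z.2 * xi a' z.2)).
  exact: (L1_prod (iXC a a') (gaussian_family_L1M xiG a a')).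
move/eqP: lim1; rewrite (eq_mean _ BE) meanZ; last first.
  by apply: L1_sum => a _; apply: L1_sum => a' _; exact: L1Z.
rewrite mulNr eqr_opp => /eqP ->; congr (_ * _).
have VE : (fun w => V w * cos (Q w + b)) =1 (fun w => \sum_(a < N) \sum_(a' < N)
    c a * c a' * r a a' * (xi a w * xi a' w * cos (Q w + b))).
  move=> w; rewrite /V /quad_carre mulr_suml; apply: eq_bigr => a _.
  by rewrite mulr_suml; apply: eq_bigr => a' _; rewrite -!mulrA.
rewrite (eq_mean _ VE) !mean_sum => [|a _|a _]; last 2 first.
- by apply: L1_sum => a' _; exact: L1Z.
- by apply: L1_sum => a' _; exact: L1Z.
apply: eq_bigr => a _; rewrite !mean_sum => [|a' _|a' _]; [|exact: L1Z|exact: L1Z].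
apply: eq_bigr => a' _; rewrite !meanZ//.
rewrite (mean_prod (iXC a a') (gaussian_family_L1M xiG a a')).
by rewrite -/(r a a'); ring.
Qed.

End quadratic_stein.

Section quadratic_charfun.
Context {d : measure_display} {T : measurableType d} {R : realType}.
Variables (P : probability T R) (xi : nat -> T -> R).
Hypothesis xiG : gaussian_family P xi.
Local Notation r := (gcov P xi).
Variables (N : nat) (c : nat -> R).

Let Q := quad_form P xi N c.
Let V := quad_carre P xi N c.
Let q : R := 2 * \sum_(a < N) \sum_(b < N) c a * c b * r a b ^+ 2.

Let wt (a b : nat) := c a * c b * r a b.

(** [q] is the variance of the form: in Isserlis' formula the centring cancels [r a a * r b b], and
    the other two pairings are equal. *)
Let q0 : 0 <= q.
Proof.
have -> : q = mean P (fun w => Q w ^+ 2).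
  rewrite (@eq_mean _ _ _ P _ (fun w => \sum_(a < N) \sum_(b < N) c a * c b *
     ((xi a w * xi a w) * (xi b w * xi b w) - r b b * (xi a w * xi a w) -
      r a a * (xi b w * xi b w) + r a a * r b b))); last first.
    move=> w; rewrite /Q /quad_form expr2 mulr_suml; apply: eq_bigr => a _.
    by rewrite mulr_sumr; apply: eq_bigr => b _; ring.
  have i2 a b := gaussian_family_L1M xiG a b.
  have i4 a b : L1 P (fun w => (xi a w * xi a w) * (xi b w * xi b w)).
    exact: gaussian_family_L4M.
  have iF a b : L1 P (fun w => c a * c b *
     ((xi a w * xi a w) * (xi b w * xi b w) - r b b * (xi a w * xi a w) -
      r a a * (xi b w * xi b w) + r a a * r b b)).
    apply: L1Z; apply: L1D; last exact: L1_cst.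
    by apply: L1B; [apply: L1B => //; exact: L1Z|exact: L1Z].
  rewrite mean_sum => [|a _]; last by apply: L1_sum.
  rewrite /q mulr_sumr; apply: eq_bigr => a _; rewrite mean_sum//.
  rewrite mulr_sumr; apply: eq_bigr => b _; rewrite meanZ; last first.
    apply: L1D; last exact: L1_cst.
    by apply: L1B; [apply: L1B => //; exact: L1Z|exact: L1Z].
  rewrite meanD; [|by apply: L1B; [apply: L1B => //; exact: L1Z|exact: L1Z]|exact: L1_cst].
  rewrite meanB; [|by apply: L1B => //; exact: L1Z|exact: L1Z].
  rewrite meanB//; last exact: L1Z.
  rewrite mean_cst !meanZ// (isserlis xiG) -!/(r _ _).
  by ring.
by apply: mean_ge0 => w; exact: sqr_ge0.
Qed.

Lemma quad_carre_centered_L1 : L1 P (fun w => `|V w - q / 2|).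
Proof. by apply: L1_norm; apply: L1B; [exact: quad_carre_L1|exact: L1_cst]. Qed.

Let scale t w : quad_form P xi N (fun a => t * c a) w = t * Q w.
Proof.
by rewrite /Q /quad_form mulr_sumr; apply: eq_bigr => a _; rewrite mulrA.
Qed.

Let scaleV t w : quad_carre P xi N (fun a => t * c a) w = t ^+ 2 * V w.
Proof.
rewrite /V /quad_carre mulr_sumr; apply: eq_bigr => a _.
by rewrite mulr_sumr; apply: eq_bigr => b _; ring.
Qed.

(** Stein's identity for the multiple [t * Q], with V replaced by its mean [q / 2], is the Gaussian
    equation for [phi] with a perturbation of size at most [2 * E |V - q / 2|] on [0, 1];
    [gaussian_ode] carries this bound to [t = 1]. *)
Lemma quad_charfun_bound (b : R) :
  `|mean P (fun w => cos (Q w + b)) - cos b * expR (- (q / 2))| <=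
  2 * mean P (fun w => `|V w - q / 2|).
Proof.
have mQ := measurable_quad_form xiG N c : measurable_fun setT Q.
have Q2 := quad_form_L2 xiG N c : L1 P (fun w => Q w ^+ 2).
have iV := quad_carre_L1 xiG N c : L1 P V.
have mcos t : measurable_fun setT (fun w => cos (t * Q w + b)) by exact: measurable_cos_affine.
have iVC t : L1 P (fun w => V w * cos (t * Q w + b)).
  by apply: (L1_mulB (M := 1)) => // w; exact: cos_max.
pose phi t := mean P (fun w => cos (t * Q w + b)).
pose eps t := - (2 * t * mean P (fun w => (V w - q / 2) * cos (t * Q w + b))).
have iVq t : L1 P (fun w => (V w - q / 2) * cos (t * Q w + b)).
  apply: (L1_mulB (M := 1)) => // [|w]; last exact: cos_max.
  by apply: L1B => //; exact: L1_cst.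
have iC t : L1 P (fun w => cos (t * Q w + b)) by exact: L1_cos_affine.
have stein t : mean P (fun w => Q w * sin (t * Q w + b)) =
    2 * t * mean P (fun w => V w * cos (t * Q w + b)).
  have iQS : L1 P (fun w => Q w * sin (t * Q w + b)).
    apply: (L1_mulB (M := 1)) => [||w]; [exact: L1_sqr|exact: measurable_sin_affine|exact: sin_max].
  (* For the coefficients [t * c a], [quad_stein] has a factor [t] on the left and [t ^+ 2] on the
     right. Dividing by [t] leaves out 0, where both sides vanish. *)
  have [->|t0] := eqVneq t 0.
    rewrite mulr0 mul0r (@eq_mean _ _ _ P _ (fun w => sin b * Q w)); last first.
      by move=> w; rewrite mul0r add0r mulrC.
    by rewrite meanZ ?mean_quad_form ?mulr0//; exact: L1_sqr.
  have := quad_stein xiG N (fun a => t * c a) b.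
  rewrite (@eq_mean _ _ _ P _ (fun w => t * (Q w * sin (t * Q w + b)))); last first.
    by move=> w; rewrite !scale mulrA.
  rewrite (@eq_mean _ _ _ P (fun w => quad_carre _ _ _ _ w * _)
    (fun w => t ^+ 2 * (V w * cos (t * Q w + b)))); last first.
    by move=> w; rewrite !scale scaleV mulrA.
  by rewrite !meanZ// => /(congr1 (fun x => t^-1 * x)); rewrite mulKf// => ->; field.
have dphi (t : R) : is_derive t 1 phi (- (t * q * phi t) + eps t).
  apply: (is_derive_eq (is_derive_charfun b mQ Q2 t)); rewrite stein /eps.
  rewrite (@eq_mean _ _ _ P (fun w => (V w - q / 2) * _)
    (fun w => V w * cos (t * Q w + b) - q / 2 * cos (t * Q w + b))); last first.
    by move=> w; rewrite mulrBl.
  rewrite meanB//; last exact: L1Z.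
  by rewrite meanZ// -/(phi t); field.
have eta0 : 0 <= 2 * mean P (fun w => `|V w - q / 2|).
  by rewrite mulr_ge0// mean_ge0.
have epsle (t : R) : 0 <= t <= 1 -> `|eps t| <= 2 * mean P (fun w => `|V w - q / 2|).
  move=> /andP[t0 t1]; rewrite /eps normrN normrM ler_pM//.
    by rewrite ger0_norm ?mulr_ge0// ler_piMr.
  apply: mean_norm_le => //; first exact: quad_carre_centered_L1.
  by move=> w; rewrite normrM ler_piMr// cos_max.
have := gaussian_ode q0 eta0 dphi epsle; congr (`|_ - _ * _| <= _).
  by apply: eq_mean => w; rewrite mul1r.
rewrite /phi (@eq_mean _ _ _ P _ (fun=> cos b)) ?mean_cst// => w.
by rewrite mul0r add0r.
Qed.

(** In Isserlis' formula the pairing of [a] with [b] and [e] with [f] sums to the squared mean; the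
    two crossed pairings remain, each a sum over four-cycles. *)
Lemma quad_carre_variance :
  L1 P (fun t => (V t - q / 2) ^+ 2) /\
  mean P (fun t => (V t - q / 2) ^+ 2) =
  \sum_(a < N) \sum_(b < N) \sum_(e < N) \sum_(f < N)
    wt a b * wt e f * (r a e * r b f + r a f * r b e).
Proof.
have iV := quad_carre_L1 xiG N c : L1 P V.
have VE : (fun t => V t ^+ 2) =1 (fun t => \sum_(a < N) \sum_(b < N) \sum_(e < N) \sum_(f < N)
    wt a b * wt e f * ((xi a t * xi b t) * (xi e t * xi f t))).
  move=> t; rewrite /V /quad_carre expr2 mulr_suml; apply: eq_bigr => a _.
  rewrite mulr_suml; apply: eq_bigr => b _; rewrite mulr_sumr; apply: eq_bigr => e _.
  by rewrite mulr_sumr; apply: eq_bigr => f _; rewrite /wt; ring.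
have i4 a b e f : L1 P (fun t => wt a b * wt e f * ((xi a t * xi b t) * (xi e t * xi f t))).
  by apply: L1Z; exact: gaussian_family_L4M.
have V2 : L1 P (fun t => V t ^+ 2).
  apply: (eq_L1 (fun t => esym (VE t))).
  by do 4 (apply: L1_sum => ? _).
have E : (fun t => (V t - q / 2) ^+ 2) =1 (fun t => V t ^+ 2 - q * V t + (q / 2) ^+ 2).
  by move=> t; field.
have iE : L1 P (fun t => V t ^+ 2 - q * V t) by apply: L1B => //; exact: L1Z.
split; first by apply: (eq_L1 (fun t => esym (E t))); apply: L1D => //; exact: L1_cst.
rewrite (eq_mean _ E) meanD//; last exact: L1_cst.
rewrite mean_cst meanB//; last exact: L1Z.
rewrite meanZ// (mean_quad_carre xiG) (eq_mean _ VE).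
pose m := \sum_(a < N) \sum_(b < N) c a * c b * r a b ^+ 2; rewrite -/m.
have mE : m ^+ 2 = \sum_(a < N) \sum_(b < N) \sum_(e < N) \sum_(f < N)
    wt a b * wt e f * (r a b * r e f).
  rewrite /m expr2 mulr_suml; apply: eq_bigr => a _.
  rewrite mulr_suml; apply: eq_bigr => b _; rewrite mulr_sumr; apply: eq_bigr => e _.
  by rewrite mulr_sumr; apply: eq_bigr => f _; rewrite /wt; ring.
have -> : q = 2 * m by [].
rewrite (_ : mean P _ - _ + _ = mean P (fun t => \sum_(a < N) \sum_(b < N) \sum_(e < N) \sum_(f < N)
    wt a b * wt e f * ((xi a t * xi b t) * (xi e t * xi f t))) - m ^+ 2); last by field.
rewrite mE mean_sum => [|a _]; last by do 3 (apply: L1_sum => ? _).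
rewrite -sumrB; apply: eq_bigr => a _.
rewrite mean_sum => [|b _]; last by do 2 (apply: L1_sum => ? _).
rewrite -sumrB; apply: eq_bigr => b _.
rewrite mean_sum => [|e _]; last by (apply: L1_sum => ? _).
rewrite -sumrB; apply: eq_bigr => e _.
rewrite mean_sum => [|f _]; last exact: i4.
rewrite -sumrB; apply: eq_bigr => f _.
rewrite meanZ; last exact: gaussian_family_L4M.
by rewrite (isserlis xiG) -mulrBr; congr (_ * _); ring.
Qed.

(* [|y| <= delta + y ^+ 2 / delta] *)
Lemma quad_charfun_le (b delta : R) : 0 < delta ->
  `|mean P (fun w => cos (Q w + b)) - cos b * expR (- (q / 2))| <=
  2 * (delta + (\sum_(a < N) \sum_(b < N) \sum_(e < N) \sum_(f < N)
    wt a b * wt e f * (r a e * r b f + r a f * r b e)) / delta).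
Proof.
move=> d0; apply: (le_trans (quad_charfun_bound b)); rewrite ler_wpM2l//.
have [iV2 <-] := quad_carre_variance.
rewrite -(mean_cst P delta) -meanZr//= -meanD//; [|exact: L1_cst|exact: L1Zr].
apply: mean_le => [||t]; first exact: quad_carre_centered_L1.
  by apply: L1D; [exact: L1_cst|exact: L1Zr].
rewrite mean_cst -(real_normK (num_real (V t - q / 2))).
move: `|_| (normr_ge0 (V t - q / 2)) => y y0.
rewrite -lerBlDl ler_pdivlMr//.
by have := sqr_ge0 (y - delta); have := sqr_ge0 delta; nra.
Qed.

End quadratic_charfun.

(** * Four-cycle sums of a function of the lag *)

Section toeplitz_sums.
Context {R : realType}.
Implicit Types (g rho : nat -> R) (n k l : nat).

(** The distance [|k - l|]: subtraction is truncated, so one of the two terms is 0. *)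
Definition ndist k l := ((k - l) + (l - k))%N.

Lemma ndistC k l : ndist k l = ndist l k.
Proof. by rewrite /ndist addnC. Qed.

Lemma sum_split (m n : nat) (F : nat -> R) : (m <= n)%N ->
  \sum_(i < n) F i = \sum_(i < m) F i + \sum_(i < n - m) F (m + i)%N.
Proof.
move=> mn; rewrite -(big_mkord xpredT F) -{1}(subnKC mn) big_mkord.
by rewrite big_split_ord.
Qed.

Lemma sqr_sum_le n (x : nat -> R) :
  (\sum_(i < n) x i) ^+ 2 <= n%:R * \sum_(i < n) x i ^+ 2.
Proof.
have -> : n%:R * \sum_(i < n) x i ^+ 2 = \sum_(i < n) \sum_(j < n) (x i ^+ 2 + x j ^+ 2) / 2.
  transitivity (\sum_(i < n) (n%:R * x i ^+ 2 + \sum_(j < n) x j ^+ 2) / 2).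
    rewrite -mulr_suml big_split/= -mulr_sumr sumr_const card_ord -mulr_natl.
    by field.
  apply: eq_bigr => i _; rewrite -mulr_suml; congr (_ / 2).
  by rewrite big_split/= sumr_const card_ord mulr_natl.
rewrite expr2 mulr_suml; apply: ler_sum => i _; rewrite mulr_sumr; apply: ler_sum => j _.
by have := sqr_ge0 (x i - x j); lra.
Qed.

(** On either side of [k] the distances are distinct and below [n], which accounts for the factor
    2. *)
Lemma sum_ndist_le g n k : (forall m, 0 <= g m) -> (k < n)%N ->
  \sum_(l < n) g (ndist k l) <= 2 * \sum_(m < n) g m.
Proof.
move=> g0 kn.
have sub a b : (a <= b)%N -> \sum_(m < a) g m <= \sum_(m < b) g m.
  move=> ab; rewrite (sum_split g ab) lerDl.
  by apply: sumr_ge0.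
have sub1 a b : (a < b)%N -> \sum_(m < a) g m.+1 <= \sum_(m < b) g m.
  move=> ab; apply: le_trans (sub a.+1 b ab).
  by rewrite big_ord_recl lerDr.
rewrite (sum_split (fun l => g (ndist k l)) (ltnW kn)) mulr_natl mulr2n; apply: lerD.
  apply: le_trans (sub1 k n kn).
  rewrite (reindex_inj rev_ord_inj)/=; apply: ler_sum => i _.
  by rewrite /ndist subKn// (eqP (_ : k - i.+1 - k == 0)%N) ?addn0// subn_eq0 leq_subr.
apply: le_trans (sub (n - k)%N n (leq_subr _ _)); apply: ler_sum => i _.
by rewrite /ndist subnDA subnn sub0n add0n addKn.
Qed.

(** Both pairings sum to the squared entries of [S], the square of the matrix [u]. An entry of [S]
    is at most [2 * D], and all entries together are at most [n] times the square of the row bound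
    [2 * r]; so the total is at most [2 * (2 * D) * n * (2 * r) ^+ 2]. *)
Lemma four_cycle_le rho n (D : R) : (forall m, 0 <= rho m) ->
  \sum_(m < n) rho m ^+ 2 <= D ->
  \sum_(k < n) \sum_(l < n) \sum_(p < n) \sum_(q < n)
    rho (ndist k l) * rho (ndist p q) *
    (rho (ndist k p) * rho (ndist l q) + rho (ndist k q) * rho (ndist l p)) <=
  16 * D * n%:R * (\sum_(m < n) rho m) ^+ 2.
Proof.
move=> rho0 rhoD; pose u k l := rho (ndist k l).
have u0 k l : 0 <= u k l by exact: rho0.
have uC k l : u k l = u l k by rewrite /u ndistC.
pose S k q := \sum_(l < n) u k l * u l q.
have S0 k q : 0 <= S k q by apply: sumr_ge0 => l _; rewrite mulr_ge0.
have SD (k q : 'I_n) : S k q <= 2 * D.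
  have h (m : 'I_n) : \sum_(l < n) u m l ^+ 2 <= 2 * D.
    apply: (le_trans (sum_ndist_le (g := fun m => rho m ^+ 2) _ (ltn_ord m))).
      by move=> ?; exact: sqr_ge0.
    by rewrite ler_wpM2l.
  apply: (@le_trans _ _ (\sum_(l < n) (u k l ^+ 2 + u q l ^+ 2) / 2)).
    apply: ler_sum => l _; rewrite (uC l q).
    by have := sqr_ge0 (u k l - u q l); lra.
  rewrite -mulr_suml big_split/=; have := h k; have := h q; lra.
have A : \sum_(k < n) \sum_(l < n) \sum_(p < n) \sum_(q < n)
    u k l * u p q * (u k p * u l q) = \sum_(k < n) \sum_(q < n) S k q ^+ 2.
  apply: eq_bigr => k _.
  transitivity (\sum_(l < n) \sum_(q < n) \sum_(p < n) u k l * u p q * (u k p * u l q)).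
    by apply: eq_bigr => l _; rewrite exchange_big.
  rewrite exchange_big/=; apply: eq_bigr => q _.
  rewrite expr2 {1}/S mulr_suml; apply: eq_bigr => l _.
  by rewrite /S mulr_sumr; apply: eq_bigr => p _; ring.
have B : \sum_(k < n) \sum_(l < n) \sum_(p < n) \sum_(q < n)
    u k l * u p q * (u k q * u l p) = \sum_(k < n) \sum_(q < n) S k q ^+ 2.
  rewrite -A; apply: eq_bigr => k _; apply: eq_bigr => l _.
  rewrite exchange_big/=; apply: eq_bigr => p _; apply: eq_bigr => q _.
  by rewrite (uC q p).
have -> : \sum_(k < n) \sum_(l < n) \sum_(p < n) \sum_(q < n)
    rho (ndist k l) * rho (ndist p q) *
    (rho (ndist k p) * rho (ndist l q) + rho (ndist k q) * rho (ndist l p)) = 2 * \sum_(k < n) \sum_(q < n) S k q ^+ 2.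
  rewrite mulr_natl mulr2n -{1}A -B -big_split; apply: eq_bigr => k _.
  rewrite -big_split; apply: eq_bigr => l _; rewrite -big_split; apply: eq_bigr => p _.
  by rewrite -big_split; apply: eq_bigr => q _; rewrite mulrDr.
have D0 : 0 <= D by apply: le_trans rhoD; apply: sumr_ge0 => m _; exact: sqr_ge0.
pose r := \sum_(m < n) rho m.
have r0 : 0 <= r by apply: sumr_ge0.
have row (l : 'I_n) : \sum_(k < n) u l k <= 2 * r by exact: sum_ndist_le.
have C : \sum_(k < n) \sum_(q < n) S k q <= n%:R * (2 * r) ^+ 2.
  have -> : \sum_(k < n) \sum_(q < n) S k q =
      \sum_(l < n) (\sum_(k < n) u l k) * (\sum_(q < n) u l q).
    transitivity (\sum_(k < n) \sum_(l < n) \sum_(q < n) u k l * u l q).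
      by apply: eq_bigr => k _; rewrite exchange_big.
    rewrite exchange_big/=; apply: eq_bigr => l _; rewrite mulr_suml.
    by apply: eq_bigr => k _; rewrite mulr_sumr uC.
  apply: (@le_trans _ _ (\sum_(l < n) (2 * r) ^+ 2)).
    apply: ler_sum => l _; rewrite expr2 ler_pM//; exact: sumr_ge0.
  by rewrite sumr_const card_ord -[leLHS]mulr_natl.
have E : \sum_(k < n) \sum_(q < n) S k q ^+ 2 <= 2 * D * (n%:R * (2 * r) ^+ 2).
  apply: (@le_trans _ _ (2 * D * \sum_(k < n) \sum_(q < n) S k q)); last first.
    by rewrite ler_wpM2l// mulr_ge0.
  rewrite mulr_sumr; apply: ler_sum => k _; rewrite mulr_sumr; apply: ler_sum => q _.
  by rewrite expr2 ler_wpM2r.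
by rewrite -/r; have := E; lra.
Qed.

(** The first [K] terms contribute a constant, and the rest, by Cauchy-Schwarz, at most [n] times a
    small tail of the squares. This covers sequences whose own sum diverges. *)
Lemma sqr_sum_littleo rho (D : R) : (forall m, 0 <= rho m) ->
  (forall n, \sum_(m < n) rho m ^+ 2 <= D) ->
  forall e, 0 < e -> \forall n \near \oo, (\sum_(m < n) rho m) ^+ 2 <= e * n%:R.
Proof.
move=> rho0 rhoD e e0.
pose s n := \sum_(m < n) rho m ^+ 2.
have cs : cvgn s.
  apply: nondecreasing_is_cvgn; last by exists D => _ [n _ <-]; exact: rhoD.
  by apply/nondecreasing_seqP => n; rewrite /s big_ord_recr/= lerDl sqr_ge0.
have e4 : 0 < e / 4 by rewrite divr_gt0.
have [K _ KP] : \forall K \near \oo, limn s - s K <= e / 4.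
  by have /cvgrPdist_le/(_ _ e4) := cs; apply: filterS => n; apply: le_trans; exact: ler_norm.
pose C := (\sum_(m < K) rho m) ^+ 2.
near=> n; have Kn : (K <= n)%N by near: n; exact: nbhs_infty_ge.
have Cn : C <= e / 4 * n%:R.
  by rewrite mulrC -ler_pdivrMr//; near: n; exact: nbhs_infty_ger.
have slim k : s k <= limn s.
  apply: nondecreasing_cvgn_le => //.
  by apply/nondecreasing_seqP => i; rewrite /s big_ord_recr/= lerDl sqr_ge0.
have tailK : \sum_(i < n - K) rho (K + i)%N ^+ 2 <= e / 4.
  apply: le_trans (KP K (leqnn K)); rewrite lerBrDl.
  by have := slim n; rewrite {1}/s (sum_split (fun m => rho m ^+ 2) Kn).
rewrite (sum_split rho Kn).
apply: (@le_trans _ _ (2 * C + 2 * (\sum_(i < n - K) rho (K + i)%N) ^+ 2)).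
  by rewrite /C; have := sqr_ge0 (\sum_(m < K) rho m - \sum_(i < n - K) rho (K + i)%N); lra.
have h := @sqr_sum_le (n - K) (fun i => rho (K + i)%N).
have h2 : (n - K)%:R * \sum_(i < n - K) rho (K + i)%N ^+ 2 <= n%:R * (e / 4).
  by apply: ler_pM => //; [apply: sumr_ge0 => i _; exact: sqr_ge0|rewrite ler_nat leq_subr].
by lra.
Unshelve. all: by end_near. Qed.

(** Flattens time [k] and coordinate [j] into the single index [k * J + j] that the lemmas on
    quadratic forms expect. *)
Lemma sum_divmod (J n : nat) (F : nat -> nat -> R) :
  \sum_(a < n * J) F (a %/ J)%N (a %% J)%N = \sum_(k < n) \sum_(j < J) F k j.
Proof.
have [->|J0] := posnP J.
  by rewrite muln0 big_ord0 big1// => k _; rewrite big_ord0.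
elim: n => [|n IHn]; first by rewrite mul0n !big_ord0.
rewrite mulSnr big_split_ord/= IHn big_ord_recr/=; congr (_ + _).
by apply: eq_bigr => j _; rewrite divnMDl// divn_small// addn0 modnMDl modn_small.
Qed.

End toeplitz_sums.

(** * Central limit theorem for normalized sums of centred squares *)

Section quadratic_clt.
Context {d : measure_display} {T : measurableType d} {R : realType}.
Variables (P : probability T R) (zeta : nat * nat -> T -> R).
Hypothesis zetaG : gaussian_family P zeta.
Local Notation r k i l j := (gcov P zeta (@pair nat nat k i) (@pair nat nat l j)).
Variables (J : nat) (alpha : nat -> R) (rho : nat -> R) (D q : R).
Hypothesis rho_ge : forall k l i j, (i < J)%N -> (j < J)%N ->
  `|r k i l j| <= rho (ndist k l).
Hypothesis rho0 : forall m, 0 <= rho m.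
Hypothesis rhoD : forall n, \sum_(m < n) rho m ^+ 2 <= D.
Hypothesis qcvg :
  2 * \sum_(k < n) \sum_(l < n) \sum_(i < J) \sum_(j < J)
    alpha i * alpha j * r k i l j ^+ 2 / n%:R @[n --> \oo] --> q.

Let xi (a : nat) := zeta (a %/ J, a %% J)%N.
Let c (n a : nat) : R := alpha (a %% J)%N / Num.sqrt n%:R.
Let xiG : gaussian_family P xi.
Proof. exact: (gaussian_family_comp (fun a => (a %/ J, a %% J)%N) zetaG). Qed.

Let A := \sum_(j < J) `|alpha j|.

Let cA n a : (0 < J)%N -> (0 < n)%N -> `|c n a| <= A / Num.sqrt n%:R.
Proof.
move=> J0 n0; rewrite /c normrM normfV (ger0_norm (sqrtr_ge0 _)).
rewrite ler_wpM2r ?invr_ge0// /A (bigD1 (Ordinal (ltn_pmod a J0)))//=.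
by rewrite lerDl sumr_ge0.
Qed.

Let sqrt2 n : (Num.sqrt n%:R)^-1 * (Num.sqrt n%:R)^-1 = n%:R^-1 :> R.
Proof. by rewrite -invfM -expr2 sqr_sqrtr. Qed.

Let quad_formE n w : quad_form P xi (n * J) (c n) w = \sum_(j < J) alpha j *
  ((Num.sqrt n%:R)^-1 * \sum_(k < n) (zeta (@pair nat nat k j) w ^+ 2 - r k j k j)).
Proof.
rewrite /quad_form (sum_divmod J n (fun k j => alpha j / Num.sqrt n%:R *
  (zeta (k, j) w ^+ 2 - r k j k j))) exchange_big/=; apply: eq_bigr => j _.
by rewrite mulrA mulr_sumr.
Qed.

Let sigmaE n : \sum_(a < n * J) \sum_(b < n * J) c n a * c n b * gcov P xi a b ^+ 2 =
  \sum_(k < n) \sum_(l < n) \sum_(i < J) \sum_(j < J)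
    alpha i * alpha j * r k i l j ^+ 2 / n%:R.
Proof.
pose G (k i l j : nat) := alpha i * alpha j * r k i l j ^+ 2 / n%:R.
transitivity (\sum_(a < n * J) \sum_(l < n) \sum_(j < J) G (a %/ J)%N (a %% J)%N l j).
  apply: eq_bigr => a _; rewrite -(sum_divmod J n (fun l j => G (a %/ J)%N (a %% J)%N l j)).
  by apply: eq_bigr => b _; rewrite /G /c -sqrt2 /gcov/=; ring.
rewrite (sum_divmod J n (fun k i => \sum_(l < n) \sum_(j < J) G k i l j)).
by apply: eq_bigr => k _; rewrite exchange_big.
Qed.

Let block n (F : nat -> R) : \sum_(a < n * J) F (a %/ J)%N = J%:R * \sum_(k < n) F k.
Proof.
rewrite (sum_divmod J n (fun k _ => F k)) mulr_sumr; apply: eq_bigr => k _.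
by rewrite sumr_const card_ord mulr_natl.
Qed.

(** Four weights of size at most [A / sqrt n] give [A ^+ 4 / n ^+ 2], the four coordinate indices
    give [J ^+ 4], and [four_cycle_le] gives [16 * D * n] times the squared sum of [rho]. *)
Let variance_le n : (0 < J)%N -> (0 < n)%N ->
  \sum_(a < n * J) \sum_(b < n * J) \sum_(e < n * J) \sum_(f < n * J)
    (c n a * c n b * gcov P xi a b) * (c n e * c n f * gcov P xi e f) *
    (gcov P xi a e * gcov P xi b f + gcov P xi a f * gcov P xi b e) <=
  16 * D * J%:R ^+ 4 * A ^+ 4 * ((\sum_(m < n) rho m) ^+ 2 / n%:R).
Proof.
move=> J0 n0.
pose s : R := A / Num.sqrt n%:R.
have A0 : 0 <= A by apply: sumr_ge0.
have s0 : 0 <= s by rewrite divr_ge0.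
pose K (a b : nat) := rho (ndist (a %/ J) (b %/ J)).
have K0 a b : 0 <= K a b by exact: rho0.
have gK a b : `|gcov P xi a b| <= K a b by apply: rho_ge; rewrite ltn_mod.
have wK a b : `|c n a * c n b * gcov P xi a b| <= s * s * K a b.
  rewrite normrM (normrM (c n a)); apply: ler_pM => //.
  by apply: ler_pM => //; exact: cA.
apply: (@le_trans _ _ (\sum_(a < n * J) \sum_(b < n * J) \sum_(e < n * J) \sum_(f < n * J)
    s ^+ 4 * (K a b * K e f * (K a e * K b f + K a f * K b e)))).
  apply: ler_sum => a _; apply: ler_sum => a' _; apply: ler_sum => e _; apply: ler_sum => f _.
  rewrite (le_trans (ler_norm _))// normrM.
  rewrite (_ : s ^+ 4 * _ = (s * s * K a a') * (s * s * K e f) * (K a e * K a' f + K a f * K a' e)); last by ring.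
  apply: ler_pM => //.
    by rewrite normrM ler_pM.
  by rewrite (le_trans (ler_normD _ _))// !normrM lerD// ler_pM.
pose u k l := rho (ndist k l).
have -> : \sum_(a < n * J) \sum_(b < n * J) \sum_(e < n * J) \sum_(f < n * J)
    s ^+ 4 * (K a b * K e f * (K a e * K b f + K a f * K b e)) =
  J%:R ^+ 4 * s ^+ 4 * \sum_(k < n) \sum_(l < n) \sum_(p < n) \sum_(q < n)
    u k l * u p q * (u k p * u l q + u k q * u l p).
  pose F (k l p q : nat) := s ^+ 4 * (u k l * u p q * (u k p * u l q + u k q * u l p)).
  transitivity (J%:R * (J%:R * (J%:R * (J%:R * \sum_(k < n) \sum_(l < n) \sum_(p < n) \sum_(q < n)
    F k l p q)))); last first.
    rewrite -[RHS]mulrA (_ : s ^+ 4 * _ = \sum_(k < n) \sum_(l < n) \sum_(p < n) \sum_(q < n)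
      F k l p q); last first.
      rewrite mulr_sumr; apply: eq_bigr => k _; rewrite mulr_sumr; apply: eq_bigr => l _.
      rewrite mulr_sumr; apply: eq_bigr => p _; rewrite mulr_sumr; exact: eq_bigr.
    by move: (\sum_(k < n) _) => X; ring.
  rewrite -(block n (fun k => \sum_(l < n) \sum_(p < n) \sum_(q < n) F k l p q)) !mulr_sumr.
  apply: eq_bigr => a _.
  rewrite -(block n (fun l => \sum_(p < n) \sum_(q < n) F (a %/ J)%N l p q)) !mulr_sumr.
  apply: eq_bigr => b _.
  rewrite -(block n (fun p => \sum_(q < n) F (a %/ J)%N (b %/ J)%N p q)) !mulr_sumr.
  apply: eq_bigr => e _.
  by rewrite -(block n (fun q => F (a %/ J)%N (b %/ J)%N (e %/ J)%N q)).
have h := four_cycle_le rho0 (rhoD n).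
have s4 : s ^+ 4 = A ^+ 4 / (n%:R ^+ 2).
  rewrite /s exprMn exprVn; congr (_ * _^-1).
  have -> : Num.sqrt n%:R ^+ 4 = (Num.sqrt n%:R ^+ 2) ^+ 2 :> R by rewrite -exprM.
  by rewrite sqr_sqrtr.
apply: (le_trans (ler_wpM2l _ h)); first by rewrite mulr_ge0// ?exprn_ge0.
have nn : n%:R != 0 :> R by rewrite pnatr_eq0 -lt0n.
by rewrite s4 le_eqVlt; apply/orP; left; apply/eqP; field.
Qed.

(** Compared first with the Gaussian value for the variance [qn n] at stage [n], which then tends to
    [q]. *)
Theorem clt_quadratic (b : R) :
  mean P (fun w => cos (\sum_(j < J) alpha j * ((Num.sqrt n%:R)^-1 *
    \sum_(k < n) (zeta (@pair nat nat k j) w ^+ 2 - r k j k j)) + b)) @[n --> \oo] -->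
  cos b * expR (- (q / 2)).
Proof.
pose qn n := 2 * \sum_(k < n) \sum_(l < n) \sum_(i < J) \sum_(j < J)
    alpha i * alpha j * r k i l j ^+ 2 / n%:R.
pose M n := mean P (fun w => cos (quad_form P xi (n * J) (c n) w + b)).
rewrite (_ : (fun n => _) = M); last first.
  by apply/funext => n; apply: eq_mean => w; rewrite quad_formE.
have ecvg : cos b * expR (- (qn n / 2)) @[n --> \oo] --> cos b * expR (- (q / 2)).
  apply: cvgM; first exact: cvg_cst.
  apply: (cvg_comp (fun n => - (qn n / 2)) expR); last exact: continuous_expR.
  by apply: cvgN; apply: cvgM => //; exact: cvg_cst.
suff diff : M n - cos b * expR (- (qn n / 2)) @[n --> \oo] --> (0 : R).
  rewrite (_ : M = fun n => (M n - cos b * expR (- (qn n / 2))) + cos b * expR (- (qn n / 2))).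
    by rewrite -[X in _ --> X]add0r; exact: cvgD.
  by apply/funext => n; rewrite subrK.
apply/cvgrPdist_le => e e0.
(* The bounds on the weights reduce indices modulo [J]. For [J = 0] the cosine is constant. *)
have [J0|J0] := posnP J.
  near=> n; rewrite /M /qn J0 muln0 (@eq_mean _ _ _ P _ (fun=> cos b)) => [|w]; last first.
    by rewrite /quad_form big_ord0 add0r.
  rewrite mean_cst big1 => [|k _]; last by rewrite big1// => l _; rewrite big_ord0.
  by rewrite mulr0 mul0r oppr0 expR0 mulr1 subrr subr0 normr0 ltW.
(* The variance is brought below [del ^+ 2], and [2 * (del + del ^+ 2 / del)] is [e]. *)
pose del := e / 4; have del0 : 0 < del by rewrite divr_gt0.
pose C := 16 * D * J%:R ^+ 4 * A ^+ 4.
have C0 : 0 <= C.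
  have D0 : 0 <= D by apply: le_trans (rhoD 0); rewrite big_ord0.
  have A0 : 0 <= A by apply: sumr_ge0.
  by rewrite !mulr_ge0// ?exprn_ge0.
have t0 : 0 < del ^+ 2 / (C + 1) by rewrite divr_gt0 ?exprn_gt0// ltr_wpDl.
near=> n; have n0 : (0 < n)%N by near: n; exact: nbhs_infty_gt.
have nR : 0 < n%:R :> R by rewrite ltr0n.
have small : (\sum_(m < n) rho m) ^+ 2 / n%:R <= del ^+ 2 / (C + 1).
  by rewrite ler_pdivrMr//; near: n; exact: (sqr_sum_littleo rho0 rhoD t0).
rewrite sub0r normrN.
have := quad_charfun_le xiG (n * J) (c n) b del0.
rewrite sigmaE -/(qn n) => /le_trans; apply.
have V := variance_le J0 n0; rewrite -/C in V.
have {}V := le_trans V (ler_wpM2l C0 small).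
have Cd : C * (del ^+ 2 / (C + 1)) <= del ^+ 2.
  by rewrite mulrCA ler_piMr ?sqr_ge0// ler_pdivrMr ?ltr_wpDl// mul1r lerDl.
have {}V := le_trans V Cd.
rewrite [leRHS](_ : e = 2 * (del + del ^+ 2 / del)); last by rewrite /del; field; rewrite gt_eqF.
by rewrite ler_wpM2l// lerD2l ler_wpM2r// invr_ge0 ltW.
Unshelve. all: by end_near. Qed.

End quadratic_clt.

(** * Hilbert spaces and the trace norm *)

Section hilbert.
Context {R : realType} {H : hilbertType R}.
Implicit Types (x y z h : H) (a b : R).

Lemma innerC x y : inner x y = inner y x.
Proof. by rewrite hermC expr0 mul1r. Qed.

Lemma innerDl x y z : inner (x + y) z = inner x z + inner y z.
Proof. by rewrite linearDl. Qed.

Lemma innerDr x y z : inner z (x + y) = inner z x + inner z y.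
Proof. by rewrite linearDr. Qed.

Lemma innerZl a x z : inner (a *: x) z = a * inner x z.
Proof. by rewrite linearZl_LR. Qed.

Lemma innerZr a x z : inner z (a *: x) = a * inner z x.
Proof. by rewrite linearZr_LR. Qed.

Lemma innerNl x z : inner (- x) z = - inner x z.
Proof. by rewrite linearNl. Qed.

Lemma innerNr x z : inner z (- x) = - inner z x.
Proof. by rewrite linearNr. Qed.

Lemma innerBl x y z : inner (x - y) z = inner x z - inner y z.
Proof. by rewrite innerDl innerNl. Qed.

Lemma innerBr x y z : inner z (x - y) = inner z x - inner z y.
Proof. by rewrite innerDr innerNr. Qed.

Lemma inner0l z : inner 0 z = 0.
Proof. by rewrite linear0l. Qed.

Lemma inner_suml (I : Type) (r : seq I) (F : I -> H) z :
  inner (\sum_(i <- r) F i) z = \sum_(i <- r) inner (F i) z.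
Proof.
by elim: r => [|i r IHr]; rewrite ?big_nil ?inner0l// !big_cons innerDl IHr.
Qed.

Lemma inner_ge0 x : 0 <= inner x x.
Proof. by rewrite inner_normE sqr_ge0. Qed.

Lemma sqr_inner_le x y : inner x y ^+ 2 <= `|x| ^+ 2 * `|y| ^+ 2.
Proof.
have [->|y0] := eqVneq y 0.
  by rewrite innerC inner0l expr0n mulr_ge0// sqr_ge0.
have ny : 0 < `|y| ^+ 2 by rewrite exprn_gt0// normr_gt0.
have := inner_ge0 (x - (inner x y / `|y| ^+ 2) *: y).
rewrite innerBl !innerBr !innerZl !innerZr (innerC y x) !inner_normE.
set t := inner x y / _; have tE : inner x y = t * `|y| ^+ 2 by rewrite divfK// gt_eqF.
rewrite tE => h; have : t ^+ 2 * `|y| ^+ 2 <= `|x| ^+ 2 by lra.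
move=> /(ler_wpM2r (ltW ny)); apply: le_trans.
by rewrite le_eqVlt; apply/orP; left; apply/eqP; ring.
Qed.

Lemma inner_norm_le x y : `|inner x y| <= `|x| * `|y|.
Proof.
rewrite -(@ler_pXn2r _ 2)// ?nnegrE ?mulr_ge0//.
by rewrite real_normK ?num_real// exprMn sqr_inner_le.
Qed.

Lemma inner_continuous h : continuous (fun x => inner x h).
Proof.
move=> x; apply/cvgrPdist_le => e e0; near=> y.
rewrite -innerBl (le_trans (inner_norm_le _ _))//.
apply: (@le_trans _ _ (`|x - y| * (`|h| + 1))); first by rewrite ler_wpM2l// lerDl.
rewrite -ler_pdivlMr ?ltr_wpDl//.
near: y; apply: cvgr_dist_le; first exact: cvg_id.
by rewrite divr_gt0// ltr_wpDl.
Unshelve. all: by end_near. Qed.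

Lemma inner_ext x y : (forall h, inner x h = inner y h) -> x = y.
Proof.
move=> xy; apply/eqP; rewrite -subr_eq0 -normr_eq0 -sqrf_eq0 -inner_normE.
by rewrite innerBl xy subrr.
Qed.

Section basis.
Variable e : nat -> H.
Hypothesis eB : orthonormal_basis e.

Lemma basis_inner i j : inner (e i) (e j) = (i == j)%:R.
Proof. by have [->] := eB. Qed.

Lemma basis_norm i : `|e i| = 1.
Proof.
apply/eqP; rewrite -(@eqrXn2 _ 2)// expr1n -inner_normE basis_inner eqxx//.
Qed.

Let proj n x := \sum_(i < n) inner x (e i) *: e i.

Let projE n x : proj n x = series (fun i => inner x (e i) *: e i) n.
Proof. by rewrite /series/= big_mkord. Qed.

Lemma basis_inner_cvg x y :
  (fun n => \sum_(i < n) inner x (e i) * inner y (e i)) @ \oo --> inner x y.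
Proof.
rewrite (_ : (fun n => _) = (fun z => inner z y) \o series (fun i => inner x (e i) *: e i)).
  by apply: (cvg_comp _ _ (eB.2 x)); exact: inner_continuous.
apply/funext => n; rewrite /= -projE inner_suml; apply: eq_bigr => i _.
by rewrite innerZl (innerC (e i)).
Qed.

Lemma basis_norm_cvg x :
  (fun n => \sum_(i < n) inner x (e i) ^+ 2) @ \oo --> `|x| ^+ 2.
Proof. by rewrite -inner_normE; exact: basis_inner_cvg. Qed.

Lemma basis_bessel x n : \sum_(i < n) inner x (e i) ^+ 2 <= `|x| ^+ 2.
Proof.
rewrite -(cvg_lim _ (basis_norm_cvg (x := x)))//.
apply: (nondecreasing_cvgn_le (u_ := fun n => \sum_(i < n) inner x (e i) ^+ 2)).
  by apply/nondecreasing_seqP => k; rewrite big_ord_recr/= lerDl sqr_ge0.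
by apply: cvgP; exact: basis_norm_cvg.
Qed.

Lemma basis_ext x y : (forall i, inner x (e i) = inner y (e i)) -> x = y.
Proof.
move=> xy; apply: inner_ext => h.
rewrite -(cvg_lim _ (basis_inner_cvg (x := x) (y := h)))//.
rewrite -(cvg_lim _ (basis_inner_cvg (x := y) (y := h)))//.
by congr (limn _); apply/funext => n; apply: eq_bigr => i _; rewrite xy.
Qed.

Lemma basis_inner_proj x n j : inner (proj n x) (e j) = if (j < n)%N then inner x (e j) else 0.
Proof.
rewrite /proj inner_suml (eq_bigr (fun i : 'I_n => inner x (e i) * (i == j :> nat)%:R)); last first.
  by move=> i _; rewrite innerZl basis_inner.
case: ltnP => [jn|nj].
  rewrite (bigD1 (Ordinal jn))//= eqxx mulr1 big1 ?addr0// => i.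
  by rewrite -val_eqE/= => /negbTE ->; rewrite mulr0.
by rewrite big1// => i _; rewrite ltn_eqF ?mulr0// (leq_trans (ltn_ord i)).
Qed.

Lemma basis_normB_proj x n :
  `|x - proj n x| ^+ 2 = `|x| ^+ 2 - \sum_(i < n) inner x (e i) ^+ 2.
Proof.
have px : inner x (proj n x) = \sum_(i < n) inner x (e i) ^+ 2.
  by rewrite innerC inner_suml; apply: eq_bigr => i _; rewrite innerZl (innerC (e i)) expr2.
have pp : inner (proj n x) (proj n x) = \sum_(i < n) inner x (e i) ^+ 2.
  rewrite {1}/proj inner_suml; apply: eq_bigr => i _.
  by rewrite innerZl (innerC (e i)) basis_inner_proj ltn_ord expr2.
rewrite -inner_normE innerBl !innerBr (innerC (proj n x) x) px pp inner_normE.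
by ring.
Qed.

Context {d : measure_display} {Omega : measurableType d} {P : probability Omega R}.
Variable Y : Omega -> H.
Hypothesis mY : forall h, measurable_fun setT (fun w => inner (Y w) h).

Lemma measurable_sqr_norm : measurable_fun setT (fun w => `|Y w| ^+ 2).
Proof.
apply: (measurable_fun_cvg (h := fun n w => \sum_(i < n) inner (Y w) (e i) ^+ 2)) => [n|w _].
  by apply: measurable_sum => i; exact: measurable_funX.
exact: basis_norm_cvg.
Qed.

Let measurable_sqrt : measurable_fun setT (@Num.sqrt R).
Proof. by apply: continuous_measurable_fun; exact: sqrt_continuous. Qed.

Lemma measurable_norm : measurable_fun setT (fun w => `|Y w|).
Proof.
rewrite (_ : (fun w => _) = Num.sqrt \o (fun w => `|Y w| ^+ 2)).
  by apply: measurableT_comp => //; exact: measurable_sqr_norm.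
by apply/funext => w; rewrite /= sqrtr_sqr normr_id.
Qed.

(* The coordinatewise means form a Cauchy series because
   [|S_n - S_p|^2 = E <Y_n - Y_p, S_n - S_p>] for the truncations [Y_n]. *)
Lemma expectation_exists : L1 P (fun w => `|Y w|) -> exists m, is_expectation P Y m.
Proof.
move=> iY.
have iI h : L1 P (fun w => inner (Y w) h).
  apply: (L1_le (mY h) (L1Z `|h| iY)) => w; rewrite mulrC; exact: inner_norm_le.
have mP n h : measurable_fun setT (fun w => inner (proj n (Y w)) h).
  rewrite (_ : (fun w => _) = fun w => \sum_(i < n) inner (Y w) (e i) * inner (e i) h).
    by apply: measurable_sum => i; exact: measurable_funM.
  by apply/funext => w; rewrite inner_suml; apply: eq_bigr => i _; rewrite innerZl.
have Ple n w : `|Y w - proj n (Y w)| <= `|Y w|.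
  rewrite -(@ler_pXn2r _ 2)// ?nnegrE// basis_normB_proj gerBl.
  by apply: sumr_ge0 => i _; exact: sqr_ge0.
have mR n : measurable_fun setT (fun w => `|Y w - proj n (Y w)|).
  rewrite (_ : (fun w => _) = Num.sqrt \o
      (fun w => `|Y w| ^+ 2 - \sum_(i < n) inner (Y w) (e i) ^+ 2)).
    apply: measurableT_comp => //; apply: measurable_funB; first exact: measurable_sqr_norm.
    by apply: measurable_sum => i; exact: measurable_funX.
  by apply/funext => w; rewrite /= -basis_normB_proj sqrtr_sqr normr_id.
have iR n : L1 P (fun w => `|Y w - proj n (Y w)|).
  by apply: (L1_le (mR n) iY) => w; rewrite normr_id.
have iP n h : L1 P (fun w => inner (proj n (Y w)) h).
  apply: (L1_le (mP n h) (L1Z `|h| (L1D iY iY))) => w.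
  rewrite (le_trans (inner_norm_le _ _))// mulrC ler_wpM2l//.
  rewrite -{1}(subKr (Y w) (proj n (Y w))) (le_trans (ler_normB _ _))//.
  by rewrite lerD2l.
pose S n := \sum_(i < n) mean P (fun w => inner (Y w) (e i)) *: e i.
have SE n h : inner (S n) h = mean P (fun w => inner (proj n (Y w)) h).
  rewrite (@eq_mean _ _ _ P _ (fun w => \sum_(i < n) inner (Y w) (e i) * inner (e i) h)); last first.
    by move=> w; rewrite inner_suml; apply: eq_bigr => i _; rewrite innerZl.
  rewrite inner_suml mean_sum => [|i _]; last exact: L1Zr.
  by apply: eq_bigr => i _; rewrite innerZl meanZr.
pose dist n := mean P (fun w => `|Y w - proj n (Y w)|).
have dist0 : dist @ \oo --> (0 : R).
  rewrite -(mean_cst P 0).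
  have [||_] := @mean_dct _ _ _ P (fun n w => `|Y w - proj n (Y w)|) (fun=> 0) _ mR _ iY.
  - move=> w; apply: (@cvg_trans _
        ((fun n => `|Y w - series (fun i => inner (Y w) (e i) *: e i) n|) @ \oo)).
      by apply: near_eq_cvg; apply: nearW => n; rewrite projE.
    rewrite -(normr0 H) -(subrr (Y w)); apply: cvg_norm; apply: cvgB; first exact: cvg_cst.
    exact: eB.2.
  - by move=> n w; rewrite normr_id.
  - by [].
have Sd n p : `|S n - S p| <= dist n + dist p.
  have key : `|S n - S p| ^+ 2 <= `|S n - S p| * (dist n + dist p).
    rewrite -inner_normE; set u := (X in inner _ X).
    have -> : inner u u = mean P (fun w => inner (proj n (Y w)) u - inner (proj p (Y w)) u).
      by rewrite meanB// -!SE -innerBl.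
    rewrite mulrC -meanD// -meanZr; last exact: L1D.
    apply: mean_le => [||w]; [exact: L1B|by apply: L1Zr; exact: L1D|].
    rewrite -innerBl (le_trans (ler_norm _))// (le_trans (inner_norm_le _ _))//.
    rewrite ler_wpM2r// -(subrKA (Y w)) (le_trans (ler_normD _ _))//.
    by rewrite distrC.
  have [->|n0] := eqVneq `|S n - S p| 0.
    by rewrite addr_ge0// mean_ge0.
  by rewrite -(ler_pM2l (x := `|S n - S p|)) -?expr2// lt_def n0/=.
have cS : cvgn S.
  apply: cauchy_cvg; apply/cauchy_ballP => eps eps0.
  have e2 : 0 < eps / 2 by rewrite divr_gt0.
  have /cvgrPdist_lt/(_ _ e2)[K _ KP] := dist0.
  exists (S @` [set n | (K <= n)%N], S @` [set n | (K <= n)%N]) => /=.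
    by split; exists K => // n Kn; exists n.
  move=> [_ _] /= [[n Kn <-] [p Kp <-]]; rewrite -ball_normE/=.
  rewrite (le_lt_trans (Sd n p))// (splitr eps).
  have dge k : 0 <= dist k by apply: mean_ge0 => w; exact: normr_ge0.
  by apply: ltrD; [move: (KP n Kn)|move: (KP p Kp)]; rewrite /= sub0r normrN ger0_norm.
exists (limn S); split => // h.
rewrite expectationE//; congr (_%:E).
have c1 : inner (S n) h @[n --> \oo] --> inner (limn S) h.
  by apply: (cvg_comp S (fun x => inner x h) cS); exact: inner_continuous.
rewrite -(cvg_lim (@Rhausdorff R) c1); apply/esym/cvg_lim; first exact: Rhausdorff.
apply/cvgrPdist_le => eps eps0.
have e1 : 0 < eps / (`|h| + 1) by rewrite divr_gt0// ltr_wpDl.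
have /cvgrPdist_le/(_ _ e1) := dist0; apply: filterS => n.
have d0 : 0 <= dist n by apply: mean_ge0 => w; exact: normr_ge0.
rewrite sub0r normrN (ger0_norm d0) => hn.
rewrite SE -meanB//; apply: (@le_trans _ _ (dist n * (`|h| + 1))); last first.
  by rewrite -ler_pdivlMr// ltr_wpDl.
rewrite -meanZr//; apply: mean_norm_le; [exact: L1B|exact: L1Zr|].
move=> w; rewrite -innerBl (le_trans (inner_norm_le _ _))// ler_wpM2l//.
by rewrite lerDl.
Qed.

Lemma hexpectationP : L1 P (fun w => `|Y w|) -> is_expectation P Y (hexpectation P Y).
Proof. by move=> /expectation_exists; exact: xgetPex. Qed.

End basis.

Lemma is_expectation_inner {d} {Omega : measurableType d} (P : probability Omega R)
  (Y : Omega -> H) m h : is_expectation P Y m -> mean P (fun w => inner (Y w) h) = inner m h.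
Proof. by move=> [_ /(_ h)] /(congr1 fine) /=; rewrite fine_expectation. Qed.

End hilbert.

(** * Hilbert-Schmidt bounds and eigenvalues from the modulus *)

Section trace_norm_bounds.
Context {R : realType} {H : hilbertType R}.
Variable v : nat -> H.
Hypothesis vB : orthonormal_basis v.
Variable T : H -> H.

Section modulus.
Variable A : {linear H -> H}.
Hypothesis AT : is_modulus T A.

Let AC x y : inner (A x) y = inner x (A y). Proof. by have [_ ->] := AT. Qed.
Let A0 x : 0 <= inner (A x) x. Proof. by have [] := AT. Qed.

Lemma modulus_cauchy_schwarz x y :
  inner (A x) y ^+ 2 <= inner (A x) x * inner (A y) y.
Proof.
pose a := inner (A x) x; pose b := inner (A x) y; pose c := inner (A y) y.
have q (t : R) : 0 <= a + 2 * t * b + t ^+ 2 * c.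
  have := A0 (x + t *: y); rewrite linearD linearZ/= innerDl !innerDr !innerZl !innerZr.
  by rewrite (AC y x) (innerC y) -/a -/b -/c; lra.
have [c0|c0] := eqVneq c 0.
  have [b0|b0] := eqVneq b 0; first by rewrite -/b b0 expr0n mulr_ge0.
  (* With [c = 0] and [b] nonzero the expression is affine in [t], and at this [t] it would equal
     -1. *)
  have := q (- ((a + 1) / (2 * b))); rewrite c0 mulr0 addr0.
  by rewrite (_ : 2 * _ * b = - (a + 1)); [lra|field].
have cp : 0 < c by rewrite lt_def c0 A0.
have := q (- (b / c)).
rewrite (_ : a + _ + _ = (a * c - b ^+ 2) / c); last by field.
by rewrite pmulr_lge0 ?invr_gt0// subr_ge0.
Qed.

(** [|T v_i| = |A v_i|], and by Cauchy-Schwarz for the form of [A] the squared coordinates of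
    [A v_i] are at most [a_i * a_j], with [a_i] the diagonal of [A]. Summing over [j] and then over
    [i] gives the squared trace. *)
Lemma hs_le_trace n (t : R) : trace v A = t%:E ->
  \sum_(i < n) `|T (v i)| ^+ 2 <= t ^+ 2.
Proof.
move=> tE.
have psum k : \sum_(j < k) inner (A (v j)) (v j) <= t.
  rewrite -lee_fin -tE -sumEFin /trace -(big_mkord xpredT (fun j => (inner (A (v j)) (v j))%:E)).
  by apply: nneseries_lim_ge => j _ _; rewrite lee_fin.
have t0 : 0 <= t by apply: le_trans (psum 0); rewrite big_ord0.
have TA i : `|T (v i)| ^+ 2 <= inner (A (v i)) (v i) * t.
  have [_ _ _ AA] := AT.
  rewrite -inner_normE -AA AC inner_normE -(cvg_lim _ (basis_norm_cvg vB (x := A (v i))))//.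
  apply: limr_le; first by apply: cvgP; exact: (basis_norm_cvg vB).
  apply: nearW => k; apply: (@le_trans _ _ (inner (A (v i)) (v i) * \sum_(j < k) inner (A (v j)) (v j))).
    rewrite mulr_sumr; apply: ler_sum => j _; exact: modulus_cauchy_schwarz.
  by rewrite ler_wpM2l.
apply: (le_trans (ler_sum _ (fun (i : 'I_n) _ => TA i))).
rewrite -mulr_suml expr2; apply: ler_wpM2r => //; exact: psum.
Qed.

(* [(A + l)(A - l) v_j = 0] and [A + l] is injective. *)
Lemma modulus_eigen (lambda : nat -> R) : (forall j, 0 < lambda j) ->
  (forall j, T (v j) = lambda j *: v j) -> forall j, A (v j) = lambda j *: v j.
Proof.
move=> l0 Tv j; have [_ _ _ AA] := AT.
have AAj : A (A (v j)) = lambda j ^+ 2 *: v j.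
  apply: (basis_ext vB) => i; rewrite AA !Tv !innerZl innerZr (basis_inner vB).
  by have [->|_] := eqVneq j i; rewrite ?mulr1 ?mulr0// expr2.
pose z := A (v j) - lambda j *: v j.
have Az : A z = - (lambda j *: z).
  rewrite /z linearB linearZ/= AAj scalerBr scalerA -expr2.
  by rewrite opprB addrC.
have := A0 z; rewrite Az innerNl innerZl inner_normE oppr_ge0.
rewrite pmulr_rle0// => z2; apply/eqP; rewrite -subr_eq0 -/z -normr_eq0 -sqrf_eq0.
by rewrite eq_le z2 sqr_ge0.
Qed.

End modulus.

(** The square root is taken because [trace_norm] is an infimum of traces, not of their squares. A
    modulus of infinite trace satisfies the bound trivially. *)
Lemma sqrt_hs_le_trace_norm n :
  ((Num.sqrt (\sum_(i < n) `|T (v i)| ^+ 2))%:E <= trace_norm v T)%E.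
Proof.
apply: le_ereal_inf_tmp => _ [A AT <-].
case tE : (trace v A) => [t| |]; last 2 first.
- by rewrite leey.
- have : (0 <= trace v A)%E.
    by apply: nneseries_ge0 => j _ _; rewrite lee_fin; have [_ _ ->] := AT.
  by rewrite tE.
have t0 : 0 <= t.
  rewrite -lee_fin -tE.
  by apply: nneseries_ge0 => j _ _; rewrite lee_fin; have [_ _ ->] := AT.
rewrite lee_fin -(ger0_norm t0) -sqrtr_sqr ler_wsqrtr//.
exact: (hs_le_trace AT).
Qed.

Lemma hs_le_trace_norm2 n :
  ((\sum_(i < n) `|T (v i)| ^+ 2)%:E <= trace_norm v T ^+ 2)%E.
Proof.
have s0 : 0 <= \sum_(i < n) `|T (v i)| ^+ 2 by apply: sumr_ge0 => i _; exact: sqr_ge0.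
have q0 : (0 <= (Num.sqrt (\sum_(i < n) `|T (v i)| ^+ 2))%:E)%E by rewrite lee_fin sqrtr_ge0.
rewrite -[X in X%:E](sqr_sqrtr s0) EFin_expe !expe2.
by apply: lee_pmul => //; exact: sqrt_hs_le_trace_norm.
Qed.

(** A finite infimum supplies a modulus of finite trace, and [modulus_eigen] makes it diagonal with
    entries [lambda j]. *)
Lemma trace_class_eigen (lambda : nat -> R) : (forall j, 0 < lambda j) ->
  (forall j, T (v j) = lambda j *: v j) -> (trace_norm v T < +oo)%E ->
  cvgn (series lambda).
Proof.
move=> l0 Tv /ereal_inf_lt[_ [A AT <-]] tr.
have Av := modulus_eigen AT l0 Tv.
have lE : trace v A = (\sum_(0 <= j <oo) (lambda j)%:E)%E.
  by apply: eq_eseriesr => j _; rewrite Av innerZl (basis_inner vB) eqxx mulr1.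
have t0 : (0 <= trace v A)%E.
  by apply: nneseries_ge0 => j _ _; rewrite lee_fin; have [_ _ ->] := AT.
apply: nondecreasing_is_cvgn.
  by apply: nondecreasing_series => j _ _; exact: ltW.
exists (fine (trace v A)) => _ [n _ <-].
rewrite -lee_fin fineK ?ge0_fin_numE// lE /series/= -sumEFin.
by apply: nneseries_lim_ge => j _ _; rewrite lee_fin ltW.
Qed.

End trace_norm_bounds.

Lemma mean_indic {d} {T : measurableType d} {R : realType} (P : probability T R)
    (A : set T) : measurable A -> (mean P \1_A)%:E = P A.
Proof.
move=> mA; rewrite /mean /Rintegral integral_indic// setIT fineK//.
exact: fin_num_measure.
Qed.

(** * Laws and characteristic functions *)

Section law_of_charfun.
Context {d d' : measure_display} {R : realType}.
Context {T : measurableType d} {T' : measurableType d'}.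
Variables (P : probability T R) (P' : probability T' R) (Y : T -> R) (Y' : T' -> R).
Hypothesis mY : measurable_fun setT Y.
Hypothesis mY' : measurable_fun setT Y'.
Hypothesis Y2 : L1 P (fun w => Y w ^+ 2).
Hypothesis YY' : forall t b,
  mean P (fun w => cos (t * Y w + b)) = mean P' (fun w => cos (t * Y' w + b)).

(** The convergence criterion for a constant sequence, with the variables embedded as first
    coordinates of [l2]. *)
Lemma mean_comp_of_charfun (g : R -> R) : continuous g -> bounded_fun g ->
  mean P (g \o Y) = mean P' (g \o Y').
Proof.
move=> cg bg.
pose W w := l2_fin 1 (fun=> Y w); pose S w := l2_fin 1 (fun=> Y' w).
have WE w j : W w j = if j == 0 then Y w else 0 by rewrite /W l2_finE ltnS leqn0.
have SE w j : S w j = if j == 0 then Y' w else 0 by rewrite /S l2_finE ltnS leqn0.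
have mW j : measurable_fun setT (fun w => W w j).
  rewrite (_ : (fun w => _) = if j == 0 then Y else fun=> 0); first by case: ifP.
  by apply/funext => w; rewrite WE; case: ifP.
have mS j : measurable_fun setT (fun w => S w j).
  rewrite (_ : (fun w => _) = if j == 0 then Y' else fun=> 0); first by case: ifP.
  by apply/funext => w; rewrite SE; case: ifP.
have W2 j : L1 P (fun w => W w j ^+ 2).
  case: j => [|j]; first by apply: eq_L1 Y2 => w; rewrite WE.
  by apply: (eq_L1 _ (L1_cst P 0)) => w; rewrite WE expr0n.
pose m j := mean P (fun w => W w j ^+ 2).
have cm : cvgn (series m).
  apply: (cvgP (m 0)); apply: cvg_near_cst; exists 1%N => // -[//|n] _.
  rewrite /series/= big_mkord big_ord_recl big1 ?addr0// => i _.
  by rewrite /m (@eq_mean _ _ _ P _ (fun=> 0)) ?mean_cst// => z; rewrite WE expr0n.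
have key J (a : nat -> R) b : mean P (fun z => cos (\sum_(j < J) a j * W z j + b)) =
    mean P' (fun w => cos (\sum_(j < J) a j * S w j + b)).
  case: J => [|J].
    rewrite (@eq_mean _ _ _ P _ (fun=> cos b)) ?(@eq_mean _ _ _ P' _ (fun=> cos b)) ?mean_cst// => w.
      by rewrite big_ord0 add0r.
    by rewrite big_ord0 add0r.
  rewrite (@eq_mean _ _ _ P _ (fun w => cos (a 0 * Y w + b))); last first.
    by move=> w; rewrite big_ord_recl big1 ?addr0 ?WE// => i _; rewrite WE mulr0.
  rewrite (@eq_mean _ _ _ P' _ (fun w => cos (a 0 * Y' w + b))) ?YY'//.
  by move=> w; rewrite big_ord_recl big1 ?addr0 ?SE// => i _; rewrite SE mulr0.
pose f (x : l2 R) := g (x 0).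
have cf : continuous f.
  by move=> x; apply: (cvg_comp (fun x : l2 R => x 0) g); [exact: l2_coord_continuous|exact: cg].
have bf : bounded_fun f.
  by move: bg => [M [Mr MP]]; exists M; split => // N MN x _; exact: (MP N MN (x 0) I).
have := @l2_cvg_in_distribution R _ _ _ _ P P' (fun _ => W) S m (fun=> mW) mS _ (fun=> W2)
  (fun _ j => lexx _) cm f cf bf.
move=> H; have {}H : mean P (f \o W) @[_ --> \oo] --> mean P' (f \o S).
  by apply: H => J a b; rewrite key; exact: cvg_cst.
have := cvg_lim (@Rhausdorff R) H; rewrite lim_cst//.
have -> : g \o Y = f \o W by apply/funext => w; rewrite /f/= WE.
have -> : g \o Y' = f \o S by apply/funext => w; rewrite /f/= SE. by apply.
Qed.

(** Continuous functions that are 1 up to [x - n^-1] and 0 from [x] on; they tend to the indicator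
    of the open half line. *)
Let ramp (x : R) (n : nat) (y : R) := Num.min 1 (Num.max 0 (n%:R * (x - y))).

Let ramp_bounds x n y : 0 <= ramp x n y <= 1.
Proof. by rewrite /ramp le_min ler01 le_max lexx ge_min lexx. Qed.

Let ramp_continuous x n : continuous (ramp x n).
Proof.
move=> y; apply: (@continuous_min _ _ (fun=> 1) (fun z => Num.max 0 (n%:R * (x - z)))).
  exact: cvg_cst.
apply: (@continuous_max _ _ (fun=> 0) (fun z => n%:R * (x - z))); first exact: cvg_cst.
by apply: cvgM; [exact: cvg_cst|apply: cvgB; [exact: cvg_cst|exact: cvg_id]].
Qed.

Let ramp_cvg x y : ramp x n y @[n --> \oo] --> (\1_(`]-oo, x[%classic) y : R).
Proof.
rewrite indicE; case: (ltP y x) => yx.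
  rewrite mem_set/= ?in_itv//=.
  apply: cvg_near_cst; near=> n.
  have : 1 <= n%:R * (x - y).
    rewrite -ler_pdivrMr ?subr_gt0//; near: n; exact: nbhs_infty_ger.
  move=> h; rewrite /ramp.
  by apply/min_idPl; rewrite le_max h orbT.
rewrite memNset/= ?in_itv/= ?ltNge ?yx//.
apply: cvg_near_cst; apply: nearW => n; rewrite /ramp.
have h : n%:R * (x - y) <= 0 by rewrite mulr_ge0_le0// subr_le0.
by rewrite (max_idPl h); apply/min_idPr.
Unshelve. all: by end_near. Qed.

Let half_line {d0} {T0 : measurableType d0} (P0 : probability T0 R) (Y0 : T0 -> R) x :
  measurable_fun setT Y0 ->
  (mean P0 (ramp x n \o Y0) @[n --> \oo] --> mean P0 (\1_(Y0 @^-1` `]-oo, x[%classic) : T0 -> R)).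
Proof.
move=> mY0.
have [||||_ +] := @mean_dct _ _ _ P0 (fun n => ramp x n \o Y0)
  (\1_(Y0 @^-1` `]-oo, x[%classic) : T0 -> R) (fun=> 1).
- move=> n; apply: measurableT_comp => //.
  by apply: continuous_measurable_fun; exact: ramp_continuous.
- by move=> w; apply: ramp_cvg.
- exact: L1_cst.
- by move=> n w; have /andP[r0 r1] := ramp_bounds x n (Y0 w); rewrite /= ger0_norm.
- by [].
Qed.

(** Open half lines are stable under intersection and generate the Borel sets, so agreement on them,
    obtained from the ramps, is enough. *)
Lemma law_of_charfun (A : set R) : measurable A -> P (Y @^-1` A) = P' (Y' @^-1` A).
Proof.
have mpre (B : set R) : measurable B -> measurable (Y @^-1` B).
  by move=> mB; rewrite -[X in measurable X]setTI; exact: mY.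
have mpre' (B : set R) : measurable B -> measurable (Y' @^-1` B).
  by move=> mB; rewrite -[X in measurable X]setTI; exact: mY'.
have half x : P (Y @^-1` `]-oo, x[%classic) = P' (Y' @^-1` `]-oo, x[%classic).
  rewrite -!mean_indic; [|by apply: mpre'|by apply: mpre].
  congr (_%:E); have h := @half_line _ _ P Y x mY; have h' := @half_line _ _ P' Y' x mY'.
  rewrite -(cvg_lim (@Rhausdorff R) h) -(cvg_lim (@Rhausdorff R) h'); congr (limn _).
  apply/funext => n; apply: mean_comp_of_charfun.
    exact: ramp_continuous.
  exists 1; split => // M M1 y _ /=; have /andP[r0 r1] := ramp_bounds x n y.
  by rewrite ger0_norm// (le_trans r1)// ltW.
pose m1 : {measure set (measurableTypeR R) -> \bar R} := pushforward P (Y : T -> measurableTypeR R).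
pose m2 : {measure set (measurableTypeR R) -> \bar R} := pushforward P' (Y' : T' -> measurableTypeR R).
move=> mA; change (m1 mY A = m2 mY' A).
apply: (@measure_unique _ R (measurableTypeR R) (@RGenInftyO.G R) (fun n => `]-oo, n%:R[%classic) _ _ _ _ (m1 mY) (m2 mY') _ _ A mA) => //.
- exact: RGenInftyO.measurableE.
- move=> _ _ [x ->] [y ->]; exists (Num.min x y).
  by apply/seteqP; split => z /=; rewrite !in_itv/= lt_min => /andP.
- by move=> n; exists n%:R.
- rewrite -subTset => x _; exists (Num.trunc x).+1 => //=.
  by rewrite in_itv/=; exact: Num.Theory.truncnS_gt.
- by move=> _ [x ->]; exact: half.
- by move=> n; rewrite /m1 /= (le_lt_trans (probability_le1 P (mpre _ _)))// ltry.
Qed.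

End law_of_charfun.

Lemma gaussian_rv_of_charfun {d} {T : measurableType d} {R : realType}
    (P : probability T R) (Y : T -> R) (q : R) : 0 <= q -> measurable_fun setT Y ->
  L1 P (fun w => Y w ^+ 2) ->
  (forall t b, mean P (fun w => cos (t * Y w + b)) = cos b * expR (- (t ^+ 2 * q / 2))) ->
  gaussian_rv P Y.
Proof.
move=> q0 mY Y2 Yc; split => //; exists 0, q; split => // A mA.
have [_ _ _ gc] := gaussian_law0 q0.
apply: (@law_of_charfun _ _ _ _ (measurableTypeR R) P (gaussian_law 0 q) Y idfun) => //.
  exact: measurable_id.
by move=> t b; rewrite Yc -gc.
Qed.

(** * Cholesky factorization *)

Section cholesky.
Variable R : realType.
Implicit Types (C : nat -> nat -> R) (a : nat -> R).

Definition psd C : Prop :=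
  forall n a, 0 <= \sum_(j < n) \sum_(k < n) a j * a k * C j k.

(** The residual after eliminating the first [i] pivots. Since division by 0 gives 0, a zero pivot
    is skipped; by [psd_pivot0] its row vanishes already. *)
Fixpoint schur C i : nat -> nat -> R :=
  if i is i'.+1 then
    fun j k => schur C i' j k - schur C i' j i' * schur C i' k i' / schur C i' i' i'
  else C.

Definition cholesky C (j i : nat) : R := schur C i j i / Num.sqrt (schur C i i i).

Let sum_add_delta n i t a (F : nat -> R) :
  \sum_(j < n + i.+1) ((if (j < n)%N then a j else 0) + t * (j == i :> nat)%:R) * F j =
  \sum_(j < n) a j * F j + t * F i.
Proof.
rewrite (eq_bigr (fun j : 'I_(n + i.+1) => (if (j < n)%N then a j else 0) * F j +
    t * (j == i :> nat)%:R * F j)) => [|j _]; last by rewrite mulrDl.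
rewrite big_split/=; congr (_ + _).
  rewrite (big_ord_widen (n + i.+1) (fun j => a j * F j) (leq_addr _ _)).
  by rewrite [RHS]big_mkcond; apply: eq_bigr => j _; case: ifP => _; rewrite // mul0r.
have iN : (i < n + i.+1)%N by rewrite ltn_addl.
rewrite (bigD1 (Ordinal iN))//= eqxx mulr1 big1 ?addr0// => j.
by rewrite -val_eqE/= => /negbTE ->; rewrite mulr0 mul0r.
Qed.

(** Positivity at [a + t e_i]. The dimension [n + i.+1] makes room for the index [i] whether or not
    it is below [n]. *)
Lemma psd_add_delta C n i t a : (forall j k, C j k = C k j) -> psd C ->
  0 <= \sum_(j < n) \sum_(k < n) a j * a k * C j k +
    2 * t * (\sum_(j < n) a j * C j i) + t ^+ 2 * C i i.
Proof.
move=> CC Cp; pose b j := (if (j < n)%N then a j else 0) + t * (j == i)%:R.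
have := Cp (n + i.+1)%N b.
pose L j := \sum_(k < n) a k * C j k + t * C j i.
rewrite (eq_bigr (fun j : 'I_(n + i.+1) => b j * L j)) => [|j _]; last first.
  rewrite /L -(sum_add_delta n i t a (C j)) mulr_sumr.
  by apply: eq_bigr => k _; rewrite mulrA.
rewrite (sum_add_delta n i t a L) /L.
rewrite (eq_bigr (fun j : 'I_n => \sum_(k < n) a j * a k * C j k + a j * C j i * t)) => [|j _]; last first.
  rewrite mulrDr mulr_sumr; congr (_ + _); last by rewrite mulrCA mulrC.
  by apply: eq_bigr => k _; rewrite mulrA.
rewrite big_split/= -mulr_suml.
rewrite (eq_bigr (fun j : 'I_n => a j * C j i) (F1 := fun j : 'I_n => a j * C i j)) => [|j _]; last by rewrite CC.
by move: (\sum_(j < n) _) (\sum_(j < n) _) => A B; lra.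
Qed.

Lemma psd_pivot0 C i k : (forall j k, C j k = C k j) -> psd C ->
  C i i = 0 -> C k i = 0.
Proof.
move=> CC Cp Ci; have [//|k0] := eqVneq (C k i) 0.
have delta (F : nat -> R) : \sum_(j < k.+1) (j == k :> nat)%:R * F j = F k.
  rewrite big_ord_recr/= eqxx mul1r big1 ?add0r// => j _.
  by rewrite ltn_eqF ?mul0r//.
(* The form at [e_k + t e_i] is affine in [t] when [C i i = 0]; this [t] would give it the value
   -1. *)
have := @psd_add_delta C k.+1 i (- (C k k + 1) / (2 * C k i)) (fun j => (j == k)%:R) CC Cp.
rewrite /= Ci mulr0 addr0 (delta (C ^~ i)).
rewrite (eq_bigr (fun j : 'I_k.+1 => (j == k :> nat)%:R * C j k)) => [|j _]; last first.
  by rewrite -(delta (C j)) mulr_sumr; apply: eq_bigr => l _; rewrite mulrA.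
rewrite (delta (C ^~ k)) (_ : 2 * _ * _ = - (C k k + 1)); last by field.
by lra.
Qed.

Variable C : nat -> nat -> R.
Hypothesis CC : forall j k, C j k = C k j.
Hypothesis Cp : psd C.

Lemma schurC i j k : schur C i j k = schur C i k j.
Proof. by elim: i j k => [|i IHi] j k /=; rewrite ?(IHi j k) ?(mulrC (schur C i j i)); [exact: CC|]. Qed.

Lemma psd_diag D i : psd D -> (forall j k, D j k = D k j) -> 0 <= D i i.
Proof.
move=> Dp DD; have := @psd_add_delta D 0 i 1 (fun=> 0) DD Dp.
by rewrite !big_ord0; lra.
Qed.

(** Completing the square: the reduced form at [a] is the previous form at [a + t e_i] for the
    minimizing [t = - B / D i i]. *)
Lemma psd_schur i : psd (schur C i).
Proof.
elim: i => [//|i IHi] n a /=; set D := schur C i in IHi *.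
have DD j k : D j k = D k j by exact: schurC.
pose B := \sum_(j < n) a j * D j i.
have -> : \sum_(j < n) \sum_(k < n) a j * a k * (D j k - D j i * D k i / D i i) =
    \sum_(j < n) \sum_(k < n) a j * a k * D j k - B ^+ 2 / D i i.
  rewrite expr2 {1}/B !mulr_suml -sumrB; apply: eq_bigr => j _.
  rewrite /B mulr_sumr mulr_suml -sumrB; apply: eq_bigr => k _.
  by rewrite mulrBr; congr (_ - _); rewrite !mulrA; congr (_ / _); rewrite -!mulrA; congr (_ * _); rewrite mulrCA.
have [Di|Di] := eqVneq (D i i) 0; first by rewrite Di invr0 mulr0 subr0; exact: IHi.
have := @psd_add_delta D n i (- B / D i i) a DD IHi; rewrite -/B.
move: (\sum_(j < n) _) => A; rewrite (_ : A + _ + _ = A - B ^+ 2 / D i i)//.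
by field.
Qed.

Lemma schur_eq0 i j k : (j < i)%N -> schur C i j k = 0.
Proof.
elim: i j k => [//|i IHi] j k; rewrite ltnS leq_eqVlt => /predU1P[->|ji] /=; last first.
  by rewrite (IHi j k ji) (IHi j i ji) !mul0r subr0.
have [p0|p0] := eqVneq (schur C i i i) 0.
  by rewrite p0 invr0 mulr0 subr0 schurC psd_pivot0//; [exact: schurC|exact: psd_schur].
by rewrite (schurC i k) mulrAC divff// mul1r subrr.
Qed.

Lemma cholesky_upper j i : (j < i)%N -> cholesky C j i = 0.
Proof. by move=> ji; rewrite /cholesky schur_eq0// mul0r. Qed.

Lemma schurE n j k :
  schur C n j k = C j k - \sum_(i < n) cholesky C j i * cholesky C k i.
Proof.
elim: n => [|n IHn]; first by rewrite big_ord0 subr0.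
rewrite big_ord_recr/= opprD addrA -IHn; congr (_ - _).
rewrite /cholesky mulrACA -invfM -expr2 sqr_sqrtr//.
by apply: psd_diag; [exact: psd_schur|exact: schurC].
Qed.

(** The finite sum is exact because row [j] of the residual is 0 after [j.+1] eliminations. *)
Lemma choleskyP n j k : (j < n)%N ->
  \sum_(i < n) cholesky C j i * cholesky C k i = C j k.
Proof.
by move=> jn; apply/esym/eqP; rewrite -subr_eq0 -schurE schur_eq0.
Qed.

End cholesky.

Definition lagcov {R : realType} {d : measure_display} {T : measurableType d}
    (P : probability T R) (xi : int * nat -> T -> R) (i j : nat) (k : int) : R :=
  gcov P xi (0, i) (k, j).

(** * The coordinates of the process *)

Section hilbert_process.
Context {R : realType} {H : hilbertType R}.
Context {d : measure_display} {Omega : measurableType d} (P : probability Omega R).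
Variables (X : int -> {RV P >-> borel H}) (v : nat -> H) (lambda : nat -> R).
Hypothesis X_zero_mean : forall k : int, is_expectation P (X k) 0.
Hypothesis X_stationary : stationary P X.
Hypothesis X_gaussian : gaussian_process P X.
Hypothesis v_basis : orthonormal_basis v.
Hypothesis lambda_gt0 : forall j : nat, 0 < lambda j.
Hypothesis v_eigen : forall j : nat, cov_op P (X 1) (v j) = lambda j *: v j.
Hypothesis Gamma_summable :
  (\esum_(k in [set: int]) trace_norm v (autocov P X k) ^+ 2 < +oo)%E.

Definition coord (a : int * nat) (w : Omega) : R := inner (X a.1 w) (v a.2).

Local Notation rho := (lagcov P coord).

Lemma measurable_inner_borel (h : H) :
  measurable_fun setT (fun x : borel H => inner (x : H) h).
Proof.
apply: (measurability _ (RGenOpens.measurableE R)) => // _ [_ [a [b ->]] <-].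
rewrite setTI; apply: sub_sigma_algebra.
by move/continuousP: (@inner_continuous R H h); apply; exact: interval_open.
Qed.

Lemma measurable_inner_process (k : int) (h : H) :
  measurable_fun setT (fun w => inner (X k w : H) h).
Proof. exact: (measurableT_comp (measurable_inner_borel h)). Qed.

Lemma coord_gaussian : gaussian_family P coord.
Proof.
split=> [a|n t u].
  by rewrite /coord (is_expectation_inner (v a.2) (X_zero_mean a.1)) inner0l.
have := X_gaussian (fun i => (t i).1) (fun i => u i *: v (t i).2).
congr (gaussian_rv P _); apply/funext => w; apply: eq_bigr => i _.
by rewrite innerZr.
Qed.

(** Stationarity concerns laws of tuples; the product of two coordinates is a measurable function of
    the pair, so its mean is shift invariant. *)
Lemma gcov_stationary (k l s : int) i j :
  gcov P coord (k + s, i) (l + s, j) = gcov P coord (k, i) (l, j).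
Proof.
pose t (a : 'I_2) : int := if a == 0 then k else l.
pose f (b : 2.-tuple (borel H)) : R := inner (tnth b 0 : H) (v i) * inner (tnth b 1 : H) (v j).
have mf : measurable_fun setT f.
  by apply: measurable_funM; apply: (measurableT_comp (measurable_inner_borel _));
    exact: measurable_tnth.
have mY k' l' : measurable_fun setT (fun w => coord (k', i) w * coord (l', j) w).
  by apply: measurable_funM; exact: measurable_inner_process.
pose Y k' l' w := coord (k', i) w * coord (l', j) w.
have law (A : set R) : measurable A -> P (Y (k + s) (l + s) @^-1` A) = P (Y k l @^-1` A).
  move=> mA; have mB : measurable (f @^-1` A) by rewrite -[X in measurable X]setTI; exact: mf.
  have := @X_stationary 2 t s _ mB.
  congr (P _ = P _); apply/funext => w /=; congr (A _); rewrite /f !tnth_mktuple /t//=.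
have := @law_mean _ _ _ _ _ P P _ _ (mY (k + s) (l + s)) (mY k l) law idfun.
move=> /(_ (@measurable_id _ _ setT)); apply; exact: (gaussian_family_L1M coord_gaussian).
Qed.

Lemma gcov_rho (k l : int) i j : gcov P coord (k, i) (l, j) = rho i j (l - k).
Proof. by rewrite /lagcov -(gcov_stationary 0 (l - k) k) add0r subrK. Qed.

(** [cov_op] takes the value 0 where its expectation does not exist, so the nonzero vector
    [lambda i *: v i] certifies existence at [v i]. Deducing existence from the second moment of the
    norm would be circular, since that moment is computed from this lemma. *)
Lemma coord_cov0 (k : int) i j : gcov P coord (k, i) (k, j) = lambda i * (i == j)%:R.
Proof.
(* Stationarity moves the pair to time 1, where [v_eigen] applies. *)
rewrite gcov_rho subrr -(subrr (1 : int)) -gcov_rho.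
have vi0 : v i != 0 by rewrite -normr_eq0 (basis_norm v_basis) oner_eq0.
have ce : is_expectation P (fun w => tensor (X 1 w : H) (X 1 w) (v i)) (cov_op P (X 1) (v i)).
  apply: xgetPex; apply: contrapT => nex.
  have : cov_op P (X 1) (v i) = 0 by apply: xgetPN => m mP; apply: nex; exists m.
  move=> /eqP; rewrite v_eigen scaler_eq0 (negbTE vi0) orbF.
  by rewrite gt_eqF.
have := is_expectation_inner (v j) ce.
rewrite v_eigen innerZl (basis_inner v_basis) => <-; apply: eq_mean => w.
by rewrite /tensor innerZl innerC.
Qed.

Lemma trace_norm_autocov_fin (k : int) : (trace_norm v (autocov P X k) ^+ 2 < +oo)%E.
Proof.
apply: le_lt_trans Gamma_summable; apply: esum_ge.
by exists [set k]; [split => //; exact: finite_set1|rewrite fsbig_set1].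
Qed.

(** The autocovariance at lag 0 is the covariance operator of [X 1], and its trace norm is finite as
    a single term of the hypothesis. *)
Lemma eigenvalues_summable : cvgn (series lambda).
Proof.
apply: (@trace_class_eigen _ _ _ v_basis (autocov P X 0)) => //.
by rewrite ltNge leye_eq; apply/eqP => t; have := trace_norm_autocov_fin 0; rewrite t.
Qed.

Lemma L1_sqr_norm_process (k : int) : L1 P (fun w => `|X k w : H| ^+ 2).
Proof.
have xiG := coord_gaussian.
have i2 i : L1 P (fun w => coord (k, i) w ^+ 2) by exact: (gaussian_family_L2 xiG).
have [|||||//] := @mean_monotone _ _ _ P (fun n w => \sum_(i < n) coord (k, nat_of_ord i) w ^+ 2)
  (fun w => `|X k w : H| ^+ 2) (limn (series lambda)).
- by move=> n; apply: L1_sum => i _; exact: i2.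
- by move=> n w; apply: sumr_ge0 => i _; exact: sqr_ge0.
- by move=> n w; rewrite big_ord_recr/= lerDl sqr_ge0.
- by move=> w; exact: basis_norm_cvg.
- move=> n; rewrite mean_sum//.
  rewrite (eq_bigr (fun i : 'I_n => lambda i)) => [|i _]; last first.
    by have := coord_cov0 k i i; rewrite eqxx mulr1 => <-.
  rewrite -(big_mkord xpredT lambda).
  apply: (nondecreasing_cvgn_le (u_ := series lambda)); last exact: eigenvalues_summable.
  by apply: nondecreasing_series => j _ _; exact: ltW.
Qed.

(** Makes the trace norm hypothesis speak of coordinates. The Bochner expectation exists because
    [<X_1, v_i>] and the norm of [X (1 + k)] are square integrable. *)
Lemma autocovE (k : int) i j : inner (autocov P X k (v i)) (v j) = rho i j k.
Proof.
have mY h : measurable_fun setT (fun w => inner (tensor (X (1 + k) w : H) (X 1 w) (v i)) h).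
  rewrite (_ : (fun w => _) = fun w => inner (X 1 w : H) (v i) * inner (X (1 + k) w : H) h).
    by apply: measurable_funM; exact: measurable_inner_process.
  by apply/funext => w; rewrite /tensor innerZl (innerC (v i)).
have mN : measurable_fun setT (fun w => `|X (1 + k) w : H|).
  by apply: (measurable_norm v_basis) => h; exact: measurable_inner_process.
have iY : L1 P (fun w => `|tensor (X (1 + k) w : H) (X 1 w) (v i)|).
  apply: (@L1_le _ _ _ _ _ (fun w => `|inner (X 1 w : H) (v i) * `|X (1 + k) w : H| |)).
  - exact: (measurable_norm v_basis).
  - apply: L1_norm; apply: L1_mul => //.
    + exact: measurable_inner_process.
    + exact: (gaussian_family_L2 coord_gaussian (1, i)).
    + exact: L1_sqr_norm_process.
  - by move=> w; rewrite normr_id /tensor normrZ normrM normr_id (innerC (v i)).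
have := is_expectation_inner (v j) (hexpectationP v_basis mY iY).
rewrite -[X in inner X (v j)]/(autocov P X k (v i)) => <-.
rewrite /lagcov -(gcov_stationary 0 k 1) add0r (addrC k); apply: eq_mean => w.
by rewrite /tensor innerZl innerC.
Qed.

(** [K] is the sum in the hypothesis. At each lag Bessel's inequality bounds the inner sum by
    [|Gamma(k) v_i| ^+ 2], and the Hilbert-Schmidt norm is below the trace norm. Duplicate-free
    lists are the finite sets over which the [esum] is a supremum. *)
Lemma rho_sqr_summable : exists K : R, forall N (s : seq int), uniq s ->
  \sum_(k <- s) \sum_(i < N) \sum_(j < N) rho i j k ^+ 2 <= K.
Proof.
exists (fine (\esum_(k in [set: int]) trace_norm v (autocov P X k) ^+ 2)%E) => N s us.
have T0 k : (0 <= trace_norm v (autocov P X k) ^+ 2)%E.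
  by have := hs_le_trace_norm2 v_basis (autocov P X k) 0; rewrite big_ord0.
rewrite -lee_fin fineK; last first.
  by rewrite ge0_fin_numE//; apply: esum_ge0 => k _.
apply: esum_ge; exists [set` s]; first by split=> //; exact: finite_seq.
rewrite -fsbig_seq// -sumEFin; apply: lee_sum => k _.
apply: le_trans (hs_le_trace_norm2 v_basis (autocov P X k) N); rewrite lee_fin.
apply: ler_sum => i _; apply: le_trans (basis_bessel v_basis _ N).
by apply: ler_sum => j _; rewrite autocovE.
Qed.

End hilbert_process.

(** * Limit covariances *)

Section lagsum.
Variable R : realType.
Implicit Types F : int -> R.

Definition lagsum F (n : nat) : R := \sum_(0 <= k < n.*2.+1) F (k%:Z - n%:Z).

Lemma lagsumS F n : lagsum F n.+1 = lagsum F n + (F n.+1%:Z + F (- n.+1%:Z)).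
Proof.
rewrite /lagsum doubleS big_nat_recl// big_nat_recr//= sub0r [LHS]addrC -addrA; congr (_ + _).
  by apply: eq_bigr => k _; congr F; rewrite !intS; ring.
by congr (F _ + _); rewrite -addnn !intS PoszD; ring.
Qed.

Lemma lagsum_split F n :
  lagsum F n = F 0 + \sum_(1 <= k < n.+1) (F k%:Z + F (- k%:Z)).
Proof.
elim: n => [|n IHn]; first by rewrite /lagsum big_nat1 big_geq ?addr0// subrr.
by rewrite lagsumS IHn [in RHS]big_nat_recr//= -addrA.
Qed.

(** Enlarging the square by row and column [n] adds each lag from [- n] to [n] once. Divided by [n],
    the double sum is thus a Cesaro mean of symmetric partial sums. *)
Lemma square_sum_lag F n :
  \sum_(k < n) \sum_(l < n) F (l%:Z - k%:Z) = \sum_(m < n) lagsum F m.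
Proof.
elim: n => [|n IHn]; first by rewrite !big_ord0.
rewrite big_ord_recr/= [RHS]big_ord_recr/= -IHn.
under eq_bigr do rewrite big_ord_recr/=.
rewrite big_split/= -addrA; congr (_ + _).
rewrite lagsum_split big_add1 big_mkord big_split/= big_ord_recr/= subrr.
rewrite (reindex_inj rev_ord_inj)/= [RHS]addrC -[RHS]addrA; congr (_ + _).
  apply: eq_bigr => k _; congr F.
  by rewrite -subzn// opprB addrC subrK.
congr (_ + _); rewrite (reindex_inj rev_ord_inj)/=; apply: eq_bigr => k _; congr F.
by rewrite -subzn// addrAC subrr add0r.
Qed.

Lemma lagsum_nd F : (forall k, 0 <= F k) -> nondecreasing_seq (lagsum F).
Proof.
move=> F0; apply/nondecreasing_seqP => n.
by rewrite lagsumS lerDl addr_ge0.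
Qed.

Section summable.
Variables (F : int -> R) (M : R).
Hypothesis F0 : forall k, 0 <= F k.
Hypothesis FM : forall s : seq int, uniq s -> \sum_(k <- s) F k <= M.

Lemma lagsum_cvg : cvgn (lagsum F).
Proof.
apply: nondecreasing_is_cvgn; first exact: lagsum_nd.
exists M => _ [n _ <-].
rewrite /lagsum -(big_map (fun k : nat => k%:Z - n%:Z) xpredT F); apply: FM.
by rewrite map_inj_uniq ?iota_uniq// => a b /addIr [].
Qed.

Lemma lagsum_le n : lagsum F n <= limn (lagsum F).
Proof. by apply: nondecreasing_cvgn_le; [exact: lagsum_nd|exact: lagsum_cvg]. Qed.

Lemma summable_int : summable [set: int] (EFin \o F).
Proof.
rewrite /summable; apply: (@le_lt_trans _ _ M%:E); last exact: ltry.
apply: ge_ereal_sup => _ [s [fs _] <-].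
have [r ur ->] : exists2 r : seq int, uniq r & s = [set` r].
  by have /finite_seqP[r ->] := fs; exists (undup r); [exact: undup_uniq|apply/seteqP; split => x /=; rewrite mem_undup].
rewrite -fsbig_seq// (eq_bigr (fun k => (F k)%:E)) => [|k _].
  by rewrite sumEFin lee_fin; exact: FM.
by rewrite /= ger0_norm.
Qed.

Lemma square_mean_cvg :
  n%:R^-1 * \sum_(k < n) \sum_(l < n) F (l%:Z - k%:Z) @[n --> \oo] --> limn (lagsum F).
Proof.
have c := cesaro lagsum_cvg.
rewrite -cvg_shiftS; apply: cvg_trans c; apply: near_eq_cvg; apply: nearW => n.
by rewrite /arithmetic_mean /= square_sum_lag /series/= big_mkord.
Qed.

Lemma square_mean_le n :
  n%:R^-1 * \sum_(k < n) \sum_(l < n) F (l%:Z - k%:Z) <= limn (lagsum F).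
Proof.
case: n => [|n].
  rewrite big_ord0 mulr0; apply: le_trans (lagsum_le 0).
  by rewrite /lagsum big_nat1.
rewrite mulrC ler_pdivrMr ?ltr0n// square_sum_lag mulrC.
apply: (@le_trans _ _ (\sum_(m < n.+1) limn (lagsum F))).
  by apply: ler_sum => m _; exact: lagsum_le.
by rewrite sumr_const card_ord mulr_natl.
Qed.

End summable.
End lagsum.

Lemma cvgn_sum (R : realType) (I : Type) (r : seq I) (f : I -> nat -> R) (l : I -> R) :
  (forall i, f i n @[n --> \oo] --> l i) ->
  \sum_(i <- r) f i n @[n --> \oo] --> \sum_(i <- r) l i.
Proof.
move=> fl; elim: r => [|i r IHr].
  by rewrite big_nil; under eq_fun do rewrite big_nil; exact: cvg_cst.
by rewrite big_cons; under eq_fun do rewrite big_cons; apply: cvgD.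
Qed.

Section centered_square.
Context {d : measure_display} {T : measurableType d} {R : realType}.
Variables (P : probability T R) (I : Type) (xi : I -> T -> R).
Hypothesis xiG : gaussian_family P xi.

Definition csquare (a : I) (w : T) : R := xi a w ^+ 2 - gcov P xi a a.

Lemma measurable_csquare a : measurable_fun setT (csquare a).
Proof.
by apply: measurable_funB => //; apply: measurable_funX; exact: (gaussian_family_meas xiG).
Qed.

Lemma L1_csquare_sqr a : L1 P (fun w => csquare a w ^+ 2).
Proof.
apply: (@eq_L1 _ _ _ _ (fun w => xi a w ^+ 4 +
  (- (2 * gcov P xi a a) * xi a w ^+ 2 + gcov P xi a a ^+ 2))) => [w|].
  by rewrite /csquare; ring.
apply: L1D; first exact: (gaussian_family_L4 xiG).
by apply: L1D; [apply: L1Z; exact: (gaussian_family_L2 xiG)|exact: L1_cst].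
Qed.

Lemma mean_csquareM a b :
  mean P (fun w => csquare a w * csquare b w) = 2 * gcov P xi a b ^+ 2.
Proof.
have L2 c : L1 P (fun w => xi c w ^+ 2) by exact: (gaussian_family_L2 xiG).
rewrite (@eq_mean _ _ _ P _ (fun w => (xi a w * xi a w) * (xi b w * xi b w) -
    (gcov P xi b b * xi a w ^+ 2 + (gcov P xi a a * xi b w ^+ 2 -
      gcov P xi a a * gcov P xi b b)))); last by move=> w; rewrite /csquare; ring.
rewrite meanB; last 2 first.
- exact: (gaussian_family_L4M xiG).
- by apply: L1D; [exact: L1Z|apply: L1B; [exact: L1Z|exact: L1_cst]].
rewrite meanD; [|exact: L1Z|by apply: L1B; [exact: L1Z|exact: L1_cst]].
rewrite meanB; [|exact: L1Z|exact: L1_cst].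
rewrite mean_cst !meanZ// (isserlis xiG).
have E c : mean P (fun w => xi c w ^+ 2) = gcov P xi c c by apply: eq_mean => w; rewrite expr2.
by rewrite !E; ring.
Qed.

End centered_square.

(** * Normalized sums of a stationary Gaussian family *)

Section stationary_sequence.
Context {d : measure_display} {T : measurableType d} {R : realType}.
Variables (P : probability T R) (xi : int * nat -> T -> R) (K : R).
Hypothesis xiG : gaussian_family P xi.
Local Notation rho := (lagcov P xi).
Hypothesis xi_stat : forall (k l : int) i j, gcov P xi (k, i) (l, j) = rho i j (l - k).
Hypothesis rhoK : forall N (s : seq int), uniq s ->
  \sum_(k <- s) \sum_(i < N) \sum_(j < N) rho i j k ^+ 2 <= K.

Definition sqcov i j (k : int) : R := 2 * rho i j k ^+ 2.

Definition limcov i j : R := limn (lagsum (sqcov i j)).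

Lemma lagcovN i j k : rho i j (- k) = rho j i k.
Proof. by rewrite /lagcov gcovC xi_stat sub0r opprK. Qed.

Lemma sqcov_ge0 i j k : 0 <= sqcov i j k.
Proof. by rewrite mulr_ge0// sqr_ge0. Qed.

Lemma sqcov_sum_le i j (s : seq int) : uniq s -> \sum_(k <- s) sqcov i j k <= 2 * K.
Proof.
move=> us; rewrite -mulr_sumr ler_wpM2l//; apply: le_trans (rhoK (maxn i j).+1 us).
apply: ler_sum => k _.
have iN : (i < (maxn i j).+1)%N by rewrite ltnS leq_maxl.
have jN : (j < (maxn i j).+1)%N by rewrite ltnS leq_maxr.
rewrite (bigD1 (Ordinal iN))//= (bigD1 (Ordinal jN))//= -addrA lerDl.
by rewrite addr_ge0// !sumr_ge0// => a _; rewrite ?sqr_ge0// sumr_ge0// => b _; rewrite sqr_ge0.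
Qed.

(** The terms [i = j] of the double sum in [rhoK]. This is the finite trace of the limit covariance,
    on which tightness in [l2] rests. *)
Lemma limcov_le_sum N : \sum_(j < N) limcov j j <= 2 * K.
Proof.
have c j : lagsum (sqcov j j) @ \oo --> limcov j j.
  by apply: (@lagsum_cvg _ _ (2 * K)) => [k|s us]; [exact: sqcov_ge0|exact: sqcov_sum_le].
have cs : (fun n => \sum_(j < N) lagsum (sqcov j j) n) @ \oo --> \sum_(j < N) limcov j j.
  by apply: cvgn_sum => j; exact: c.
rewrite -(cvg_lim (@Rhausdorff R) cs); apply: limr_le; first by apply: cvgP; exact: cs.
apply: nearW => n; rewrite exchange_big/=.
pose s := [seq k%:Z - n%:Z | k <- index_iota 0 n.*2.+1].
have us : uniq s by rewrite map_inj_uniq ?iota_uniq// => a b /addIr [].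
rewrite -(big_map (fun k : nat => k%:Z - n%:Z) xpredT (fun k => \sum_(j < N) sqcov j j k)). rewrite -/s.
apply: (@le_trans _ _ (\sum_(k <- s) 2 * \sum_(i < N) \sum_(j < N) rho i j k ^+ 2)); last first.
  by rewrite -mulr_sumr ler_wpM2l//; exact: rhoK.
apply: ler_sum => k _; rewrite -mulr_sumr ler_wpM2l//; apply: ler_sum => i _.
by rewrite (bigD1 i)//= lerDl sumr_ge0// => b _; rewrite sqr_ge0.
Qed.

Lemma limcov_ge0 i j : 0 <= limcov i j.
Proof.
apply: le_trans (lagsum_le (sqcov_ge0 i j) (@sqcov_sum_le i j) 0).
by rewrite /lagsum big_nat1 sqcov_ge0.
Qed.

Lemma limcov_summable : cvgn (series (fun j => limcov j j)).
Proof.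
apply: nondecreasing_is_cvgn.
  by apply: nondecreasing_series => j _ _; exact: limcov_ge0.
by exists (2 * K) => _ [n _ <-]; rewrite /series/= big_mkord; exact: limcov_le_sum.
Qed.

(** Ordinals start at 0 and time at 1, hence the successor. *)
Definition shifted (a : nat * nat) : T -> R := xi (a.1.+1%:Z, a.2).

Definition normsum (n j : nat) (w : T) : R :=
  (Num.sqrt n%:R)^-1 * \sum_(k < n) csquare P shifted (k : nat, j) w.

Let zetaG : gaussian_family P shifted.
Proof. exact: (gaussian_family_comp (fun a : nat * nat => (a.1.+1%:Z, a.2)) xiG). Qed.

Lemma gcov_shifted k l i j : gcov P shifted (k, i) (l, j) = rho i j (l%:Z - k%:Z).
Proof. by rewrite -[LHS]/(gcov P xi (_, i) (_, j)) xi_stat !intS opprD addrACA subrr add0r. Qed.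

Lemma measurable_normsum n j : measurable_fun setT (normsum n j).
Proof.
by apply: measurable_funM => //; apply: measurable_sum => k; exact: measurable_csquare.
Qed.

Let L1_csM a b : L1 P (fun w => csquare P shifted a w * csquare P shifted b w).
Proof.
by apply: L1_mul; [exact: measurable_csquare|exact: measurable_csquare|exact: L1_csquare_sqr..].
Qed.

Let normsumM n i j w : normsum n i w * normsum n j w =
  n%:R^-1 * \sum_(k < n) \sum_(l < n) csquare P shifted (k : nat, i) w * csquare P shifted (l : nat, j) w.
Proof.
rewrite /normsum mulrACA -invfM -expr2 sqr_sqrtr// big_distrl; congr (_ * _).
by apply: eq_bigr => k _; rewrite big_distrr.
Qed.

Lemma L1_normsumM n i j : L1 P (fun w => normsum n i w * normsum n j w).
Proof.
apply: (eq_L1 (fun w => esym (normsumM n i j w))); apply: L1Z.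
by apply: L1_sum => k _; apply: L1_sum.
Qed.

Lemma mean_normsumM n i j : mean P (fun w => normsum n i w * normsum n j w) =
  n%:R^-1 * \sum_(k < n) \sum_(l < n) sqcov i j (l%:Z - k%:Z).
Proof.
rewrite (eq_mean _ (fun w => normsumM n i j w)) meanZ; last first.
  by apply: L1_sum => k _; apply: L1_sum.
congr (_ * _); rewrite mean_sum => [|k _]; last exact: L1_sum.
apply: eq_bigr => k _; rewrite mean_sum//; apply: eq_bigr => l _.
by rewrite mean_csquareM// gcov_shifted.
Qed.

Lemma mean_normsumM_cvg i j :
  mean P (fun w => normsum n i w * normsum n j w) @[n --> \oo] --> limcov i j.
Proof.
under eq_fun do rewrite mean_normsumM.
exact: (square_mean_cvg (sqcov_ge0 i j) (@sqcov_sum_le i j)).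
Qed.

Lemma mean_normsum_sqr_le n j : mean P (fun w => normsum n j w ^+ 2) <= limcov j j.
Proof.
rewrite (@eq_mean _ _ _ P _ (fun w => normsum n j w * normsum n j w)) => [|w]; last by rewrite expr2.
rewrite mean_normsumM.
exact: (square_mean_le (sqcov_ge0 j j) (@sqcov_sum_le j j)).
Qed.

Lemma limcovC i j : limcov i j = limcov j i.
Proof.
rewrite -(cvg_lim (@Rhausdorff R) (mean_normsumM_cvg (i := i) (j := j))).
rewrite -(cvg_lim (@Rhausdorff R) (mean_normsumM_cvg (i := j) (j := i))).
by congr (limn _); apply/funext => n; apply: eq_mean => w; rewrite mulrC.
Qed.

Let limcov_form_cvg J (a : nat -> R) :
  (fun n => \sum_(i < J) \sum_(j < J) a i * a j *
    mean P (fun w => normsum n i w * normsum n j w)) @ \oo -->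
  \sum_(i < J) \sum_(j < J) a i * a j * limcov i j.
Proof.
apply: cvgn_sum => i; apply: cvgn_sum => j; apply: cvgM; first exact: cvg_cst.
exact: mean_normsumM_cvg.
Qed.

(** A limit of second moment matrices of the [normsum n]. *)
Lemma limcov_psd : psd limcov.
Proof.
move=> J a; have c := @limcov_form_cvg J a.
rewrite -(cvg_lim (@Rhausdorff R) c); apply: limr_ge; first exact: (cvgP _ c).
apply: nearW => n; have LM i j := L1_normsumM n i j.
rewrite [leRHS](_ : _ = mean P (fun w => (\sum_(i < J) a i * normsum n i w) ^+ 2)).
  by apply: mean_ge0 => w; exact: sqr_ge0.
rewrite (@eq_mean _ _ _ P (fun w => (\sum_(i < J) a i * normsum n i w) ^+ 2)
  (fun w => \sum_(i < J) \sum_(j < J) a i * a j * (normsum n i w * normsum n j w))).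
  rewrite mean_sum => [|i _]; last by apply: L1_sum => j _; exact: L1Z.
  apply: eq_bigr => i _; rewrite mean_sum => [|j _]; last exact: L1Z.
  by apply: eq_bigr => j _; rewrite meanZ.
move=> w; rewrite expr2 big_distrl; apply: eq_bigr => i _.
by rewrite big_distrr; apply: eq_bigr => j _; rewrite /= mulrACA.
Qed.

Lemma normsum_charfun_cvg (J : nat) (a : nat -> R) (b : R) :
  mean P (fun w => cos (\sum_(j < J) a j * normsum n j w + b)) @[n --> \oo] -->
  cos b * expR (- ((\sum_(i < J) \sum_(j < J) a i * a j * limcov i j) / 2)).
Proof.
(* The Hilbert-Schmidt norm of the block of size [J] at lag [m]: it dominates every entry, and its
   squares sum to at most [K]. *)
pose r m := Num.sqrt (\sum_(i < J) \sum_(j < J) rho i j m%:Z ^+ 2).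
have s0 (m : int) : 0 <= \sum_(i < J) \sum_(j < J) rho i j m ^+ 2.
  by rewrite sumr_ge0// => i _; rewrite sumr_ge0// => j _; exact: sqr_ge0.
have r_ge m i j : (i < J)%N -> (j < J)%N -> `|rho i j m%:Z| <= r m.
  move=> iJ jJ; rewrite -sqrtr_sqr ler_wsqrtr//.
  rewrite (bigD1 (Ordinal iJ))//= (bigD1 (Ordinal jJ))//= -addrA lerDl.
  by rewrite addr_ge0// !sumr_ge0// => u _; rewrite ?sqr_ge0// sumr_ge0// => v _; rewrite sqr_ge0.
apply: (clt_quadratic zetaG (rho := r) (D := K)).
(* A negative lag is the transpose of a positive one, and [r] does not distinguish a block from its
   transpose. *)
- move=> k l i j iJ jJ; rewrite gcov_shifted /ndist; have [kl|/ltnW kl] := leqP k l.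
    by rewrite subzn// (eqP kl) add0n; exact: r_ge.
  by rewrite -opprB subzn// lagcovN (eqP kl) addn0; exact: r_ge.
- by move=> m; exact: sqrtr_ge0.
- move=> n; rewrite (eq_bigr (fun m : 'I_n => \sum_(i < J) \sum_(j < J) rho i j m%:Z ^+ 2)) => [|m _]; last first.
    by rewrite sqr_sqrtr.
  rewrite -(big_mkord xpredT (fun m => \sum_(i < J) \sum_(j < J) rho i j m%:Z ^+ 2)).
  rewrite -(big_map Posz xpredT (fun m => \sum_(i < J) \sum_(j < J) rho i j m ^+ 2)).
  by apply: rhoK; rewrite map_inj_uniq ?iota_uniq// => x y [].
- apply: cvg_trans (@limcov_form_cvg J a).
  apply: near_eq_cvg; apply: nearW => n.
  transitivity (\sum_(i < J) \sum_(j < J) \sum_(k < n) \sum_(l < n)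
      a i * a j * sqcov i j (l%:Z - k%:Z) / n%:R).
    apply: eq_bigr => i _; apply: eq_bigr => j _; rewrite mean_normsumM !mulr_sumr.
    apply: eq_bigr => k _; rewrite !mulr_sumr; apply: eq_bigr => l _.
    by rewrite mulrA mulrAC.
  under eq_bigr do rewrite exchange_big/=.
  rewrite exchange_big/= mulr_sumr; apply: eq_bigr => k _.
  under eq_bigr do rewrite exchange_big/=.
  rewrite exchange_big/= mulr_sumr; apply: eq_bigr => l _.
  rewrite mulr_sumr; apply: eq_bigr => i _; rewrite mulr_sumr; apply: eq_bigr => j _.
  by rewrite gcov_shifted /sqcov; ring.
Qed.

End stationary_sequence.

(** * Gaussian elements of l2 *)

Section modification.
Context {d : measure_display} {T : measurableType d} {R : realType}.
Variable P : probability T R.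

Lemma eq_law_on (A : set T) (Y Z : T -> R) : measurable A -> P (~` A) = 0%E ->
  measurable_fun setT Y -> measurable_fun setT Z -> (forall w, A w -> Y w = Z w) ->
  forall B : set R, measurable B -> P (Y @^-1` B) = P (Z @^-1` B).
Proof.
move=> mA PA mY mZ YZ B mB.
have mpre (U : T -> R) : measurable_fun setT U -> measurable (U @^-1` B).
  by move=> mU; rewrite -[X in measurable X]setTI; exact: mU.
have onA (U : T -> R) : measurable_fun setT U -> P (U @^-1` B) = P (U @^-1` B `&` A).
  move=> mU; rewrite (measureDI _ (mpre _ mU) mA) -[RHS]add0e; congr (_ + _)%E.
  apply/eqP; rewrite eq_le measure_ge0 andbT -PA le_measure ?inE//.
  - by apply: measurableD => //; exact: mpre.
  - exact: measurableC.
rewrite onA// [RHS]onA//; congr (P _); apply/seteqP.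
by split => w [/= UB Aw]; split=> //=; [rewrite -YZ|rewrite YZ].
Qed.

Lemma gaussian_rv_eq_law (Y Z : T -> R) : measurable_fun setT Z ->
  (forall B : set R, measurable B -> P (Y @^-1` B) = P (Z @^-1` B)) ->
  gaussian_rv P Y -> gaussian_rv P Z.
Proof.
by move=> mZ YZ [_ [m [q [q0 YG]]]]; split=> //; exists m, q; split=> // B mB; rewrite -YZ// YG.
Qed.

(** The sum of squares has finite mean, so it is finite outside a null set [N], on which the path is
    replaced by 0. *)
Lemma l2_modification (Y : nat -> T -> R) (m : nat -> R) :
  (forall j, measurable_fun setT (Y j)) -> (forall j, L1 P (fun w => Y j w ^+ 2)) ->
  (forall j, mean P (fun w => Y j w ^+ 2) <= m j) -> cvgn (series m) ->
  exists2 A : set T, measurable A /\ P (~` A) = 0%E &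
  exists S : T -> l2 R, forall w j, S w j = \1_A w * Y j w.
Proof.
move=> mY Y2 Ym cm.
have m0 j : 0 <= m j by apply: le_trans (Ym j); apply: mean_ge0 => w; exact: sqr_ge0.
pose Q w := (\sum_(0 <= j <oo) (Y j w ^+ 2)%:E)%E.
have mY2 j : measurable_fun setT (fun w => (Y j w ^+ 2)%:E).
  by apply/measurable_EFinP; exact: measurable_funX.
have Y20 j w : (0 <= (Y j w ^+ 2)%:E)%E by rewrite lee_fin sqr_ge0.
have Q0 w : (0 <= Q w)%E by apply: nneseries_ge0.
have iQ : P.-integrable setT Q.
  apply/integrableP; split; first exact: ge0_emeasurable_sum.
  rewrite (eq_integral Q) => [|w _]; last by rewrite gee0_abs.
  rewrite integral_nneseries//.
  apply: (@le_lt_trans _ _ (limn (series m))%:E); last exact: ltry.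
  apply: lime_le; first by apply: is_cvg_nneseries => j _ _; exact: integral_ge0.
  apply: nearW => n; apply: (@le_trans _ _ (series m n)%:E).
    rewrite /series/= -sumEFin; apply: lee_sum => j _.
    have := expectationE (Y2 j); rewrite unlock => ->.
    by rewrite lee_fin.
  rewrite lee_fin; apply: nondecreasing_cvgn_le => //.
  by apply: nondecreasing_series => j _ _.
have [N [mN PN NQ]] := integrable_ae measurableT iQ.
exists (~` N); first by split; [exact: measurableC|rewrite setCK].
(* The indicator makes the sequence square summable at every [w], so [insubd] never returns its
   default. *)
exists (fun w => insubd (0 : l2 R) (fun j => \1_(~` N) w * Y j w)) => w j.
suff sq : (fun j => \1_(~` N) w * Y j w) \in @square_summable R.
  by rewrite -[LHS]/(val (insubd (0 : l2 R) _) j) val_insubd sq.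
apply/square_summableP; rewrite indicE; have [Nw|Nw] := pselect (N w).
  rewrite memNset; last exact.
  rewrite (_ : series _ = cst 0); first exact: is_cvg_cst.
  by apply/funext => n; rewrite /series/= big1// => i _; rewrite mul0r expr0n.
rewrite mem_set//.
have Qf : Q w \is a fin_num.
  by apply: contrapT => Qw; apply: Nw; apply: NQ => /= /(_ I).
apply: nondecreasing_is_cvgn.
  by apply: nondecreasing_series => k _ _; exact: sqr_ge0.
exists (fine (Q w)) => _ [n _ <-].
rewrite -lee_fin fineK// /series/= -sumEFin.
under eq_bigr do rewrite mul1r.
exact: nneseries_lim_ge.
Qed.

End modification.

Section l2_basis.
Variable R : realType.

Lemma l2_inner_basis (x : l2 R) j : inner x (l2_basis R j) = x j.
Proof.
apply: (cvg_lim (@Rhausdorff R)); apply: cvg_near_cst; exists j.+1 => // n /= jn.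
rewrite /series/= big_mkord (bigD1 (Ordinal jn))//= eqxx mulr1 big1 ?addr0// => i.
by rewrite -val_eqE/= => /negbTE ->; rewrite mulr0.
Qed.

Lemma l2_orthonormal_basis : orthonormal_basis (l2_basis R).
Proof.
split=> [i j|x]; first by rewrite l2_inner_basis/= eq_sym.
have fE n : series (fun i => inner x (l2_basis R i) *: l2_basis R i) n = l2_fin n x.
  by rewrite /series/= big_mkord; apply: eq_bigr => i _; rewrite l2_inner_basis.
apply/cvgrPdist_le => e e0.
have e2 : 0 < e ^+ 2 by rewrite exprn_gt0.
have /cvgrPdist_le/(_ _ e2) := @l2_sqr_norm_cvg R x; apply: filterS => n.
have E : `|x - l2_fin n x| ^+ 2 = `|x| ^+ 2 - \sum_(k < n) x k ^+ 2.
  have xf : inner x (l2_fin n x) = \sum_(k < n) x k ^+ 2.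
    rewrite innerC inner_suml; apply: eq_bigr => k _.
    by rewrite innerZl innerC l2_inner_basis expr2.
  rewrite -inner_normE innerBl !innerBr (innerC (l2_fin n x)) xf !inner_normE.
  by rewrite l2_fin_sqr_norm; ring.
rewrite -E ger0_norm ?sqr_ge0// fE => h.
by rewrite -(ler_pXn2r (n := 2)) ?nnegrE ?normr_ge0 ?(ltW e0).
Qed.

End l2_basis.

Section triangular.
Context {d : measure_display} {T : measurableType d} {R : realType}.
Variables (P : probability T R) (eta : nat -> T -> R) (L : nat -> nat -> R).
Hypothesis etaG : gaussian_family P eta.
Hypothesis eta1 : forall i j, gcov P eta i j = (i == j)%:R.
Hypothesis L0 : forall j i, (j < i)%N -> L j i = 0.

(** A lower triangular [L] makes each coordinate a finite combination, hence a member of the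
    Gaussian family without any passage to the limit. *)
Definition triangular (j : nat) (w : T) : R := \sum_(i < j.+1) L j i * eta i w.

Lemma triangular_widen N j w : (j < N)%N -> triangular j w = \sum_(i < N) L j i * eta i w.
Proof.
move=> jN; rewrite /triangular (big_ord_widen N (fun i => L j i * eta i w) jN) big_mkcond.
apply: eq_bigr => i _; case: ltnP => // ji.
by rewrite L0// mul0r.
Qed.

Lemma triangular_gaussian : gaussian_family P triangular.
Proof.
split=> [j|n t u]; first exact: (mean_linear etaG).
pose N := (\max_(a < n) t a).+1.
have tN a : (t a < N)%N by rewrite ltnS; exact: leq_bigmax.
have := etaG.2 N (@nat_of_ord N) (fun i => \sum_(a < n) u a * L (t a) i).
congr (gaussian_rv P _); apply/funext => w.
under [RHS]eq_bigr do rewrite (triangular_widen _ (tN _)) mulr_sumr.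
rewrite [RHS]exchange_big; apply: eq_bigr => i _.
by rewrite mulr_suml; apply: eq_bigr => a _; rewrite mulrA.
Qed.

Lemma triangular_gcov N j k : (j < N)%N -> (k < N)%N ->
  gcov P triangular j k = \sum_(i < N) L j i * L k i.
Proof.
move=> jN kN; have i2 a b := gaussian_family_L1M etaG a b.
rewrite /gcov (@eq_mean _ _ _ P _ (fun w => \sum_(i < N) \sum_(l < N)
    L j i * L k l * (eta i w * eta l w))) => [|w]; last first.
  rewrite (triangular_widen w jN) (triangular_widen w kN) big_distrl; apply: eq_bigr => i _.
  by rewrite big_distrr; apply: eq_bigr => l _; rewrite /= mulrACA.
rewrite mean_sum => [|i _]; last by apply: L1_sum => l _; exact: L1Z.
apply: eq_bigr => i _; rewrite mean_sum => [|l _]; last exact: L1Z.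
rewrite (bigD1 i)//= meanZ// -/(gcov P eta i i) eta1 eqxx mulr1 big1 ?addr0// => l li.
by rewrite meanZ// -/(gcov P eta i l) eta1 eq_sym val_eqE (negbTE li) mulr0.
Qed.

End triangular.

(* Restricting to an event of full probability makes the sample paths square
   summable without changing the laws. *)
Lemma gaussian_l2_exists {d : measure_display} {T : measurableType d} {R : realType}
    (P : probability T R) (eta : nat -> T -> R) (C : nat -> nat -> R) :
  gaussian_family P eta -> (forall i j, gcov P eta i j = (i == j)%:R) ->
  (forall i j, C i j = C j i) -> psd C -> cvgn (series (fun j => C j j)) ->
  exists S : T -> l2 R, gaussian_family P (fun j w => S w j) /\
    forall i j, gcov P (fun j w => S w j) i j = C i j.
Proof.
move=> etaG eta1 CC Cp Cs.
pose Y := triangular eta (cholesky C).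
have L0 := cholesky_upper CC Cp.
have YG : gaussian_family P Y by exact: triangular_gaussian.
have YC i j : gcov P Y i j = C i j.
  have iN : (i < (maxn i j).+1)%N by rewrite ltnS leq_maxl.
  have jN : (j < (maxn i j).+1)%N by rewrite ltnS leq_maxr.
  by rewrite (triangular_gcov etaG eta1 L0 iN jN) choleskyP.
have mY := gaussian_family_meas YG.
have [|A [mA PA] [S SE]] := l2_modification mY (gaussian_family_L2 YG) _ Cs.
  by move=> j; rewrite -YC /gcov (@eq_mean _ _ _ P _ (fun w => Y j w * Y j w)) => [//|w]; rewrite expr2.
have mS j : measurable_fun setT (fun w => S w j).
  rewrite (_ : (fun w => _) = fun w => \1_A w * Y j w); last exact/funext.
  by apply: measurable_funM => //; exact: measurable_indic.
have SA w j : A w -> Y j w = S w j.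
  by move=> Aw; rewrite SE indicE mem_set// mul1r.
have mean_SA (f g : T -> R) : measurable_fun setT f -> measurable_fun setT g ->
    L1 P f -> (forall w, A w -> f w = g w) -> mean P f = mean P g.
  move=> mf mg f1 fg.
  have := @law_mean _ _ _ _ _ P P f g mf mg (eq_law_on mA PA mf mg fg) idfun.
  by move=> /(_ (@measurable_id _ _ setT)); apply.
exists S; split; first split.
- move=> j; rewrite -(mean_SA (Y j))//; [exact: YG.1|exact: (gaussian_family_L1 YG)|].
  by move=> w; exact: SA.
- move=> n t u.
  have mU : measurable_fun setT (fun w => \sum_(i < n) u i * S w (t i)).
    by apply: measurable_sum => i; exact: measurable_funM.
  have mV : measurable_fun setT (fun w => \sum_(i < n) u i * Y (t i) w).
    by apply: measurable_sum => i; exact: measurable_funM.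
  apply: (gaussian_rv_eq_law mU _ (YG.2 n t u)).
  by apply: (eq_law_on mA PA) => // w Aw; apply: eq_bigr => i _; rewrite SA.
move=> i j; rewrite -YC; apply/esym/mean_SA.
- exact: measurable_funM.
- exact: measurable_funM.
- exact: (gaussian_family_L1M YG).
- by move=> w Aw; rewrite !SA.
Qed.

Section gaussian_l2.
Context {d : measure_display} {T : measurableType d} {R : realType}.
Variables (P : probability T R) (S : T -> l2 R).
Local Notation xi := (fun j w => S w j).
Hypothesis SG : gaussian_family P xi.
Hypothesis Sc : cvgn (series (fun j => gcov P xi j j)).

Let mS j : measurable_fun setT (fun w => S w j).
Proof. exact: (gaussian_family_meas SG). Qed.

Let S2 j : L1 P (fun w => S w j ^+ 2).
Proof. exact: (gaussian_family_L2 SG). Qed.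

Let mI (h : l2 R) : measurable_fun setT (fun w => inner (S w) h).
Proof. by apply: (measurable_l2_continuous (f := fun x => inner x h)) => //; exact: inner_continuous. Qed.

Let mN : measurable_fun setT (fun w => `|S w|).
Proof. exact: (measurable_norm (l2_orthonormal_basis R)). Qed.

Let N2 : L1 P (fun w => `|S w| ^+ 2).
Proof.
have [|||||//] := @mean_monotone _ _ _ P (fun n w => \sum_(j < n) S w j ^+ 2)
  (fun w => `|S w| ^+ 2) (limn (series (fun j => gcov P xi j j))).
- by move=> n; apply: L1_sum => j _; exact: S2.
- by move=> n w; apply: sumr_ge0 => j _; exact: sqr_ge0.
- by move=> n w; rewrite big_ord_recr/= lerDl sqr_ge0.
- by move=> w; exact: l2_sqr_norm_cvg.
- move=> n; rewrite mean_sum => [|j _]; last exact: S2.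
  have E j : mean P (fun w => S w j ^+ 2) = gcov P xi j j.
    by apply: eq_mean => w; rewrite expr2.
  under eq_bigr do rewrite E.
  rewrite -(big_mkord xpredT (fun j => gcov P xi j j)).
  apply: (nondecreasing_cvgn_le (u_ := series (fun j => gcov P xi j j))) => //.
  apply: nondecreasing_series => j _ _; rewrite -E; apply: mean_ge0 => w; exact: sqr_ge0.
Qed.

Let N1 : L1 P (fun w => `|S w|).
Proof. exact: L1_sqr. Qed.

Section functional.
Variable h : l2 R.

Let Y n w := \sum_(j < n) h j * S w j.

Let YE w : Y n w @[n --> \oo] --> inner (S w) h.
Proof.
have := basis_inner_cvg (l2_orthonormal_basis R) (x := S w) (y := h).
apply: cvg_trans; apply: near_eq_cvg; apply: nearW => n.
by apply: eq_bigr => j _; rewrite !l2_inner_basis mulrC.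
Qed.

Let mY n : measurable_fun setT (Y n).
Proof. by apply: measurable_sum => j; exact: measurable_funM. Qed.

Let Y_le n w : `|Y n w| <= `|h| * `|S w|.
Proof.
have -> : Y n w = inner (S w) (l2_fin n h).
  rewrite innerC inner_suml; apply: eq_bigr => j _.
  by rewrite innerZl innerC l2_inner_basis.
rewrite (le_trans (inner_norm_le _ _))// mulrC ler_wpM2r//.
by rewrite -(ler_pXn2r (n := 2)) ?nnegrE// l2_fin_sqr_norm l2_psum_norm.
Qed.

Lemma mean_inner_gaussian_l2 : mean P (fun w => inner (S w) h) = 0.
Proof.
have [_ c] := mean_dct mY YE (L1Z `|h| N1) Y_le.
rewrite -(cvg_lim (@Rhausdorff R) c); apply: (cvg_lim (@Rhausdorff R)).
apply: cvg_near_cst; apply: nearW => n.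
exact: (mean_linear SG (@nat_of_ord n) (fun j => h j)).
Qed.

(** The truncations of [h] give Gaussian variables whose variances converge by domination with
    [|h| ^+ 2 * |S w| ^+ 2]; the characteristic functions then have a Gaussian limit, which fixes
    the law. *)
Lemma gaussian_rv_inner_l2 : gaussian_rv P (fun w => inner (S w) h).
Proof.
have YE2 w : Y n w ^+ 2 @[n --> \oo] --> inner (S w) h ^+ 2.
  by rewrite expr2; under eq_fun do rewrite expr2; apply: cvgM.
have Y2_le n w : `|Y n w ^+ 2| <= `|h| ^+ 2 * `|S w| ^+ 2.
  by rewrite normrX -exprMn ler_pXn2r ?nnegrE ?mulr_ge0.
have [I2 c2] := mean_dct (fun n => measurable_funX 2 (mY n)) YE2 (L1Z (`|h| ^+ 2) N2) Y2_le.
apply: (@gaussian_rv_of_charfun _ _ _ _ _ (mean P (fun w => inner (S w) h ^+ 2))) => //.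
  by apply: mean_ge0 => w; exact: sqr_ge0.
move=> t b.
have [||||_ c] := @mean_dct _ _ _ P (fun n w => cos (t * Y n w + b))
  (fun w => cos (t * inner (S w) h + b)) (fun=> 1).
- by move=> n; exact: measurable_cos_affine.
- move=> w; apply: (cvg_comp (fun n => t * Y n w + b) cos); last exact: continuous_cos.
  by apply: cvgD; [apply: cvgM => //; exact: cvg_cst|exact: cvg_cst].
- exact: L1_cst.
- by move=> n w; exact: cos_max.
rewrite -(cvg_lim (@Rhausdorff R) c); apply: (cvg_lim (@Rhausdorff R)).
have E n : mean P (fun w => cos (t * Y n w + b)) =
    cos b * expR (- (t ^+ 2 * mean P (fun w => Y n w ^+ 2) / 2)).
  rewrite (gaussian_linear_charfun SG (@nat_of_ord n) (fun j => h j)).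
  by rewrite -(mean_linear_sqr SG (@nat_of_ord n) (fun j => h j)).
rewrite (_ : _ \o _ = fun n => cos b * expR (- (t ^+ 2 * mean P (fun w => Y n w ^+ 2) / 2))); last first.
  by apply/funext => n; exact: E.
apply: cvgM; first exact: cvg_cst.
apply: (cvg_comp (fun n => - (t ^+ 2 * mean P (fun w => Y n w ^+ 2) / 2)) expR).
  apply: cvgN; apply: cvgM; last exact: cvg_cst.
  by apply: cvgM; [exact: cvg_cst|exact: c2].
exact: continuous_expR.
Qed.

End functional.

Lemma gaussian_element_l2 : gaussian_element P (H := l2 R) S.
Proof. by move=> h; exact: gaussian_rv_inner_l2. Qed.

Lemma is_expectation_l2 : is_expectation P (H := l2 R) S 0.
Proof.
split; first exact: N1.
move=> h; rewrite expectationE ?mean_inner_gaussian_l2 ?inner0l//.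
apply: (L1_le (mI h) (L1Z `|h| N1)) => w; rewrite mulrC; exact: inner_norm_le.
Qed.

Lemma cov_op_l2 i j :
  inner (cov_op P (H := l2 R) S (l2_basis R i)) (l2_basis R j) = gcov P xi i j.
Proof.
have mT h : measurable_fun setT (fun w => inner (tensor (S w) (S w) (l2_basis R i)) h).
  rewrite (_ : (fun w => _) = fun w => S w i * inner (S w) h).
    exact: measurable_funM.
  by apply/funext => w; rewrite /tensor innerZl innerC l2_inner_basis.
have iT : L1 P (fun w => `|tensor (S w) (S w) (l2_basis R i)|).
  apply: (@L1_le _ _ _ _ _ (fun w => `|S w| ^+ 2)) => //.
    exact: (measurable_norm (l2_orthonormal_basis R)).
  move=> w; rewrite normr_id /tensor innerC l2_inner_basis normrZ expr2 ler_wpM2r//.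
  exact: l2_coord_norm.
have := is_expectation_inner (l2_basis R j) (hexpectationP (l2_orthonormal_basis R) mT iT).
rewrite -[X in inner X _]/(cov_op P (H := l2 R) S (l2_basis R i)) => <-.
apply: eq_mean => w; rewrite /tensor innerZl !l2_inner_basis; congr (_ * _).
by rewrite innerC l2_inner_basis.
Qed.

End gaussian_l2.

(** Each term is at most the whole sum, so the squares are bounded by a multiple of the terms. *)
Lemma square_summable_of_summable (R : realType) (u : nat -> R) :
  (forall j, 0 <= u j) -> cvgn (series u) -> u \in @square_summable R.
Proof.
move=> u0 cu.
have uM n : \sum_(j < n) u j <= limn (series u).
  rewrite -(big_mkord xpredT u); apply: (nondecreasing_cvgn_le (u_ := series u)) => //.
  by apply: nondecreasing_series => j _ _.
apply/square_summableP; apply: nondecreasing_is_cvgn.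
  by apply: nondecreasing_series => k _ _; exact: sqr_ge0.
exists (limn (series u) * limn (series u)) => _ [n _ <-]; rewrite /series/= big_mkord.
have uj j : u j <= limn (series u).
  by apply: le_trans (uM j.+1); rewrite big_ord_recr/= lerDr sumr_ge0.
apply: (@le_trans _ _ (\sum_(j < n) limn (series u) * u j)).
  by apply: ler_sum => j _; rewrite expr2 ler_wpM2r.
by rewrite -mulr_sumr ler_wpM2l// (le_trans (u0 0)).
Qed.

Lemma cvg_in_distributionP {d d' : measure_display} {Omega : measurableType d}
    {Omega' : measurableType d'} {R : realType} (P : probability Omega R)
    (P' : probability Omega' R) (V : topologicalType)
    (Z : nat -> Omega -> V) (S : Omega' -> V) :
  (forall n f, continuous f -> measurable_fun setT (f \o Z n : Omega -> R)) ->
  (forall f, continuous f -> measurable_fun setT (f \o S : Omega' -> R)) ->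
  (forall f : V -> R, continuous f -> bounded_fun f ->
    mean P (f \o Z n) @[n --> \oo] --> mean P' (f \o S)) ->
  cvg_in_distribution P Z P' S.
Proof.
move=> mZ mS ZS f cf bf.
have [M Mf] : exists M, forall x, `|f x| <= M.
  by have [M [_ MP]] := bf; exists (M + 1) => x; apply: (MP (M + 1)); rewrite ?ltrDl.
have iZ n : L1 P (f \o Z n) by apply: (L1_bounded P (M := M)) => [|w]; [exact: mZ|exact: Mf].
have iS : L1 P' (f \o S) by apply: (L1_bounded P' (M := M)) => [|w]; [exact: mS|exact: Mf].
rewrite (expectationE iS); under eq_fun do rewrite (expectationE (iZ _)).
by apply: cvg_EFin; [exact: nearW|exact: ZS].
Qed.

(** * The central limit theorem for the eigenvalues *)

Section eigenvalue_clt.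
Context {R : realType} {H : hilbertType R}.
Context {d : measure_display} {Omega : measurableType d} (P : probability Omega R).
Variables (X : int -> {RV P >-> borel H}) (v : nat -> H) (lambda : nat -> R).
Hypothesis X_zero_mean : forall k : int, is_expectation P (X k) 0.
Hypothesis X_stationary : stationary P X.
Hypothesis X_gaussian : gaussian_process P X.
Hypothesis v_basis : orthonormal_basis v.
Hypothesis lambda_gt0 : forall j : nat, 0 < lambda j.
Hypothesis v_eigen : forall j : nat, cov_op P (X 1) (v j) = lambda j *: v j.
Hypothesis Gamma_summable :
  (\esum_(k in [set: int]) trace_norm v (autocov P X k) ^+ 2 < +oo)%E.

Local Notation xi := (coord X v).
Local Notation C := (limcov P xi).

Let xiG : gaussian_family P xi := coord_gaussian v X_zero_mean X_gaussian.
Let xi_stat := gcov_rho v X_zero_mean X_stationary X_gaussian.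
Let xi_cov0 := coord_cov0 X_zero_mean X_stationary X_gaussian v_basis lambda_gt0 v_eigen.

Let rhoK : exists K : R, forall N (s : seq int), uniq s ->
  \sum_(k <- s) \sum_(i < N) \sum_(j < N) lagcov P xi i j k ^+ 2 <= K.
Proof. exact: (rho_sqr_summable X_zero_mean X_stationary X_gaussian v_basis lambda_gt0 v_eigen Gamma_summable). Qed.

Lemma G_covE i j k l : G_cov P X v lambda i j k l = 2 * gcov P xi (k, i) (l, j) ^+ 2.
Proof.
rewrite /G_cov fine_expectation -(mean_csquareM xiG); apply: eq_mean => w.
by rewrite /csquare !xi_cov0 !eqxx !mulr1.
Qed.

Lemma G_cov_sqcov i j k l : G_cov P X v lambda i j k l = sqcov P xi i j (l - k).
Proof. by rewrite G_covE xi_stat. Qed.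

Lemma sqcov_lagsum_cvg i j : lagsum (sqcov P xi i j) @ \oo --> C i j.
Proof.
by have [K rK] := rhoK; apply: (lagsum_cvg (sqcov_ge0 P xi i j) (sqcov_sum_le rK i j)).
Qed.

Lemma G_cov_has_sumZ i j : has_sumZ (G_cov P X v lambda i j 0) (C i j).
Proof.
have -> : G_cov P X v lambda i j 0 = sqcov P xi i j.
  by apply/funext => k; rewrite G_cov_sqcov subr0.
have [K rK] := rhoK; split; last exact: sqcov_lagsum_cvg.
exact: (summable_int (sqcov_ge0 P xi i j) (sqcov_sum_le rK i j)).
Qed.

(** For [i = j] the lags [k] and [- k] contribute equally, so the one-sided sum is half of [C j j]
    without the term of lag 0. The pair of times 1 and [k.+1] has lag [k]. *)
Lemma G_cov_sum_cvg j :
  \sum_(1 <= k < n) G_cov P X v lambda j j 1 k.+1%:Z @[n --> \oo] -->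
  (C j j - G_cov P X v lambda j j 1 1) / 2.
Proof.
rewrite -cvg_shiftS; apply: (@cvg_trans _
  ((fun n => (lagsum (sqcov P xi j j) n - G_cov P X v lambda j j 1 1) / 2) @ \oo)).
  apply: near_eq_cvg; apply: nearW => n /=.
  rewrite lagsum_split G_cov_sqcov subrr addrC addrA addNr add0r.
  rewrite mulr_suml; apply: eq_bigr => k _.
  rewrite G_cov_sqcov (_ : sqcov P xi j j (- k%:Z) = sqcov P xi j j k); last first.
    by rewrite /sqcov (lagcovN xi_stat).
  have -> (a : R) : (a + a) / 2 = a by field.
  by congr sqcov; rewrite intS addrAC subrr add0r.
apply: cvgM; last exact: cvg_cst.
by apply: cvgB; [exact: sqcov_lagsum_cvg|exact: cvg_cst].
Qed.

Lemma sigma2E j : sigma2 P X v lambda j = C j j.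
Proof.
by rewrite /sigma2 (cvg_lim (@Rhausdorff R) (@G_cov_sum_cvg j)); field.
Qed.

Definition eigval_error (n : nat) (w : Omega) (j : nat) : R :=
  Num.sqrt n%:R * (eigval_hat X v n j w - lambda j).

(** Holds at every sample point: the squared coordinates of [X k w] are summable by Parseval and the
    eigenvalues by the trace class condition, and a summable nonnegative sequence is square
    summable. *)
Lemma eigval_error_square_summable n w : eigval_error n w \in @square_summable R.
Proof.
have sX (k : int) : (fun j => inner (X k w : H) (v j) ^+ 2) \in @square_summable R.
  apply: square_summable_of_summable => [j|]; first exact: sqr_ge0.
  apply: (cvgP (`|X k w : H| ^+ 2)); apply: cvg_trans (basis_norm_cvg v_basis (x := X k w)).
  by apply: near_eq_cvg; apply: nearW => m; rewrite /series/= big_mkord.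
have sl : lambda \in @square_summable R.
  apply: square_summable_of_summable => [j|]; first exact: ltW.
  exact: (eigenvalues_summable v_basis lambda_gt0 v_eigen Gamma_summable).
have sF : \sum_(1 <= k < n.+1) (fun j => inner (X k%:Z w : H) (v j) ^+ 2) \in @square_summable R.
  by apply: rpred_sum => k _; exact: sX.
rewrite (_ : eigval_error n w = Num.sqrt n%:R *: (n%:R^-1 *:
  (\sum_(1 <= k < n.+1) (fun j => inner (X k%:Z w : H) (v j) ^+ 2)) - lambda)).
  by apply: rpredZ; apply: rpredB => //; exact: rpredZ.
apply/funext => j; rewrite /eigval_error /eigval_hat.
rewrite -[RHS]/(Num.sqrt n%:R * (n%:R^-1 *
  (\sum_(1 <= k < n.+1) (fun j => inner (X k%:Z w : H) (v j) ^+ 2)) j - lambda j)).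
by rewrite fct_sumE.
Qed.

Definition eigval_error_l2 (n : nat) (w : Omega) : l2 R :=
  L2 (eigval_error_square_summable n w).

Lemma eigval_error_normsum n w j : eigval_error n w j = normsum P xi n j w.
Proof.
rewrite /eigval_error /eigval_hat /normsum /csquare.
(* For [n = 0] both sides are 0, through the square root on the left and the inverse of 0 on the
   right. *)
have [->|n0] := posnP n; first by rewrite sqrtr0 mul0r invr0 mul0r.
have nR : Num.sqrt n%:R != 0 :> R by rewrite sqrtr_eq0 -ltNge ltr0n.
have nE : n%:R = Num.sqrt n%:R ^+ 2 :> R by rewrite sqr_sqrtr.
rewrite sumrB.
rewrite [X in _ = _ * (_ - X)](eq_bigr (fun=> lambda j)) => [|k _]; last first.
  by rewrite [LHS](xi_cov0 _ j j) eqxx mulr1.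
rewrite sumr_const card_ord -[lambda j *+ n]mulr_natl big_add1/= big_mkord.
set s := (X in _ * (_ * X - _)); rewrite [X in _ = _ * (X - _)](_ : _ = s)//.
by move: nR nE; move: (Num.sqrt n%:R) => q q0 ->; field.
Qed.

Lemma measurable_eigval_error n j : measurable_fun setT (fun w => eigval_error n w j).
Proof.
rewrite (_ : (fun w => _) = normsum P xi n j).
  exact: (measurable_normsum xiG).
by apply/funext => w; exact: eigval_error_normsum.
Qed.

Lemma measurable_eigval_error_l2 n :
  measurable_fun setT (eigval_error_l2 n : Omega -> borel (l2 R)).
Proof. by apply: measurable_l2 => j; exact: measurable_eigval_error. Qed.

(** The directions at time 1 are uncorrelated with positive variances; standardized, they supply the
    orthonormal Gaussian sequence [eta] on [Omega] itself. *)
Lemma limit_exists : exists S : Omega -> l2 R,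
  gaussian_family P (fun j w => S w j) /\
  forall i j, gcov P (fun j w => S w j) i j = C i j.
Proof.
have [K rK] := rhoK.
pose eta j w := (Num.sqrt (lambda j))^-1 * xi (1, j) w.
apply: (@gaussian_l2_exists _ _ _ P eta).
- split=> [j|n t u].
    by rewrite meanZ ?(xiG.1 (1, j)) ?mulr0//; exact: (gaussian_family_L1 xiG).
  have := xiG.2 n (fun a => (1, t a)) (fun a => u a * (Num.sqrt (lambda (t a)))^-1).
  by congr (gaussian_rv P _); apply/funext => w; apply: eq_bigr => a _; rewrite mulrA.
- move=> i j; rewrite /gcov (@eq_mean _ _ _ P _ (fun w =>
    (Num.sqrt (lambda i))^-1 * (Num.sqrt (lambda j))^-1 * (xi (1, i) w * xi (1, j) w))); last first.
    by move=> w; rewrite /eta mulrACA.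
  rewrite meanZ; last exact: (gaussian_family_L1M xiG).
  rewrite -/(gcov P xi (1, i) (1, j)) xi_cov0; have [->|_] := eqVneq i j; last by rewrite !mulr0.
  by rewrite mulr1 -invfM -expr2 sqr_sqrtr ?mulVf// ?gt_eqF// ltW.
- exact: (limcovC xiG xi_stat rK).
- exact: (limcov_psd xiG xi_stat rK).
- exact: (limcov_summable rK).
Qed.

Section limit.
Variable S : Omega -> l2 R.
Hypothesis SG : gaussian_family P (fun j w => S w j).
Hypothesis SC : forall i j, gcov P (fun j w => S w j) i j = C i j.

Lemma mean_eigval_error_cvg (f : l2 R -> R) : continuous f -> bounded_fun f ->
  mean P (f \o eigval_error_l2 n) @[n --> \oo] --> mean P (f \o S).
Proof.
move=> cf bf; have [K rK] := rhoK.
apply: (@l2_cvg_in_distribution R _ _ _ _ P P eigval_error_l2 S (fun j => C j j)) => //.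
- by move=> n j; exact: measurable_eigval_error.
- by move=> j; exact: (gaussian_family_meas SG).
- move=> J a b.
  have -> : mean P (fun w => cos (\sum_(j < J) a j * S w j + b)) =
      cos b * expR (- ((\sum_(i < J) \sum_(j < J) a i * a j * C i j) / 2)).
    have := gaussian_linear_charfun SG (@nat_of_ord J) (fun j => a j) 1 b.
    rewrite expr1n mul1r.
    under [X in cos b * expR (- (X / 2))]eq_bigr do under eq_bigr do rewrite SC.
    by move=> <-; apply: eq_mean => w; rewrite mul1r.
  apply: cvg_trans (@normsum_charfun_cvg _ _ _ P xi K xiG xi_stat rK J a b).
  apply: near_eq_cvg; apply: nearW => n; apply: eq_mean => w; congr (cos (_ + _)).
  by apply: eq_bigr => j _; rewrite -eigval_error_normsum.
- move=> n j; apply: (eq_L1 _ (L1_normsumM xiG n j j)) => w.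
  by rewrite -eigval_error_normsum expr2.
- move=> n j; have := mean_normsum_sqr_le xiG xi_stat rK n j.
  by under eq_mean do rewrite -eigval_error_normsum.
- exact: (limcov_summable rK).
Qed.

Lemma eigval_error_l2_cvg_in_distribution : cvg_in_distribution P eigval_error_l2 P S.
Proof.
apply: cvg_in_distributionP => [n f cf|f cf|f cf bf]; last exact: mean_eigval_error_cvg.
- by apply: measurable_l2_continuous => // j; exact: measurable_eigval_error.
- by apply: measurable_l2_continuous => // j; exact: (gaussian_family_meas SG).
Qed.

(** A function of one coordinate is continuous on [l2], so this follows from the convergence there;
    the coordinate of [S] has the centred Gaussian law with variance [C j j]. *)
Lemma eigval_error_cvg_in_distribution j :
  cvg_in_distribution P (fun n w => eigval_error n w j) (gaussian_law 0 (C j j)) idfun.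
Proof.
apply: cvg_in_distributionP => [n f cf|f cf|f cf bf].
- apply: measurableT_comp; last exact: measurable_eigval_error.
  exact: continuous_measurable_fun.
- exact: continuous_measurable_fun.
have cj : continuous (fun x : l2 R => f (x j)).
  by move=> x; apply: (cvg_comp (fun x : l2 R => x j) f); [exact: l2_coord_continuous|exact: cf].
have bj : bounded_fun (fun x : l2 R => f (x j)).
  by move: bf => [M [Mr MP]]; exists M; split => // N MN x _; exact: (MP N MN (x j) I).
have mf : measurable_fun setT f by exact: continuous_measurable_fun.
have mS : measurable_fun setT (fun w => S w j) by exact: (gaussian_family_meas SG).
have [_ _ _ law] := gaussian_rv0 (gaussian_family_rv SG j) (SG.1 j).
have q : mean P (fun w => S w j ^+ 2) = C j j.
  by rewrite -SC; apply: eq_mean => w; rewrite expr2.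
rewrite q in law.
have fS : L1 P (f \o (fun w => S w j)).
  have [M [_ MP]] := bf.
  apply: (L1_bounded P (M := M + 1)) => [|w]; first exact: measurableT_comp.
  by apply: (MP (M + 1)); rewrite ?ltrDl.
rewrite -[X in _ --> X](@law_mean _ _ _ (measurableTypeR R) _ P (gaussian_law 0 (C j j)) _ idfun mS (@measurable_id _ _ setT) law f mf fS).
exact: (mean_eigval_error_cvg cj bj).
Qed.

End limit.
End eigenvalue_clt.

Theorem mainTheorem6 (R : realType) (H : hilbertType R)
    (d : measure_display) (Omega : measurableType d) (P : probability Omega R)
    (X : int -> {RV P >-> borel H}) (v : nat -> H) (lambda : nat -> R)
    (H_separable : separable H)
    (X_zero_mean : forall k : int, is_expectation P (X k) 0)
    (X_stationary : stationary P X)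
    (X_gaussian : gaussian_process P X)
    (Q_nondegenerate : forall x : H, cov_op P (X 1) x = 0 -> x = 0)
    (v_basis : orthonormal_basis v)
    (lambda_gt0 : forall j : nat, 0 < lambda j)
    (v_eigen : forall j : nat, cov_op P (X 1) (v j) = lambda j *: v j)
    (Gamma_summable :
      (\esum_(k in [set: int]) trace_norm v (autocov P X k) ^+ 2 < +oo)%E) :
  (forall j : nat,
     cvgn (fun n => \sum_(1 <= k < n) G_cov P X v lambda j j 1 (k.+1)%:Z) /\
     cvg_in_distribution P
       (fun n w => Num.sqrt n%:R * (eigval_hat X v n j w - lambda j))
       (gaussian_law 0 (sigma2 P X v lambda j)) idfun) /\
  (exists (Z : nat -> {RV P >-> borel (l2 R)})
          (d' : measure_display) (Omega' : measurableType d')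
          (P' : probability Omega' R) (S : {RV P' >-> borel (l2 R)}),
     (forall n w j,
        (Z n w : l2 R) j = Num.sqrt n%:R * (eigval_hat X v n j w - lambda j)) /\
     gaussian_element P' (H := l2 R) S /\
     is_expectation P' (H := l2 R) S 0 /\
     (forall i j : nat,
        has_sumZ (fun k : int => G_cov P X v lambda i j 0 k)
          (inner (cov_op P' (H := l2 R) S (l2_basis R i)) (l2_basis R j))) /\
     cvg_in_distribution P (fun n w => Z n w : l2 R) P' (S : Omega' -> l2 R)).
Proof.
have [S [SG SC]] := limit_exists X_zero_mean X_stationary X_gaussian v_basis lambda_gt0
  v_eigen Gamma_summable.
have [K rK] := rho_sqr_summable X_zero_mean X_stationary X_gaussian v_basis lambda_gt0
  v_eigen Gamma_summable.
have Sc : cvgn (series (fun j => gcov P (fun j w => S w j) j j)).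
  by under eq_fun do rewrite SC; exact: (limcov_summable rK).
split=> [j|].
  split.
    apply: cvgP; exact: (G_cov_sum_cvg X_zero_mean X_stationary X_gaussian v_basis
      lambda_gt0 v_eigen Gamma_summable).
  rewrite (sigma2E X_zero_mean X_stationary X_gaussian v_basis lambda_gt0 v_eigen Gamma_summable).
  exact: (eigval_error_cvg_in_distribution X_zero_mean X_stationary X_gaussian v_basis
      lambda_gt0 v_eigen Gamma_summable SG SC).
pose Z n := eigval_error_l2 v_basis lambda_gt0 v_eigen Gamma_summable n.
have mZ n : (Z n : Omega -> borel (l2 R)) \in mfun.
  by apply: mem_set; exact: (measurable_eigval_error_l2 X_zero_mean X_stationary X_gaussian).
have mS : (S : Omega -> borel (l2 R)) \in mfun.
  by apply: mem_set; apply: measurable_l2 => j; exact: (gaussian_family_meas SG).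
(* The limit lives on the sample space of the process. *)
exists (fun n => mfun_Sub (mZ n)), d, Omega, P, (mfun_Sub mS).
split; first by [].
split; first exact: gaussian_element_l2.
split; first exact: is_expectation_l2.
split.
  move=> i j; rewrite (cov_op_l2 SG Sc) SC.
  exact: (G_cov_has_sumZ X_zero_mean X_stationary X_gaussian v_basis
      lambda_gt0 v_eigen Gamma_summable).
exact: eigval_error_l2_cvg_in_distribution.
Qed.
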